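(* Let $2<n<\omega$, let $\mathsf{K}$ be any variety between $\mathsf{Sc}$ and $\mathsf{QEA}$, and let $n+3\le m<\omega$. Then $\mathsf{RK}_n$ is not atom-canonical with respect to $\mathbf{S}\mathsf{Nr}_n\mathsf{K}_m$; that is, there is an atomic $\mathfrak{D}\in\mathsf{RK}_n$ such that $\mathfrak{Cm}\,\mathsf{At}\,\mathfrak{D}\notin \mathbf{S}\mathsf{Nr}_n\mathsf{K}_m$. In fact, there is a countable atomic simple $\mathfrak{A}\in\mathsf{RQEA}_n$ such that $\mathfrak{Rd}_{sc}\,\mathfrak{Cm}\,\mathsf{At}\,\mathfrak{A}$ does not have an $(n+3)$-square representation, and a fortiori does not have an $(n+3)$-flat representation.
   Context: Below $\alpha$ is an ordinal and $i,j,k,l<\alpha$. $[i|j]$ is the map on $\alpha$ sending $i$ to $j$ and fixing everything else; $[i,j]$ is the transposition of $i$ and $j$. **$\mathsf{Sc}_\alpha$** (Pinter's substitution algebras): algebras $\langle A,+,\cdot,-,0,1,\mathsf c_i,\mathsf s_i^j\rangle_{i,j<\alpha}$, where $\mathsf s_i^j$ corresponds to the replacement $[i|j]$, with a Boolean reduct and satisfying: $\mathsf c_i0=0$; $x\le \mathsf c_ix$; $\mathsf c_i(x\cdot \mathsf c_iy)=\mathsf c_ix\cdot \mathsf c_iy$; $\mathsf c_i\mathsf c_jx=\mathsf c_j\mathsf c_ix$; $\mathsf s_i^ix=x$; each $\mathsf s_i^j$ is a Boolean endomorphism; $\mathsf s_i^j\mathsf c_ix=\mathsf c_ix$; $\mathsf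 c_i\mathsf s_i^jx=\mathsf s_i^jx$ if $i\ne j$; $\mathsf s_i^j\mathsf c_kx=\mathsf c_k\mathsf s_i^jx$ if $k\notin\{i,j\}$; $\mathsf c_i\mathsf s_j^ix=\mathsf c_j\mathsf s_i^jx$; $\mathsf s_j^i\mathsf s_l^kx=\mathsf s_l^k\mathsf s_j^ix$ if $|\{i,j,k,l\}|=4$; $\mathsf s_l^i\mathsf s_j^lx=\mathsf s_l^i\mathsf s_j^ix$. **$\mathsf{QEA}_\alpha$** (quasi-polyadic equality algebras): algebras $\langle A,+,\cdot,-,0,1,\mathsf c_i,\mathsf s_i^j,\mathsf s_{[i,j]},\mathsf d_{ij}\rangle_{i,j<\alpha}$ with a Boolean reduct satisfying: $\mathsf s_i^ix=\mathsf s_{[i,i]}x=x$; $\mathsf s_{[i,j]}=\mathsf s_{[j,i]}$; $x\le\mathsf c_ix$; $\mathsf c_i(x+y)=\mathsf c_ix+\mathsf c_iy$; $\mathsf s_i^j\mathsf c_ix=\mathsf c_ix$; $\mathsf c_i\mathsf s_i^jx=\mathsf s_i^jx$ if $i\neq j$; $\mathsf s_i^j\mathsf c_kx=\mathsf c_k\mathsf s_i^jx$ if $k\notin\{i,j\}$; $\mathsf s_i^j$ and $\mathsf s_{[i,j]}$ are Boolean endomorphisms; $\mathsf s_{[i,j]}\mathsf s_{[i,j]}x=x$; $\mathsf s_{[i,j]}\mathsf s_{[i,k]}x=\mathsf s_{[j,k]}\mathsf s_{[i,j]}x$ if $i,j,k$ are distinct; $\mathsf s_{[i,j]}\mathsf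 s_i^jx=\mathsf s_j^ix$; $\mathsf s_i^j\mathsf d_{ij}=1$; $x\cdot\mathsf d_{ij}\le\mathsf s_i^jx$. **Varieties between $\mathsf{Sc}$ and $\mathsf{QEA}$**: $\mathsf K$ gives, for each dimension $\alpha$, a variety $\mathsf K_\alpha$ whose signature contains that of $\mathsf{Sc}_\alpha$ (the operations $\mathsf s_i^j$ being allowed to be term-definable, as in cylindric algebras by $\mathsf s_i^jx=\mathsf c_i(x\cdot\mathsf d_{ij})$ for $i\ne j$) and is contained in that of $\mathsf{QEA}_\alpha$, such that all equations holding in $\mathsf{Sc}_\alpha$ hold in $\mathsf K_\alpha$ and all equations holding in $\mathsf K_\alpha$ hold in $\mathsf{QEA}_\alpha$. **Representability**: for a set $U$, the concrete operations on $\wp({}^nU)$ are $\mathsf C_iX=\{s:\exists t\in X,\ t(j)=s(j)\ \forall j\ne i\}$, $\mathsf D_{ij}=\{s:s_i=s_j\}$, $\mathsf S_{[i|j]}X=\{s:s\circ[i|j]\in X\}$ (interpreting $\mathsf s_i^j$), $\mathsf S_{[i,j]}X=\{s:s\circ[i,j]\in X\}$, together with the Boolean operations. $\mathsf{RK}_n$ (in particular $\mathsf{RQEA}_n$) is the class of algebras isomorphic to subdirect products of subalgebras of such full set algebras in the signature of $\mathsf K_n$. **Neat reducts**: for $n<m$ and $\mathfrak B\in\mathsf K_m$, $\mathfrak{Nr}_n\mathfrak B$ has universe $\{x\in\mathfrak B:\mathsf c_ix=x\text{ for all }n\le i<m\}$ and the operations of $\mathfrak B$ with indices $<n$. $\mathsf{Nr}_n\mathsf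 K_m=\{\mathfrak{Nr}_n\mathfrak B:\mathfrak B\in\mathsf K_m\}$ and $\mathbf S$ is closure under (isomorphic copies of) subalgebras. **Atom structures**: for an atomic Boolean algebra with operators $\mathfrak A$, $\mathsf{At}\,\mathfrak A$ is the set of atoms with relations $R_f(b,a_1,\dots,a_r)\iff b\le f(a_1,\dots,a_r)$ for each non-Boolean operator $f$ of rank $r$. $\mathfrak{Cm}\,\mathsf{At}\,\mathfrak A$ is the powerset algebra of the set of atoms with $f(X_1,\dots,X_r)=\{b:\exists a_i\in X_i,\ R_f(b,a_1,\dots,a_r)\}$. $\mathfrak{Rd}_{sc}$ is the reduct to the signature of $\mathsf{Sc}_n$. **$m$-square and $m$-flat representations** ($2<n\le m<\omega$): let $\mathfrak A$ be an algebra of dimension $n$. A relativized representation of $\mathfrak A$ with base $M$ is an injective homomorphism $f:\mathfrak A\to\wp(V)$, with $V=f(1)\subseteq{}^nM$, $M=\bigcup_{s\in V}\mathrm{rng}(s)$, where $\wp(V)$ carries the Boolean operations (complement taken relative to $V$) and, for $X\subseteq V$ and $i,j<n$, those of the following operations that interpret operations in the signature of $\mathfrak A$: $\mathsf C_iX=\{s\in V:\exists t\in X,\ t(j)=s(j)\ \forall j\ne i\}$ (interpreting $\mathsf c_i$), $\mathsf D_{ij}=\{s\in V:s_i=s_j\}$ (interpreting $\mathsf d_{ij}$), $\mathsf S_{[i|j]}X=\{s\in V:s\circ[i|j]\in X\}$ (interpreting $\mathsf s_i^j$), $\mathsf S_{[i,j]}X=\{s\in V:s\circ[i,j]\in X\}$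 (interpreting $\mathsf s_{[i,j]}$). Write $M\models a(s)$ for $s\in f(a)$. An $n$-clique is a set $C\subseteq M$ such that $(a_1,\dots,a_n)\in V$ for all distinct $a_1,\dots,a_n\in C$. Let $\mathsf C^m(M)=\{s\in{}^mM:\mathrm{rng}(s)\text{ is an }n\text{-clique}\}$. $M$ is an $m$-square representation if for all $\bar s\in\mathsf C^m(M)$, $a\in\mathfrak A$, $i<n$ and injective $l:n\to m$, whenever $M\models\mathsf c_ia(s_{l(0)},\dots,s_{l(n-1)})$ there is $\bar t\in\mathsf C^m(M)$ agreeing with $\bar s$ off $l(i)$ such that $M\models a(t_{l(0)},\dots,t_{l(n-1)})$. Let $L(\mathfrak A)^m$ be the first-order language with $m$ variables and one $n$-ary relation symbol for each element of $\mathfrak A$. The clique-guarded semantics $\models_c$ at $\bar s\in\mathsf C^m(M)$ is as usual for atomic formulas and Boolean connectives, and $M,\bar s\models_c\exists x_i\phi$ iff there is $\bar t\in\mathsf C^m(M)$ agreeing with $\bar s$ off $i$ with $M,\bar t\models_c\phi$. $M$ is $m$-flat if it is $m$-square and for all $\phi\in L(\mathfrak A)^m$, all $\bar s\in\mathsf C^m(M)$ and all distinct $i,j<m$, $M,\bar s\models_c\exists x_i\exists x_j\phi\leftrightarrow\exists x_j\exists x_i\phi$. *)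

(* Defs.v *)
From mathcomp Require Import all_boot perm.
From mathcomp Require Import boolp classical_sets cardinality.

Set Implicit Arguments.
Unset Strict Implicit.
Unset Printing Implicit Defensive.

Local Open Scope classical_set_scope.

(** * Signatures, algebras, terms *)

(* [Sub i j] is the symbol s_i^j of the replacement [i|j] (subscript first);
   [Tr i j] is s_[i,j]. *)
Inductive qop (n : nat) : Type :=
| Cyl of 'I_n
| Sub of 'I_n & 'I_n
| Tr of 'I_n & 'I_n
| Diag of 'I_n & 'I_n.

Definition arity n (f : qop n) : nat :=
  match f with Cyl _ | Sub _ _ | Tr _ _ => 1 | Diag _ _ => 0 end.

(* A signature (beyond the Boolean operations) is a set of symbols. *)
Definition signature (n : nat) : Type := qop n -> bool.

Definition qea_sig n : signature n := fun _ => true.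
Definition sc_sig n : signature n :=
  fun f => match f with Cyl _ | Sub _ _ => true | _ => false end.

Record alg n (P : signature n) : Type := Alg {
  car :> Type;
  add : car -> car -> car;
  mul : car -> car -> car;
  neg : car -> car;
  zero : car;
  one : car;
  op : forall f : qop n, P f -> ('I_(arity f) -> car) -> car
}.
Arguments zero {n P a}.
Arguments one {n P a}.
Arguments op {n P a} f _ _.

Definition le n (P : signature n) (A : alg P) (x y : A) : Prop := mul x y = x.

Inductive term n (P : signature n) : Type :=
| TVar of nat
| TZero
| TOne
| TAdd of term P & term P
| TMul of term P & term P
| TNeg of term P
| TOp (f : qop n) (h : P f) of ('I_(arity f) -> term P).

Fixpoint eval n (P : signature n) (A : alg P) (v : nat -> A) (t : term P) : A :=
  match t with
  | TVar k => v k
  | TZero => zero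
  | TOne => one
  | TAdd t u => add (eval v t) (eval v u)
  | TMul t u => mul (eval v t) (eval v u)
  | TNeg t => neg (eval v t)
  | TOp f h ts => op f h (fun k => eval v (ts k))
  end.

Definition equation n (P : signature n) : Type := (term P * term P)%type.

Definition sat n (P : signature n) (A : alg P) (e : equation P) : Prop :=
  forall v : nat -> A, eval v e.1 = eval v e.2.

Definition valid n (P : signature n) (K : alg P -> Prop) (e : equation P) : Prop :=
  forall A : alg P, K A -> sat A e.

Definition variety n (P : signature n) (K : alg P -> Prop) : Prop :=
  exists E : set (equation P), forall A : alg P, K A <-> forall e, E e -> sat A e.

Record hom n (P : signature n) (A B : alg P) (f : A -> B) : Prop := Hom {
  hom_add : forall x y, f (add x y) = add (f x) (f y);
  hom_mul : forall x y, f (mul x y) = mul (f x) (f y);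
  hom_neg : forall x, f (neg x) = neg (f x);
  hom_zero : f zero = zero;
  hom_one : f one = one;
  hom_op : forall g (h : P g) (a : 'I_(arity g) -> A),
    f (op g h a) = op g h (fun k => f (a k))
}.

(* A is isomorphic to a subalgebra of B. *)
Definition embeds n (P : signature n) (A B : alg P) : Prop :=
  exists f : A -> B, hom f /\ injective f.

Record congruence n (P : signature n) (A : alg P) (r : A -> A -> Prop) : Prop :=
  Congruence {
  cg_refl : forall x, r x x;
  cg_sym : forall x y, r x y -> r y x;
  cg_trans : forall x y z, r x y -> r y z -> r x z;
  cg_add : forall x x' y y', r x x' -> r y y' -> r (add x y) (add x' y');
  cg_mul : forall x x' y y', r x x' -> r y y' -> r (mul x y) (mul x' y');
  cg_neg : forall x x', r x x' -> r (neg x) (neg x');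
  cg_op : forall g (h : P g) (a a' : 'I_(arity g) -> A),
    (forall k, r (a k) (a' k)) -> r (op g h a) (op g h a')
}.

Definition simple n (P : signature n) (A : alg P) : Prop :=
  (exists x y : A, x <> y) /\
  forall r : A -> A -> Prop, congruence r ->
    (forall x y, r x y -> x = y) \/ (forall x y, r x y).

Definition reduct n (P Q : signature n) (PQ : forall f, P f -> Q f) (A : alg Q)
    : alg P :=
  @Alg n P A (@add _ _ A) (@mul _ _ A) (@neg _ _ A) zero one
    (fun f h x => @op n Q A f (PQ f h) x).

Definition Rd_sc n (A : alg (@qea_sig n)) : alg (@sc_sig n) :=
  reduct (fun f (_ : sc_sig f) => isT : qea_sig f) A.

(* Reduct to the operations with indices < n. *)
Definition widen_qop n m (nm : n <= m) (f : qop n) : qop m :=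
  let w := widen_ord nm in
  match f with
  | Cyl i => Cyl (w i)
  | Sub i j => Sub (w i) (w j)
  | Tr i j => Tr (w i) (w j)
  | Diag i j => Diag (w i) (w j)
  end.

Definition dim_reduct n m (nm : n <= m) (P : signature n) (Q : signature m)
    (PQ : forall f, P f -> Q (widen_qop nm f)) (B : alg Q) : alg P :=
  @Alg n P B (@add _ _ B) (@mul _ _ B) (@neg _ _ B) zero one
    (fun f =>
      match f return P f -> ('I_(arity f) -> B) -> B with
      | Cyl i => fun h x => @op m Q B _ (PQ (Cyl i) h) x
      | Sub i j => fun h x => @op m Q B _ (PQ (Sub i j) h) x
      | Tr i j => fun h x => @op m Q B _ (PQ (Tr i j) h) x
      | Diag i j => fun h x => @op m Q B _ (PQ (Diag i j) h) x
      end).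

(** * Substitution algebras and quasi-polyadic equality algebras *)

Record boolean n (P : signature n) (A : alg P) : Prop := Boolean {
  ba_addC : forall x y : A, add x y = add y x;
  ba_mulC : forall x y : A, mul x y = mul y x;
  ba_addA : forall x y z : A, add x (add y z) = add (add x y) z;
  ba_mulA : forall x y z : A, mul x (mul y z) = mul (mul x y) z;
  ba_mulDr : forall x y z : A, mul x (add y z) = add (mul x y) (mul x z);
  ba_addMr : forall x y z : A, add x (mul y z) = mul (add x y) (add x z);
  ba_add0 : forall x : A, add x zero = x;
  ba_mul1 : forall x : A, mul x one = x;
  ba_addN : forall x : A, add x (neg x) = one;
  ba_mulN : forall x : A, mul x (neg x) = zero
}.

Record boolean_endo n (P : signature n) (A : alg P) (s : A -> A) : Prop :=
  BooleanEndo {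
  be_add : forall x y, s (add x y) = add (s x) (s y);
  be_mul : forall x y, s (mul x y) = mul (s x) (s y);
  be_neg : forall x, s (neg x) = neg (s x);
  be_zero : s zero = zero;
  be_one : s one = one
}.

Definition scC n (A : alg (@sc_sig n)) (i : 'I_n) (x : A) : A :=
  op (Cyl i) isT (fun=> x).
Definition scS n (A : alg (@sc_sig n)) (i j : 'I_n) (x : A) : A :=
  op (Sub i j) isT (fun=> x).

Record Sc n (A : alg (@sc_sig n)) : Prop := ScAxioms {
  sc_bool : boolean A;
  sc_c0 : forall i, scC i (zero : A) = zero;
  sc_le_c : forall i (x : A), le x (scC i x);
  sc_cM : forall i (x y : A), scC i (mul x (scC i y)) = mul (scC i x) (scC i y);
  sc_cC : forall i j (x : A), scC i (scC j x) = scC j (scC i x);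
  sc_sii : forall i (x : A), scS i i x = x;
  sc_endo : forall i j, boolean_endo (@scS n A i j);
  sc_sc : forall i j (x : A), scS i j (scC i x) = scC i x;
  sc_cs : forall i j (x : A), i != j -> scC i (scS i j x) = scS i j x;
  sc_sck : forall i j k (x : A), k \notin [:: i; j] ->
    scS i j (scC k x) = scC k (scS i j x);
  sc_csji : forall i j (x : A), scC i (scS j i x) = scC j (scS i j x);
  sc_ssC : forall i j k l (x : A), uniq [:: i; j; k; l] ->
    scS j i (scS l k x) = scS l k (scS j i x);
  sc_ss : forall i j l (x : A), scS l i (scS j l x) = scS l i (scS j i x)
}.

Definition qC n (A : alg (@qea_sig n)) (i : 'I_n) (x : A) : A :=
  op (Cyl i) isT (fun=> x).
Definition qS n (A : alg (@qea_sig n)) (i j : 'I_n) (x : A) : A :=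
  op (Sub i j) isT (fun=> x).
Definition qT n (A : alg (@qea_sig n)) (i j : 'I_n) (x : A) : A :=
  op (Tr i j) isT (fun=> x).
Definition qD n (A : alg (@qea_sig n)) (i j : 'I_n) : A :=
  op (Diag i j) isT (fun=> zero).

Record QEA n (A : alg (@qea_sig n)) : Prop := QEAAxioms {
  qea_bool : boolean A;
  qea_sii : forall i (x : A), qS i i x = x;
  qea_tii : forall i (x : A), qT i i x = x;
  qea_tC : forall i j (x : A), qT i j x = qT j i x;
  qea_le_c : forall i (x : A), le x (qC i x);
  qea_cD : forall i (x y : A), qC i (add x y) = add (qC i x) (qC i y);
  qea_sc : forall i j (x : A), qS i j (qC i x) = qC i x;
  qea_cs : forall i j (x : A), i != j -> qC i (qS i j x) = qS i j x;
  qea_sck : forall i j k (x : A), k \notin [:: i; j] ->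
    qS i j (qC k x) = qC k (qS i j x);
  qea_s_endo : forall i j, boolean_endo (@qS n A i j);
  qea_t_endo : forall i j, boolean_endo (@qT n A i j);
  qea_tt : forall i j (x : A), qT i j (qT i j x) = x;
  qea_ttt : forall i j k (x : A), uniq [:: i; j; k] ->
    qT i j (qT i k x) = qT j k (qT i j x);
  qea_ts : forall i j (x : A), qT i j (qS i j x) = qS j i x;
  qea_sd : forall i j, qS i j (qD A i j) = one;
  qea_d_le : forall i j (x : A), le (mul x (qD A i j)) (qS i j x)
}.

(** * Varieties between Sc and QEA *)

(* The Sc-type algebra defined in A by its own cylindrifiers and by terms
   [tau i j] (in the variable [TVar 0]) for the s_i^j. *)
Definition sc_of n (P : signature n) (hC : forall i, P (Cyl i))
    (tau : 'I_n -> 'I_n -> term P) (A : alg P) : alg (@sc_sig n) :=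
  @Alg n (@sc_sig n) A (@add _ _ A) (@mul _ _ A) (@neg _ _ A) zero one
    (fun f =>
      match f return sc_sig f -> ('I_(arity f) -> A) -> A with
      | Cyl i => fun _ x => @op n P A (Cyl i) (hC i) x
      | Sub i j => fun _ x => eval (fun=> x ord0) (tau i j)
      | Tr _ _ | Diag _ _ => fun h _ => False_rect _ (notF h)
      end).

(* The signatures of the different dimensions restrict to each other, so that
   the n-dimensional reduct of a member of K_m has the type of K_n.  The
   operations s_i^j are given by terms [bt_sub]: these agree with s_i^j when it
   is in the signature of K, define s_i^j in QEA, and do not depend on the
   dimension, up to the equations of K.  The conditions concern the dimensions
   n > 2 only: the listed axioms of QEA_1 do not give c_0 0 = 0 and those of
   QEA_2 do not give c_0 c_1 x = c_1 c_0 x, so QEA_1 and QEA_2 do not satisfy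
   the equations of Sc_1 and Sc_2. *)
Record between : Type := Between {
  bt_sig : forall n, signature n;
  bt_sig_widen : forall n m (nm : n <= m) (f : qop n),
    bt_sig (widen_qop nm f) = bt_sig f;
  bt_cyl : forall n (i : 'I_n), bt_sig (Cyl i);
  bt_sub : forall n, 'I_n -> 'I_n -> term (@bt_sig n);
  bt_class : forall n, alg (@bt_sig n) -> Prop;
  bt_variety : forall n, 2 < n -> variety (@bt_class n);
  bt_sub_prim : forall n, 2 < n -> forall A : alg (@bt_sig n), bt_class A ->
    forall i j (h : bt_sig (Sub i j)) (x : A),
    op (Sub i j) h (fun=> x) = eval (fun=> x) (bt_sub i j);
  bt_sub_widen : forall n m (nm : n <= m), 2 < n ->
    forall B : alg (@bt_sig m), bt_class B ->
    forall (i j : 'I_n) (x : B),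
    eval (A := dim_reduct
                 (fun f (h : bt_sig f) => eq_ind_r is_true h (bt_sig_widen nm f))
                 B)
         (fun=> x) (bt_sub i j)
    = eval (fun=> x) (bt_sub (widen_ord nm i) (widen_ord nm j));
  bt_above : forall n, 2 < n -> forall e, valid (@Sc n) e ->
    forall A : alg (@bt_sig n), bt_class A ->
    sat (sc_of (@bt_cyl n) (@bt_sub n) A) e;
  bt_below : forall n, 2 < n -> forall e, valid (@bt_class n) e ->
    forall A : alg (@qea_sig n), QEA A ->
    sat (reduct (fun f (_ : bt_sig f) => isT : qea_sig f) A) e;
  bt_sub_qea : forall n, 2 < n -> forall A : alg (@qea_sig n), QEA A ->
    forall i j (x : A),
    qS i j x
    = eval (A := reduct (fun f (_ : bt_sig f) => isT : qea_sig f) A)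
           (fun=> x) (bt_sub i j)
}.

(** * Relativized set algebras and representability *)

Definition repl n (i j k : 'I_n) : 'I_n := if k == i then j else k.

Definition agree_off n (M : Type) (i : 'I_n) (s t : 'I_n -> M) : Prop :=
  forall j, j != i -> t j = s j.

(* The operations of the powerset algebra of V, on all sets of n-tuples but cut
   down to V; its elements proper are the X `<=` V.  For V = setT this is the
   full set algebra with base M. *)
Definition set_alg n (P : signature n) (M : Type) (V : set ('I_n -> M)) : alg P :=
  @Alg n P (set ('I_n -> M))
    (fun X Y => X `|` Y) (fun X Y => X `&` Y) (fun X => V `\` X) set0 V
    (fun f _ =>
      match f return ('I_(arity f) -> set ('I_n -> M)) -> set ('I_n -> M) with
      | Cyl i => fun X =>
          [set s | V s /\ exists2 t, X ord0 t & agree_off i s t]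
      | Sub i j => fun X => [set s | V s /\ X ord0 (s \o repl i j)]
      | Tr i j => fun X => [set s | V s /\ X ord0 (s \o tperm i j)]
      | Diag i j => fun _ => [set s | V s /\ s i = s j]
      end).

Definition full_set_alg n (P : signature n) (U : Type) : alg P :=
  set_alg P (setT : set ('I_n -> U)).

Definition subdirect n (P : signature n) (A : alg P) (I : Type) (B : I -> alg P)
    : Prop :=
  exists h : forall k, A -> B k,
    [/\ forall k, hom (h k),
        forall k (b : B k), exists a, h k a = b
      & forall x y, (forall k, h k x = h k y) -> x = y].

Definition representable n (P : signature n) (A : alg P) : Prop :=
  exists (I : Type) (U : I -> Type) (B : I -> alg P),
    (forall k, embeds (B k) (full_set_alg P (U k))) /\ subdirect A B.

Definition RQEA n (A : alg (@qea_sig n)) : Prop := representable A.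
Definition RK (K : between) n (A : alg (@bt_sig K n)) : Prop := representable A.

(** * Neat reducts *)

(* The elements of the neat reduct Nr_n B; for B in K_m they are closed under
   the operations with indices < n. *)
Definition neat (K : between) n m (B : alg (@bt_sig K m)) : set B :=
  [set x | forall i : 'I_m, n <= i -> op (Cyl i) (bt_cyl K i) (fun=> x) = x].

Definition Rd_dim (K : between) n m (nm : n <= m) (B : alg (@bt_sig K m))
    : alg (@bt_sig K n) :=
  dim_reduct
    (fun f (h : bt_sig K f) => eq_ind_r is_true h (bt_sig_widen K nm f)) B.

(* S Nr_n K_m: the algebras isomorphic to a subalgebra of Nr_n B, i.e. embedded
   in the n-dimensional reduct of B with image in the universe of Nr_n B. *)
Definition SNr (K : between) n m (A : alg (@bt_sig K n)) : Prop :=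
  exists (nm : n < m) (B : alg (@bt_sig K m)),
    bt_class B /\
    exists f : A -> Rd_dim (ltnW nm) B,
      [/\ hom f, injective f & forall a, neat n (f a : B)].

(** * Atom structures and complex algebras *)

Definition is_atom n (P : signature n) (A : alg P) (a : A) : Prop :=
  a <> zero /\ forall x, le x a -> x = zero \/ x = a.

Definition atomic n (P : signature n) (A : alg P) : Prop :=
  forall x : A, x <> zero -> exists2 a, is_atom a & le a x.

Record atom_structure n (P : signature n) : Type := AtomStructure {
  atoms :> Type;
  arel : forall f : qop n, P f -> atoms -> ('I_(arity f) -> atoms) -> Prop
}.
Arguments arel {n P a} f _ _ _.

Definition At n (P : signature n) (A : alg P) : atom_structure P :=
  @AtomStructure n P {a : A | is_atom a}
    (fun f h b a => le (sval b) (op f h (fun k => sval (a k)))).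

Definition Cm n (P : signature n) (S : atom_structure P) : alg P :=
  @Alg n P (set S)
    (fun X Y => X `|` Y) (fun X Y => X `&` Y) (fun X => ~` X) set0 setT
    (fun f h X =>
      [set b | exists a : 'I_(arity f) -> S, (forall k, X k (a k)) /\ arel f h b a]).

(** * Square and flat relativized representations *)

Record rel_rep n (P : signature n) (A : alg P) (M : Type) (V : set ('I_n -> M))
    (f : A -> set_alg P V) : Prop := RelRep {
  rr_sub : forall a, (f a : set ('I_n -> M)) `<=` V;
  rr_hom : hom f;
  rr_inj : injective f;
  rr_base : forall x : M, exists2 s, V s & exists i, s i = x
}.

Definition clique n (M : Type) (V : set ('I_n -> M)) (C : set M) : Prop :=
  forall a : 'I_n -> M, injective a -> (forall k, C (a k)) -> V a.

Definition clique_tuples n (M : Type) (V : set ('I_n -> M)) m : set ('I_m -> M) :=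
  [set s | clique V (range s)].

Definition square n (P : signature n) (A : alg P) (M : Type)
    (V : set ('I_n -> M)) (f : A -> set_alg P V) m : Prop :=
  forall (s : 'I_m -> M) (a : A) (i : 'I_n) (hC : P (Cyl i)) (l : 'I_n -> 'I_m),
    clique_tuples V s -> injective l ->
    (f (op (Cyl i) hC (fun=> a)) : set ('I_n -> M)) (s \o l) ->
    exists t : 'I_m -> M,
      [/\ clique_tuples V t, agree_off (l i) s t
        & (f a : set ('I_n -> M)) (t \o l)].

Inductive formula (R : Type) (n m : nat) : Type :=
| FRel of R & ('I_n -> 'I_m)
| FEq of 'I_m & 'I_m
| FNot of formula R n m
| FAnd of formula R n m & formula R n m
| FEx of 'I_m & formula R n m.

Fixpoint csat n (R M : Type) (V : set ('I_n -> M)) (f : R -> set ('I_n -> M)) m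
    (phi : formula R n m) (s : 'I_m -> M) : Prop :=
  match phi with
  | FRel a l => f a (s \o l)
  | FEq i j => s i = s j
  | FNot p => ~ csat V f p s
  | FAnd p q => csat V f p s /\ csat V f q s
  | FEx i p => exists t : 'I_m -> M,
      [/\ clique_tuples V t, agree_off i s t & csat V f p t]
  end.

Definition flat n (P : signature n) (A : alg P) (M : Type)
    (V : set ('I_n -> M)) (f : A -> set_alg P V) m : Prop :=
  square f m /\
  forall (phi : formula A n m) (s : 'I_m -> M) (i j : 'I_m),
    clique_tuples V s -> i != j ->
    csat V f (FEx i (FEx j phi)) s <-> csat V f (FEx j (FEx i phi)) s.

Definition has_square_rep n (P : signature n) (A : alg P) m : Prop :=
  exists (M : Type) (V : set ('I_n -> M)) (f : A -> set_alg P V),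
    rel_rep f /\ square f m.

Definition has_flat_rep n (P : signature n) (A : alg P) m : Prop :=
  exists (M : Type) (V : set ('I_n -> M)) (f : A -> set_alg P V),
    rel_rep f /\ flat f m.

(* Main.v *)
(* The algebra is a "blow up and blur" construction. We build a countable structure M in which the
   points fall into n + 3 sorts: n - 3 frame sorts, two base sorts and four apex sorts. Labels are
   attached to pairs of points of the last six sorts, relative to a choice of one point from every
   frame sort. Hence an n-tuple sees a triangle of labels, and an n-tuple with more than three
   points of the last six sorts sees no label at all. The constraints on triangles force two apexes
   of different sorts that are adjacent to the same two base points to be joined by a red. There
   are infinitely many real reds, and they are so constrained that four apexes cannot all be joined
   by real reds; in addition there is one unconstrained blurred red, which makes it possible to
   amalgamate: every consistent one-point extension of n - 1 points of M is realised in M.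

   An n-ary relation on M is tame if it does not distinguish all but finitely many of the real reds
   from the blurred one. By the extension property the tame relations form a subalgebra of the full
   set algebra with base M. It is countable, simple and atomic, the atoms being the types of the
   n-tuples without blurred labels. In the complex algebra of the atom structure, the join of all
   relations "joined by a real red" has no blurred part left. In a neat embedding in dimension
   n + 3, or in an (n + 3)-square representation, one can place four apexes of different sorts over
   a single frame and base; this uses n + 3 points. They are pairwise joined by real reds, which is
   impossible. *)
Require Import Defs.
From mathcomp Require Import all_boot perm zify.
From mathcomp Require Import boolp classical_sets cardinality.
Import Defs.

Set Implicit Arguments.
Unset Strict Implicit.
Unset Printing Implicit Defensive.

Local Open Scope classical_set_scope.

(** * Labels and the one-point extension step *)

(** Among k + 3 points that include a frame only three others remain, so no triangle shows two
    apexes together with both base points. The base points therefore act separately: each forbids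
    one kind of white between its neighbours, and only a red survives both. The obstacle is
    amalgamation. The blurred red shares no red triangle with a real red, yet it is the label that
    must be put between a new apex and the old apexes over its base. If two of these were joined by
    a real red, the new apex could not be added. On the other hand, real reds between apexes over a
    common base must not be excluded altogether. The labels [pairl i j] resolve the conflict: when
    two apexes joined by a real red and adjacent to one base point get a second common base point,
    the label of the new base admits no third apex sort. There are sixteen such labels after 0 and
    1, whence the threshold 18. *)

(* Points have sorts 0 .. k+5: sorts 0 and 1 are the two base sorts, 2 .. 5 the four apex sorts,
   and 6+m (m < k) the frame sorts. For each choice [g] of one point of every frame sort, the
   pairs of points of increasing sorts < 6 carry a label, a natural number:
   - 0 is the blurred red, 1 .. 17 are plain labels, and the labels x >= 18 are the real reds;
   - on a base point and an apex, label 1 means adjacent and any other label not adjacent;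
   - on two base points, label 1 allows every apex sort as a common neighbour, and
     [pairl i j] (in 2 .. 17) allows the apex sorts i and j only;
   - on two apexes, [white 0] consists of label 1, and [white 1] of the labels 2 .. 17. *)
Definition red x := (x == 0) || (18 <= x).
Definition white c x := if c == 0 then x == 1 else 1 < x < 18.
Definition pairl i j := 2 + 4 * (i - 2) + (j - 2).
Definition allowed x j :=
  (x == 1) ||
  (1 < x < 18) && ((j == 2 + (x - 2) %/ 4) || (j == 2 + (x - 2) %% 4)).
Definition flip x := if odd x then x.-1 else x.+1.
(* Condition on the labels x = (1,2), y = (2,3), z = (1,3) of a red triangle 1, 2, 3 of apexes of
   increasing sorts. No four apexes can be joined by real reds this way, while any real red edge
   extends to such a triangle. *)
Definition tri x y z := (x == y) && ((x == 0) && (z == 0) || (18 <= x) && (z == flip x)).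

Lemma allowed_pairl i j s : 1 < i < 6 -> 1 < j < 6 ->
  allowed (pairl i j) s = (s == i) || (s == j).
Proof.
move=> hi hj; rewrite /allowed /pairl.
have -> : (2 + 4 * (i - 2) + (j - 2) - 2) = (i - 2) * 4 + (j - 2) by lia.
rewrite divnMDl // modnMDl divn_small ?modn_small; lia.
Qed.

Definition frame k I (D : I -> Prop) (srt : I -> nat) (g : 'I_k -> I) :=
  forall m, D (g m) /\ srt (g m) = 6 + m.

Record good k I (D : I -> Prop) (srt : I -> nat) (lb : ('I_k -> I) -> I -> I -> nat)
    : Prop := Good {
  good_base : forall g a b z, frame D srt g -> D a -> D b -> D z ->
    srt a = 0 -> srt b = 1 -> 1 < srt z < 6 -> lb g a z = 1 -> lb g b z = 1 ->
    allowed (lb g a b) (srt z);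
  good_white : forall g h z z', frame D srt g -> D h -> D z -> D z' ->
    srt h < 2 -> 1 < srt z -> srt z < srt z' < 6 -> lb g h z = 1 -> lb g h z' = 1 ->
    ~~ white (srt h) (lb g z z');
  good_tri : forall g x y z, frame D srt g -> D x -> D y -> D z ->
    1 < srt x -> srt x < srt y -> srt y < srt z < 6 ->
    red (lb g x y) -> red (lb g y z) -> red (lb g x z) ->
    tri (lb g x y) (lb g y z) (lb g x z)
}.

(* Holds in the model under construction only: over a base allowing more than two apex sorts,
   apexes are joined by the blurred red, so that a further apex can be added. *)
Definition sparse k I (D : I -> Prop) (srt : I -> nat) (lb : ('I_k -> I) -> I -> I -> nat)
    : Prop :=
  forall g a b z z' j, frame D srt g -> D a -> D b -> D z -> D z' ->
    srt a = 0 -> srt b = 1 -> 1 < srt z -> srt z < srt z' < 6 ->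
    lb g a z = 1 -> lb g b z = 1 -> lb g a z' = 1 -> lb g b z' = 1 ->
    18 <= lb g z z' -> j < 6 -> j != srt z -> j != srt z' -> 1 < j ->
    ~~ allowed (lb g a b) j.

Section Step.
Variables (k p t : nat) (srt : nat -> nat) (lab ell : ('I_k -> nat) -> nat -> nat -> nat).
Variable R : nat -> Prop.

Definition srt' x := if x == p then t else srt x.
Let D x := x < p.
Let D' x := x < p.+1.
Definition bothO (q : 'I_k -> nat) x y := [/\ forall m, q m < p, x < p & y < p].
Definition bothR (q : 'I_k -> nat) x y := [/\ forall m, R (q m), R x & R y].

(** Adjacency through a label that is old or prescribed. For a base point and an apex this is all
    adjacency, since [dflt] gives such a pair the label 2. *)
Definition e1 q x y := (bothO q x y /\ lab q x y = 1) \/ (bothR q x y /\ ell q x y = 1).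
Definition apex q a b z := e1 q a z /\ e1 q b z.
(** The first clause is what [good_base] asks of the label of a base. The second secures [sparse]:
    it excludes a third sort as soon as two apex sorts occur, whatever joins them. *)
Definition fits q a b r :=
  (forall z, 1 < srt' z < 6 -> apex q a b z -> allowed r (srt' z)) /\
  (forall z z' j, 1 < srt' z -> srt' z < srt' z' < 6 -> apex q a b z -> apex q a b z' ->
    j < 6 -> j != srt' z -> j != srt' z' -> 1 < j -> ~~ allowed r j).
Definition common c q x y := exists h, [/\ srt' h = c, e1 q h x & e1 q h y].
(* The label of a pair that is neither old nor prescribed. *)
Definition dflt q x y : nat :=
  if srt' y < 2 then xget 2 [set r | fits q x y r]
  else if srt' x < 2 then 2
  else if `[< common 0 q x y >] then (if `[< common 1 q x y >] then 0 else 2) else 1.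
Definition lab' q x y :=
  if `[< bothO q x y >] then lab q x y
  else if `[< bothR q x y >] then ell q x y else dflt q x y.

Hypothesis goodD : good D srt lab.
Hypothesis sparseD : sparse D srt lab.
Hypothesis Rp : forall x, R x -> x < p.+1.
Hypothesis agree : forall q x y, bothO q x y -> bothR q x y -> ell q x y = lab q x y.
Hypothesis goodR : good R srt' ell.
Hypothesis count4 : forall (q : 'I_k -> nat) x y z w, frame R srt' q -> R x -> R y -> R z -> R w ->
  uniq [:: srt' x; srt' y; srt' z; srt' w] -> all (fun s => s < 6) [:: srt' x; srt' y; srt' z; srt' w] -> False.
Hypothesis count3 : forall (q : 'I_k -> nat) x y z x', frame R srt' q -> R x -> R y -> R z -> R x' ->
  uniq [:: srt' x; srt' y; srt' z] -> all (fun s => s < 6) [:: srt' x; srt' y; srt' z] ->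
  srt' x' = srt' x -> x' = x.

Lemma lab'O q x y : bothO q x y -> lab' q x y = lab q x y.
Proof. by rewrite /lab' => /asboolP ->. Qed.

Lemma lab'R q x y : bothR q x y -> lab' q x y = ell q x y.
Proof.
move=> h; rewrite /lab'; case: asboolP => [o|_]; first by rewrite agree.
by case: asboolP.
Qed.

Lemma lab'd q x y : ~ bothO q x y -> ~ bothR q x y -> lab' q x y = dflt q x y.
Proof. by rewrite /lab' => h1 h2; case: asboolP => //; case: asboolP. Qed.

Lemma srt'O x : x < p -> srt' x = srt x.
Proof. by rewrite /srt'; case: eqP => // ->; rewrite ltnn. Qed.

Lemma frameO (q : 'I_k -> nat) : frame D' srt' q -> (forall m, q m < p) -> frame D srt q.
Proof. by move=> h o m; split; [exact: o|rewrite -srt'O //; case: (h m)]. Qed.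

Lemma frameR (q : 'I_k -> nat) : frame D' srt' q -> (forall m, R (q m)) -> frame R srt' q.
Proof. by move=> h o m; split; [exact: o|case: (h m)]. Qed.

Lemma e1P q h z : srt' h < 2 -> 1 < srt' z -> lab' q h z = 1 -> e1 q h z.
Proof.
move=> hh hz; rewrite /lab' /e1.
case: asboolP => o; first by left.
case: asboolP => r; first by right.
by rewrite /dflt ltnNge hz hh.
Qed.

Lemma e1O q h z : bothO q h z -> e1 q h z -> lab q h z = 1.
Proof. by move=> o [[]//|[r]]; rewrite agree. Qed.

Lemma e1R q h z : bothR q h z -> e1 q h z -> ell q h z = 1.
Proof. by move=> o [[r]|[]//]; rewrite agree. Qed.

Lemma lt_or_new x : D' x -> x < p \/ x = p.
Proof. by rewrite /D' ltnS leq_eqVlt => /orP[/eqP|]; [right|left]. Qed.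

(** Apexes of at most two sorts lie over such a base, so some [pairl] fits. If the frame is not old,
    both edges to an apex are prescribed, and then so is the base. Otherwise one base point is [p],
    and three apexes would give, with [p], four points of [R] besides the frame. *)
Lemma fits_ex (q : 'I_k -> nat) a b : frame D' srt' q -> D' a -> D' b -> srt' a = 0 -> srt' b = 1 ->
  ~ bothO q a b -> ~ bothR q a b -> exists r, fits q a b r.
Proof.
move=> pq Da Db sa sb nO nR.
have three z1 z2 z3 : 1 < srt' z1 < 6 -> 1 < srt' z2 < 6 -> 1 < srt' z3 < 6 ->
    apex q a b z1 -> apex q a b z2 -> apex q a b z3 ->
    uniq [:: srt' z1; srt' z2; srt' z3] -> False.
  move=> h1 h2 h3 x1 x2 x3 u.
  have step c : c = a \/ c = b -> c = p ->
    forall z, apex q a b z -> (forall m, R (q m)) /\ R p /\ R z.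
    move=> [->|->] e z [xa xb].
      by case: xa => [[[_]]|[[]]]; rewrite e ?ltnn.
    by case: xb => [[[_]]|[[]]]; rewrite e ?ltnn.
  have [qO|nqO] := pselect (forall m, q m < p); last first.
    case: x1 => -[[o _]|[ra _]] eb; first by case: o.
    case: eb => [[o _]|[rb _]]; first by case: o.
    by case: nR; case: ra rb => ? ? ? [].
  have [c hc cp] : exists2 c, c = a \/ c = b & c = p.
    case: (lt_or_new Da) => ha; last by exists a => //; left.
    case: (lt_or_new Db) => hb; last by exists b => //; right.
    by case: nO.
  have [qR [Rp' R1]] := step c hc cp _ x1.
  have [_ [_ R2]] := step c hc cp _ x2.
  have [_ [_ R3]] := step c hc cp _ x3.
  have sp : srt' p < 2 by case: hc cp => -> <-; lia.
  apply: (@count4 q p z1 z2 z3) => //; first exact: frameR.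
    by move: u => /=; rewrite !inE; lia.
  by rewrite /=; lia.
have [[z [hz xz]]|none] := pselect (exists z, 1 < srt' z < 6 /\ apex q a b z); last first.
  exists 2; split=> [z hz xz|z z' j h1 h2 x1]; first by case: none; exists z.
  by case: none; exists z; split=> //; lia.
have [[z' [hz' xz' ne]]|only] :=
    pselect (exists z', [/\ 1 < srt' z' < 6, apex q a b z' & srt' z' != srt' z]).
  exists (pairl (srt' z) (srt' z')).
  have all2 y : 1 < srt' y < 6 -> apex q a b y -> (srt' y == srt' z) || (srt' y == srt' z').
    move=> hy xy; apply/negPn/negP=> n.
    by apply: (three z z' y) => //=; rewrite !inE; lia.
  split=> [y hy xy|y y' j hy hy' xy xy' j6 n n' j1]; rewrite allowed_pairl //.
    exact: all2.
  have := all2 y _ xy; have := all2 y' _ xy'; lia.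
exists (pairl (srt' z) (srt' z)).
have one y : 1 < srt' y < 6 -> apex q a b y -> srt' y = srt' z.
  by move=> hy xy; apply/eqP/negPn/negP=> n; case: only; exists y.
split=> [y hy xy|y y' j hy hy' xy xy']; first by rewrite allowed_pairl // (one y) // eqxx.
have := one y _ xy; have := one y' _ xy'; lia.
Qed.

Lemma fitsP (q : 'I_k -> nat) a b : frame D' srt' q -> D' a -> D' b -> srt' a = 0 -> srt' b = 1 ->
  ~ bothO q a b -> ~ bothR q a b -> fits q a b (lab' q a b).
Proof.
move=> pq Da Db sa sb nO nR; have [r fr] := fits_ex pq Da Db sa sb nO nR.
by rewrite lab'd // /dflt sb /=; apply: (@xgetPex _ 2 [set r | fits q a b r]); exists r.
Qed.

(* Default reds only join the new point to an old apex outside [R] over the same base. *)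
Lemma dflt_red (q : 'I_k -> nat) x y : frame D' srt' q -> D' x -> D' y ->
  1 < srt' x -> srt' x < srt' y < 6 -> ~ bothO q x y -> ~ bothR q x y -> red (lab' q x y) ->
  lab' q x y = 0 /\ exists a b,
    [/\ srt' a = 0, srt' b = 1, apex q a b x & apex q a b y]
    /\ [/\ forall m, q m < p, forall m, R (q m), R a, R b & R p] /\
    [\/ [/\ x = p, y < p & ~ R y] | [/\ y = p, x < p & ~ R x]].
Proof.
move=> pq Dx Dy hx hy nO nR; rewrite lab'd // /dflt.
have -> : (srt' y < 2) = false by lia.
have -> : (srt' x < 2) = false by lia.
case: asboolP => // -[a [sa eax eay]]; case: asboolP => // -[b [sb ebx eby]] _.
split=> //; exists a, b; split=> //.
have qO : forall m, q m < p.
  case: (eax) => [[o1 _]|[o1 _]]; first by case: o1.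
  case: (eay) => [[o2 _]|[o2 _]]; first by case: o2.
  by case: nR; case: o1 => ? ? ?; case: o2.
have new u v : (u = x /\ v = y) \/ (u = y /\ v = x) -> u = p ->
    [/\ forall m, R (q m), R a, R b, R p & v < p /\ ~ R v].
  move=> huv up.
  have vp : v < p.
    have : D' v by case: huv => -[_ ->].
    by case/lt_or_new => // vp; case: huv => -[eu ev]; move: hy; rewrite -eu -ev up vp; lia.
  have au : e1 q a u by case: huv => -[-> _].
  have bu : e1 q b u by case: huv => -[-> _].
  case: au => [[[_ _]]|[[qR Ra Ru] _]]; first by rewrite up ltnn.
  case: bu => [[[_ _]]|[[_ Rb _] _]]; first by rewrite up ltnn.
  rewrite up in Ru; split=> //; split=> // Rv.
  by apply: nR; case: huv => -[<- <-]; rewrite up.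
case: (lt_or_new Dx) => xp; last first.
  by have [|] := new x y _ xp; [left|move=> ? ? ? ? []; split=> //; left].
case: (lt_or_new Dy) => yp; last first.
  by have [|] := new y x _ yp; [right|move=> ? ? ? ? []; split=> //; right].
by case: nO.
Qed.

(** Reads the label from the smaller sort to the greater, so that the new point can be treated alike
    at all three corners of a triangle. *)
Definition uedge q x y := if srt' x < srt' y then lab' q x y else lab' q y x.

Lemma dflt_uedge (q : 'I_k -> nat) u : frame D' srt' q -> D' u -> D' p ->
  1 < srt' p < 6 -> 1 < srt' u < 6 -> srt' p != srt' u -> ~ bothR q p u ->
  red (uedge q p u) ->
  uedge q p u = 0 /\ exists a b,
    [/\ srt' a = 0, srt' b = 1, apex q a b p & apex q a b u]
    /\ [/\ forall m, q m < p, forall m, R (q m), R a, R b & R p] /\ (u < p /\ ~ R u).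
Proof.
move=> pq Du Dp hp hu ne nR; rewrite /uedge; case: ltnP => lt rd.
  have nO : ~ bothO q p u by case; rewrite ltnn.
  have [e [a [b [B [H [[_ ? ?]|[up _ _]]]]]]] :=
    dflt_red pq Dp Du ltac:(lia) ltac:(lia) nO nR rd.
    by split=> //; exists a, b.
  by move: ne; rewrite up eqxx.
have nO : ~ bothO q u p by case=> ? ?; rewrite ltnn.
have nR' : ~ bothR q u p by case=> *; apply: nR.
have {}lt : srt' u < srt' p by rewrite ltn_neqAle eq_sym ne.
have [e [a [b [[? ? ? ?] [H [[up _ _]|[_ ? ?]]]]]]] :=
  dflt_red pq Du Dp ltac:(lia) ltac:(lia) nO nR' rd.
  by move: ne; rewrite up eqxx.
by split=> //; exists a, b.
Qed.

(* A red edge from the new point [p] that is neither old nor in [R] forces [u] and [w]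
   to be old apexes over one base, which then cannot be joined by a real red. *)
Lemma uedge_tri (q : 'I_k -> nat) u w : frame D' srt' q -> D' u -> D' w -> D' p ->
  1 < srt' p < 6 -> 1 < srt' u < 6 -> 1 < srt' w < 6 ->
  srt' p != srt' u -> srt' p != srt' w -> srt' u != srt' w -> ~ bothR q p u ->
  red (uedge q p u) -> red (uedge q p w) -> red (uedge q u w) ->
  [/\ uedge q p u = 0, uedge q p w = 0 & uedge q u w = 0].
Proof.
move=> pq Du Dw Dp hp hu hw npu npw nuw nR ru rw ruw.
have [zu [a [b [[sa sb xp xu] [[qO qR Ra Rb Rp'] [up nRu]]]]]] :=
  dflt_uedge pq Du Dp hp hu npu nR ru.
have nRw : ~ bothR q p w.
  case=> _ _ Rw; apply: (@count4 q a b p w) => //=; rewrite ?inE; try exact: frameR; lia.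
have [zw [a' [b' [[sa' sb' xp' xw] [[_ _ Ra' Rb' _] [wp nRw']]]]]] :=
  dflt_uedge pq Dw Dp hp hw npw nRw rw.
split=> //.
(* [a], [b], [p] have three different sorts below 6, so by [count3] no other point of [R] has one of
   these sorts: the two bases coincide. *)
have ea : a' = a.
  by apply: (@count3 q a b p a' _) => //=; rewrite ?inE; try exact: frameR; lia.
have eb : b' = b.
  by apply: (@count3 q b a p b' _) => //=; rewrite ?inE; try exact: frameR; lia.
subst a' b'.
have aO : bothO q a u by case: xu => [[[//]|[[? ? Rv] _]] _]; case: nRu.
have bO : bothO q b u by case: xu => [_ [[//]|[[? ? Rv] _]]]; case: nRu.
have aOw : bothO q a w by case: xw => [[[//]|[[? ? Rv] _]] _]; case: nRw.
have bOw : bothO q b w by case: xw => [_ [[//]|[[? ? Rv] _]]]; case: nRw.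
have [ap bp] : a < p /\ b < p by case: aO bO => _ ? _ [].
have al : allowed (lab q a b) (srt' p).
  rewrite -agree //; apply: (good_base goodR) => //; try exact: frameR.
    by apply: e1R; last by case: xp.
  by apply: e1R; last by case: xp.
have E1 := e1O aO (proj1 xu); have E2 := e1O bO (proj2 xu).
have E3 := e1O aOw (proj1 xw); have E4 := e1O bOw (proj2 xw).
have sp := sparseD.
move: ruw; rewrite /uedge.
move: sa sb hu hw nuw npu npw; rewrite !(srt'O up, srt'O wp, srt'O ap, srt'O bp).
move=> sa sb hu hw nuw npu npw.
case: ltnP => lt; rewrite lab'O ?/red //; case/orP => [/eqP //|ge].
  by have := @sp q a b u w (srt' p) (frameO pq qO) ap bp up wp sa sb
     ltac:(lia) ltac:(lia) E1 E2 E3 E4 ge ltac:(lia) npu npw ltac:(lia); rewrite al.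
by have := @sp q a b w u (srt' p) (frameO pq qO) ap bp wp up sa sb
     ltac:(lia) ltac:(lia) E3 E4 E1 E2 ge ltac:(lia) npw npu ltac:(lia); rewrite al.
Qed.

Lemma good_step : good D' srt' lab'.
Proof.
split.
- move=> q a b z pq Da Db Dz sa sb hz ea eb.
  have {}ea : e1 q a z by apply: e1P => //; lia.
  have {}eb : e1 q b z by apply: e1P => //; lia.
  have [o|nO] := pselect (bothO q a b).
    case: o => qO ap bp; case: (lt_or_new Dz) => zp; last first.
      case: ea => [[[_ _]]|[[qR Ra Rz] ea]]; first by rewrite zp ltnn.
      case: eb => [[[_ _]]|[[_ Rb _] eb]]; first by rewrite zp ltnn.
      by rewrite lab'R //; apply: (good_base goodR) => //; apply: frameR.
    rewrite lab'O // (srt'O zp).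
    rewrite (srt'O ap) in sa; rewrite (srt'O bp) in sb; rewrite (srt'O zp) in hz.
    by apply: (good_base goodD) => //; [exact: frameO|apply: e1O ea|apply: e1O eb].
  have [r|nR] := pselect (bothR q a b).
    case: r => qR Ra Rb; rewrite lab'R //.
    have [Rz|nRz] := pselect (R z).
      by apply: (good_base goodR) => //; [exact: frameR|apply: e1R ea|apply: e1R eb].
    case: ea => [[[qO ap zp] ea]|[[]//]]; case: eb => [[[_ bp _] eb]|[[]//]].
    by case: nO.
  by apply: (proj1 (fitsP pq Da Db sa sb nO nR)).
- move=> q h z z' pq Dh Dz Dz' sh hz hz' ez ez'.
  have {}ez : e1 q h z by apply: e1P => //; lia.
  have {}ez' : e1 q h z' by apply: e1P => //; lia.
  have [o|nO] := pselect (bothO q z z').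
    case: o => qO zp zp'; case: (lt_or_new Dh) => hp; last first.
      case: ez => [[[_ +]]|[[qR Rh Rz] ez]]; first by rewrite hp ltnn.
      case: ez' => [[[_ +]]|[[_ _ Rz'] ez']]; first by rewrite hp ltnn.
      by rewrite lab'R //; apply: (good_white goodR) => //; apply: frameR.
    rewrite lab'O // (srt'O hp).
    rewrite (srt'O hp) in sh; rewrite (srt'O zp) in hz hz'; rewrite (srt'O zp') in hz'.
    by apply: (good_white goodD) => //; [exact: frameO|apply: e1O ez|apply: e1O ez'].
  have [r|nR] := pselect (bothR q z z').
    case: r => qR Rz Rz'; rewrite lab'R //.
    have [Rh|nRh] := pselect (R h).
      by apply: (good_white goodR) => //; [exact: frameR|apply: e1R ez|apply: e1R ez'].
    case: ez => [[[qO hp zp] ez]|[[]//]]; case: ez' => [[[_ _ zp'] ez']|[[]//]].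
    by case: nO.
  (* The default avoids the white forbidden by a common neighbour: it is label 1 when there is none
     of sort 0, label 2 when there is one of sort 0 but none of sort 1, and the blurred red when
     there are both. *)
  rewrite lab'd // /dflt.
  have -> : (srt' z' < 2) = false by lia.
  have -> : (srt' z < 2) = false by lia.
  have com : common (srt' h) q z z' by exists h.
  case: (srt' h) sh com => [|[|//]] _ com; rewrite (asboolT com) //.
    by case: ifP.
  by case: ifP.
- move=> q x y z pq Dx Dy Dz hx hy hz rxy ryz rxz.
  have [o|nO] := pselect ([/\ bothO q x y, bothO q y z & bothO q x z]).
    case: o => o1 o2 o3; move: rxy ryz rxz; rewrite !lab'O // => rxy ryz rxz.
    case: o1 o2 => qO xp yp [_ _ zp].
    rewrite (srt'O xp) in hx hy; rewrite (srt'O yp) in hy hz; rewrite (srt'O zp) in hz.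
    by apply: (good_tri goodD) => //; apply: frameO.
  have [o|nR] := pselect ([/\ bothR q x y, bothR q y z & bothR q x z]).
    case: o => o1 o2 o3; move: rxy ryz rxz; rewrite !lab'R // => rxy ryz rxz.
    case: o1 o2 => qO xp yp [_ _ zp].
    by apply: (good_tri goodR) => //; apply: frameR.
  have ns u w : srt' u < srt' w -> uedge q u w = lab' q u w by rewrite /uedge => ->.
  have xz : srt' x < srt' z by lia.
  have hx6 : 1 < srt' x < 6 by lia.
  have hy6 : 1 < srt' y < 6 by lia.
  have hz6 : 1 < srt' z < 6 by lia.
  have [exy eyz exz] : [/\ srt' x != srt' y, srt' y != srt' z & srt' x != srt' z] by split; lia.
  have [fxy fyz fxz] : [/\ srt' y != srt' x, srt' z != srt' y & srt' z != srt' x] by split; lia.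
  (* Two old edges make the third old, and likewise for prescribed ones. So this triangle has a
     default edge, whose red is blurred, and the other two edges have to be blurred as well. *)
  suff [-> -> ->] : [/\ lab' q x y = 0, lab' q y z = 0 & lab' q x z = 0] by [].
  have yz : srt' y < srt' z by lia.
  move: rxy ryz rxz; rewrite -(ns _ _ hy) -(ns _ _ yz) -(ns _ _ xz) => rxy ryz rxz.
  have usym u w : srt' u != srt' w -> uedge q u w = uedge q w u.
    by rewrite /uedge; case: ltngtP.
  have bRC u w : bothR q u w -> bothR q w u by case.
  have two u w v : D' p -> D' w -> D' v -> u = p ->
    1 < srt' u < 6 -> 1 < srt' w < 6 -> 1 < srt' v < 6 -> 
    srt' u != srt' w -> srt' u != srt' v -> srt' w != srt' v ->
    red (uedge q u w) -> red (uedge q u v) -> red (uedge q w v) ->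
    ~ [/\ bothR q u w, bothR q w v & bothR q u v] ->
    [/\ uedge q u w = 0, uedge q u v = 0 & uedge q w v = 0].
    move=> Dp Dw Dv up; rewrite {}up => hu hw hv n1 n2 n3 r1 r2 r3 nA.
    have [R1|R1] := pselect (bothR q p w); last exact: uedge_tri.
    have [R2|R2] := pselect (bothR q p v).
      by case: nA; split=> //; case: R1 R2 => ? ? ? [].
    rewrite (usym w v) // in r3 *.
    by have [] := @uedge_tri q v w pq Dv Dw Dp hu hv hw n2 n1 ltac:(by rewrite eq_sym) R2 r2 r1 r3.
  case: (lt_or_new Dx) => xp; last first.
    have [] := two x y z ltac:(by rewrite -xp) Dy Dz xp hx6 hy6 hz6 exy exz eyz rxy rxz ryz.
      by case=> *; apply: nR.
    by move=> -> -> ->.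
  case: (lt_or_new Dy) => yp; last first.
    have [] := two y x z ltac:(by rewrite -yp) Dx Dz yp hy6 hx6 hz6 fxy eyz exz
      ltac:(by rewrite usym) ryz rxz.
      by case=> *; apply: nR; split=> //; apply: bRC.
    by rewrite (usym x y) // => -> -> ->.
  case: (lt_or_new Dz) => zp; last first.
    have [] := two z x y ltac:(by rewrite -zp) Dx Dy zp hz6 hx6 hy6 fxz fyz exy
      ltac:(by rewrite usym) ltac:(by rewrite usym) rxy.
      by case=> *; apply: nR; split=> //; apply: bRC.
    by rewrite (usym x z) // (usym y z) // => -> -> ->.
  (* The three points are old, so the frame is not. A default red would need an old frame, hence all
     three edges are prescribed. *)
  have [qO|nqO] := pselect (forall m, q m < p); first by case: nO; split; split.
  have far u w : D' u -> D' w -> 1 < srt' u -> srt' u < srt' w < 6 -> red (uedge q u w) ->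
    bothR q u w.
    move=> Du Dw hu hw; rewrite ns => [r|]; last lia.
    have [//|nRR] := pselect (bothR q u w).
    have nOO : ~ bothO q u w by case.
    by have [_ [a [b [_ [[]]]]]] := dflt_red pq Du Dw hu hw nOO nRR r.
  by case: nR; split; apply: far => //; lia.
Qed.

(** A real red between apexes is never a default label, and a prescribed one over a base is also
    old, because a frame, a base and two apexes are too many points for [R]. It remains to look at
    the label of the base, which is old or fits. *)
Lemma sparse_step : sparse D' srt' lab'.
Proof.
move=> q a b z z' j pq Da Db Dz Dz' sa sb hz hz' ea eb ea' eb' ge j6 jz jz' j1.
have {}ea : e1 q a z by apply: e1P => //; lia.
have {}eb : e1 q b z by apply: e1P => //; lia.
have {}ea' : e1 q a z' by apply: e1P => //; lia.
have {}eb' : e1 q b z' by apply: e1P => //; lia.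
have four : frame R srt' q -> R a -> R b -> R z -> R z' -> False.
  move=> pR Ra Rb Rz Rz'; apply: (@count4 q a b z z') => //=; rewrite ?inE; lia.
have old : bothO q z z' -> ~~ allowed (lab' q a b) j.
  move=> o; case: (o) => qO zp zp'.
  have [oab|nO] := pselect (bothO q a b).
    case: oab => _ ap bp; rewrite (srt'O ap) in sa; rewrite (srt'O bp) in sb.
    rewrite (srt'O zp) in hz hz' jz; rewrite (srt'O zp') in hz' jz'.
    move: ge; rewrite !lab'O // => ge.
    by apply: (@sparseD q a b z z' j) => //;
      try exact: e1O; try exact: frameO.
  have nR : ~ bothR q a b.
    case=> qR Ra Rb; apply: nO; split=> //.
      case: (lt_or_new Da) => // ap.
      case: ea => [[[_ ]]|[[_ _ Rz] _]]; first by rewrite ap ltnn.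
      case: ea' => [[[_ ]]|[[_ _ Rz'] _]]; first by rewrite ap ltnn.
      by case: four => //; apply: frameR.
    case: (lt_or_new Db) => // bp.
    case: eb => [[[_ ]]|[[_ _ Rz] _]]; first by rewrite bp ltnn.
    case: eb' => [[[_ ]]|[[_ _ Rz'] _]]; first by rewrite bp ltnn.
    by case: four => //; apply: frameR.
  by have [_ /(_ z z' j)] := fitsP pq Da Db sa sb nO nR; apply.
have [/old //|nO] := pselect (bothO q z z').
have [[qR Rz Rz']|nR] := pselect (bothR q z z').
  have pR := frameR pq qR.
  case: ea => [[[qO ap zp] _]|[[_ Ra _] _]].
    case: ea' => [[[_ _ zp'] _]|[[_ Ra _] _]]; first by case: nO.
    case: eb' => [[[_ _ zp'] _]|[[_ Rb _] _]]; first by case: nO.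
    by case: four.
  case: eb => [[[qO bp zp] _]|[[_ Rb _] _]]; last by case: four.
  case: eb' => [[[_ _ zp'] _]|[[_ Rb _] _]]; first by case: nO.
  by case: four.
have := ge; rewrite lab'd // /dflt.
have -> : (srt' z' < 2) = false by lia.
have -> : (srt' z < 2) = false by lia.
by case: ifP => //; case: ifP.
Qed.
End Step.

(** * A homogeneous model on the natural numbers *)

Section Counting.
Variables (k : nat) (T : eqType) (v : 'I_k.+3 -> T) (srt : T -> nat) (R : T -> Prop).
Hypothesis Rv : forall x, R x -> exists j, v j = x.

(** The k frame sorts and the sorts of [l] are distinct values of [srt \o v], which has only k + 3
    arguments. Three sorts in [l] use up all of them. *)
Lemma count_sorts (q : 'I_k -> T) (l : seq T) : frame R srt q ->
  (forall x, x \in l -> R x) -> uniq (map srt l) -> all (fun s => s < 6) (map srt l) ->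
  size l <= 3 /\ (size l = 3 -> injective (srt \o v)).
Proof.
move=> pq Rl ul l6.
pose L := map (fun m => srt (q m)) (enum 'I_k) ++ map srt l.
have eL : map (fun m => srt (q m)) (enum 'I_k) = map (fun m : 'I_k => 6 + m) (enum 'I_k).
  by apply: eq_map => m; case: (pq m).
have uL : uniq L.
  rewrite cat_uniq ul andbT eL map_inj_uniq ?enum_uniq => [|x y /addnI/val_inj //].
  apply/hasPn => s /(allP l6) s6; apply/negP => /mapP[m _ es].
  by move: s6; rewrite es /=; lia.
have sub : {subset L <= map (srt \o v) (enum 'I_k.+3)}.
  move=> s; rewrite mem_cat => /orP[] /mapP[x xl ->].
    by have [/Rv[j <-] _] := pq x; apply/mapP; exists j; rewrite ?mem_enum.
  by have [j <-] := Rv (Rl _ xl); apply/mapP; exists j; rewrite ?mem_enum.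
have sz : size (map (srt \o v) (enum 'I_k.+3)) = k + 3 by rewrite size_map size_enum_ord addn3.
have szL : size L = k + size l by rewrite /L size_cat size_map size_enum_ord size_map.
have := uniq_leq_size uL sub; rewrite sz szL leq_add2l => le; split=> // l3.
have u : uniq (map (srt \o v) (enum 'I_k.+3)).
  by have [_ eqL] := uniq_min_size uL sub ltac:(by rewrite sz szL l3);
     rewrite (uniq_size_uniq uL eqL) sz szL l3.
by apply/injectiveP; rewrite /injectiveb /dinjectiveb.
Qed.
End Counting.

Lemma good_image k I J (D : I -> Prop) (E : J -> Prop) (v : I -> J) srtI srtJ
    (lbI : ('I_k -> I) -> I -> I -> nat) (lbJ : ('I_k -> J) -> J -> J -> nat) :
  (forall y, E y -> exists2 x, D x & v x = y) ->
  (forall x, D x -> srtJ (v x) = srtI x) ->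
  (forall g x y, (forall m, D (g m)) -> D x -> D y -> lbJ (v \o g) (v x) (v y) = lbI g x y) ->
  good D srtI lbI -> good E srtJ lbJ.
Proof.
move=> sur hs hl gI.
have lift g : frame E srtJ g -> exists2 g', frame D srtI g' & v \o g' = g.
  move=> fg; have /choice[g' hg'] m : exists x, D x /\ v x = g m.
    by have [/sur[x ? ?] _] := fg m; exists x.
  exists g'; last by apply/funext => m /=; case: (hg' m).
  by move=> m; have [Dg e] := hg' m; split=> //; rewrite -hs // e; case: (fg m).
split.
- move=> g _ _ _ /lift[g' fg <-] /sur[a Da <-] /sur[b Db <-] /sur[z Dz <-].
  have Dg m : D (g' m) by case: (fg m).
  by rewrite !hs // !hl //; apply: (good_base gI).
- move=> g _ _ _ /lift[g' fg <-] /sur[a Da <-] /sur[b Db <-] /sur[z Dz <-].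
  have Dg m : D (g' m) by case: (fg m).
  by rewrite !hs // !hl //; apply: (good_white gI).
- move=> g _ _ _ /lift[g' fg <-] /sur[a Da <-] /sur[b Db <-] /sur[z Dz <-].
  have Dg m : D (g' m) by case: (fg m).
  by rewrite !hs // !hl //; apply: (good_tri gI).
Qed.

Lemma unbounded_inj (f : nat -> nat) b : injective f -> exists d, b <= f d.
Proof.
move=> fi; apply/not_existsP => h.
have lt d : f d < b by rewrite ltnNge; apply/negP/h.
have inj : injective (fun i : 'I_b.+1 => Ordinal (lt i)).
  by move=> i j [] /fi /val_inj.
by have := leq_card _ inj; rewrite !card_ord ltnn.
Qed.

Definition upd n (A : Type) (s : 'I_n -> A) i x : 'I_n -> A := fun j => if j == i then x else s j.

(** * Construction of the model in stages, one point at a time *)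

Section Model.
Variable k : nat.
Notation n := k.+3.
Notation labels I := (('I_k -> I) -> I -> I -> nat).

(** The indices in use, the old points, the index and the sort of the new point, and the prescribed
    labels. All of it is stated on indices and finite, so that [unpickle] enumerates the
    requests. *)
Definition request : Type :=
  ({set 'I_n} * {ffun 'I_n -> nat} * 'I_n * nat * {ffun {ffun 'I_k -> 'I_n} * 'I_n * 'I_n -> nat})%type.

Record stage := Stage { ssrt : nat -> nat; slab : labels nat }.

Definition stage_ok p S :=
  [/\ forall x, ssrt S x < k + 6, good (fun x => x < p) (ssrt S) (slab S)
   & sparse (fun x => x < p) (ssrt S) (slab S)].

Definition image_on (D : 'I_n -> Prop) (v : 'I_n -> nat) x := exists2 j, D j & v j = x.

Definition admissible p S (D : {set 'I_n}) (u : 'I_n -> nat) (i : 'I_n) t (T : labels 'I_n) :=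
  let v := upd u i p in
  [/\ i \in D, t < k + 6, forall j, j \in D -> j != i -> u j < p &
   exists ell, [/\ forall q x y, bothO p q x y -> bothR (image_on (fun j => j \in D) v) q x y ->
        ell q x y = slab S q x y,
     good (image_on (fun j => j \in D) v) (srt' p t (ssrt S)) ell
   & forall g j j', (forall m, g m \in D) -> j \in D -> j' \in D ->
        ell (v \o g) (v j) (v j') = T g j j']].

Definition extends p S S' :=
  (forall x, x < p -> ssrt S' x = ssrt S x) /\
  (forall q x y, bothO p q x y -> slab S' q x y = slab S q x y).

Definition realizes S (D : {set 'I_n}) (u : 'I_n -> nat) (i : 'I_n) t (T : labels 'I_n) p :=
  let v := upd u i p in
  ssrt S p = t /\ forall g j j', (forall m, g m \in D) -> j \in D -> j' \in D ->
     slab S (v \o g) (v j) (v j') = T g j j'.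

Lemma stage_admissible p S D u i t T : stage_ok p S -> admissible p S D u i t T ->
  exists S', [/\ stage_ok p.+1 S', extends p S S' & realizes S' D u i t T p].
Proof.
move=> [srtb gS sS] [iD tb up [ell [agree gR tab]]].
set v := upd u i p in agree gR tab; set R := image_on _ v in agree gR.
have Rp x : R x -> x < p.+1.
  by case=> j jD <-; rewrite /v /upd; case: eqP => // /eqP ji; apply/ltnW/up.
have Rv x : R x -> exists j, v j = x by case=> j _ <-; exists j.
have c4 : forall (f : 'I_k -> nat) x y z w, frame R (srt' p t (ssrt S)) f -> R x -> R y -> R z -> R w ->
    uniq (map (srt' p t (ssrt S)) [:: x; y; z; w]) ->
    all (fun s => s < 6) (map (srt' p t (ssrt S)) [:: x; y; z; w]) -> False.
  move=> f x y z w fq Rx Ry Rz Rw un al.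
  have Rl a : a \in [:: x; y; z; w] -> R a by rewrite !inE => /or4P[] /eqP ->.
  by have [] := count_sorts Rv fq Rl un al.
have c3 : forall (f : 'I_k -> nat) x y z x', frame R (srt' p t (ssrt S)) f -> R x -> R y -> R z -> R x' ->
    uniq (map (srt' p t (ssrt S)) [:: x; y; z]) ->
    all (fun s => s < 6) (map (srt' p t (ssrt S)) [:: x; y; z]) ->
    srt' p t (ssrt S) x' = srt' p t (ssrt S) x -> x' = x.
  move=> f x y z x' fq Rx Ry Rz Rx' un al; have [j' <-] := Rv _ Rx'.
  have Rl a : a \in [:: x; y; z] -> R a by rewrite !inE => /or3P[] /eqP ->.
  have [_ /(_ erefl) inj] := count_sorts Rv fq Rl un al.
  by have [j <-] := Rv _ Rx => /inj ->.
pose S' := Stage (srt' p t (ssrt S)) (lab' p t (ssrt S) (slab S) ell R).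
have ok : stage_ok p.+1 S'.
  split=> /=.
  - by move=> x; rewrite /srt'; case: ifP.
  - exact: good_step.
  - exact: sparse_step.
exists S'; split=> //.
  split=> [x xp|q x y o] /=; first by rewrite srt'O.
  exact: lab'O.
split=> [|g j j' gD jD jD'] /=; first by rewrite /srt' eqxx.
rewrite lab'R ?tab //; split; [by move=> m; exists (g m); first exact: gD|by exists j|by exists j'].
Qed.

Definition decode (r : request) (P : {set 'I_n} -> ('I_n -> nat) -> 'I_n -> nat -> labels 'I_n -> Prop) :=
  P r.1.1.1.1 r.1.1.1.2 r.1.1.2 r.1.2 (fun g j j' => r.2 (finfun g, j, j')).

Lemma stage_next p S : stage_ok p S -> exists S', [/\ stage_ok p.+1 S', extends p S S' &
  forall r d, unpickle p = Some ((r, d) : request * nat) -> decode r (admissible p S) ->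
    decode r (fun D u i t T => realizes S' D u i t T p)].
Proof.
move=> ok.
have [[r [d [e val]]]|no] := pselect (exists r d, unpickle p = Some ((r, d) : request * nat) /\
    decode r (admissible p S)).
  have [S' [ok' ext re]] := stage_admissible ok val.
  by exists S'; split=> // r' d'; rewrite e => -[<- _].
(* Without an admissible request, [p] is added as a point of sort 0 with nothing prescribed towards
   older points, so that each stage adds exactly one point. *)
have val : admissible p S [set ord0]%SET (fun=> 0) ord0 0 (fun _ _ _ => 2).
  split; [by rewrite inE|by rewrite addnS|by move=> j; rewrite inE => ->|].
  exists (fun q x y => if `[< bothO p q x y >] then slab S q x y else 2); split.
  - by move=> q x y o _; rewrite asboolT.
  - have Rx x : image_on (fun j => j \in [set ord0]%SET) (upd (fun=> 0) (ord0 : 'I_n) p) x -> x = p.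
      by case=> j; rewrite /= inE /upd => -> <-.
    split.
    + by move=> g a b z _ Da Db _; rewrite (Rx _ Da) (Rx _ Db) => ->.
    + by move=> g h z z' _ _ Dz Dz' _ _; rewrite (Rx _ Dz) (Rx _ Dz') ltnn.
    + by move=> g x y z _ Dx Dy _ _; rewrite (Rx _ Dx) (Rx _ Dy) ltnn.
  - move=> g j j' gD; rewrite !inE => /eqP -> _; rewrite asboolF //.
    by case=> _; rewrite /upd eqxx ltnn.
have [S' [ok' ext _]] := stage_admissible ok val.
by exists S'; split=> // r d e v; case: no; exists r, d.
Qed.

Definition stage0 : stage := Stage (fun=> 0) (fun _ _ _ => 2).

Lemma stage0_ok : stage_ok 0 stage0.
Proof.
split=> [x||] /=; first by rewrite addnS.
  by split=> g a b z.
by move=> g a b z.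
Qed.

Definition next p (S : {S | stage_ok p S}) : {S | stage_ok p.+1 S} :=
  let c := cid (stage_next (svalP S)) in
  exist _ (sval c) (let: And3 ok _ _ := svalP c in ok).

Fixpoint stages p : {S | stage_ok p S} :=
  if p is p'.+1 then next (stages p') else exist _ stage0 stage0_ok.

Lemma next_extends p : extends p (sval (stages p)) (sval (stages p.+1)).
Proof. by rewrite /= /next /=; case: cid => S' []. Qed.

Lemma next_realizes p r d : unpickle p = Some ((r, d) : request * nat) ->
  decode r (admissible p (sval (stages p))) ->
  decode r (fun D u i t T => realizes (sval (stages p.+1)) D u i t T p).
Proof. by move=> e v; rewrite /= /next /=; case: cid => S' [ok ext h]; apply: (h r d e v). Qed.

Lemma stages_extend p p' : p <= p' -> extends p (sval (stages p)) (sval (stages p')).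
Proof.
move=> le; have [d ->] : exists d, p' = p + d by exists (p' - p); rewrite subnKC.
elim: d => [|d [IH1 IH2]]; first by rewrite addn0.
rewrite addnS; have [h1 h2] := next_extends (p + d); split.
  by move=> x xp; rewrite h1 ?IH1 // (leq_trans xp) ?leq_addr.
move=> q x y [qp xp yp]; rewrite h2 ?IH2 //.
by split=> [m||]; apply: leq_trans (leq_addr _ _).
Qed.

Definition msrt x := ssrt (sval (stages x.+1)) x.
Definition mtop (q : 'I_k -> nat) x y := (\max_(m < k) q m + x + y).+1.
Definition mlab q x y := slab (sval (stages (mtop q x y))) q x y.

Lemma mtopP q x y : bothO (mtop q x y) q x y.
Proof.
rewrite /mtop; split=> [m||]; rewrite ltnS; last lia; last lia.
by rewrite -addnA; apply: leq_trans (leq_addr _ _); apply: leq_bigmax.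
Qed.

Lemma msrtE p x : x < p -> ssrt (sval (stages p)) x = msrt x.
Proof. by move=> xp; have [-> //] := stages_extend xp; rewrite ltnS. Qed.

Lemma mlabE p q x y : bothO p q x y -> slab (sval (stages p)) q x y = mlab q x y.
Proof.
move=> o; rewrite /mlab; set p' := mtop q x y.
case: (leqP p p') => le.
  by have [_ ->] := stages_extend le.
by have [_ ->] := stages_extend (ltnW le); last exact: mtopP.
Qed.

Lemma msrt_bound x : msrt x < k + 6.
Proof. by have [h _ _] := svalP (stages x.+1); apply: h. Qed.

Lemma good_below (D : nat -> Prop) (p : nat) srt srt' (lb lb' : labels nat) :
  (forall x, D x -> x < p) -> (forall x, x < p -> srt' x = srt x) ->
  (forall q x y, bothO p q x y -> lb' q x y = lb q x y) ->
  good (fun x => x < p) srt lb -> good D srt' lb'.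
Proof.
move=> Dp hs hl gp.
have fr (q : 'I_k -> nat) : frame D srt' q -> frame (fun x => x < p) srt q.
  by move=> fq m; have [/Dp lt <-] := fq m; rewrite hs.
split=> q x y z fq /Dp xp /Dp yp /Dp zp; have qp m := proj1 (fr q fq m); rewrite !hs // !hl //.
- by apply: (good_base gp) => //; apply: fr.
- by apply: (good_white gp) => //; apply: fr.
- by apply: (good_tri gp) => //; apply: fr.
Qed.

Lemma good_finite (D : nat -> Prop) srt (lb : labels nat) :
  (forall p, good (fun x => D x /\ x < p) srt lb) -> good D srt lb.
Proof.
move=> h.
have fr (q : 'I_k -> nat) x y z : frame D srt q -> frame (fun u => D u /\ u < (mtop q x y + z).+1) srt q.
  move=> fq m; have [Dm sm] := fq m; split=> //; split=> //.
  by have [/(_ m) + _ _] := mtopP q x y; lia.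
split=> q x y z fq Dx Dy Dz; have [_ xt yt] := mtopP q x y.
- by apply: (good_base (h (mtop q x y + z).+1)); [exact: fr|split=> //; lia..].
- by apply: (good_white (h (mtop q x y + z).+1)); [exact: fr|split=> //; lia..].
- by apply: (good_tri (h (mtop q x y + z).+1)); [exact: fr|split=> //; lia..].
Qed.

Lemma mgood : good (fun=> True) msrt mlab.
Proof.
apply: good_finite => p; have [_ gS _] := svalP (stages p).
apply: good_below gS; first by move=> x [].
  by move=> x xp; rewrite msrtE.
by move=> q x y o; rewrite mlabE.
Qed.

(** The indices that name the same point once [i] names a new one. *)
Definition sim (u : 'I_n -> nat) (i j j' : 'I_n) :=
  (j == j') || [&& j != i, j' != i & u j == u j'].

Lemma model_extension (D : {set 'I_n}) (u : 'I_n -> nat) (i : 'I_n) t (T : labels 'I_n) :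
  i \in D -> t < k + 6 ->
  (forall g j j', (forall m, g m \in D :\ i) -> j \in D :\ i -> j' \in D :\ i ->
     T g j j' = mlab (u \o g) (u j) (u j')) ->
  (forall g g' x x' y y', (forall m, g m \in D /\ g' m \in D) -> x \in D -> x' \in D ->
     y \in D -> y' \in D -> (forall m, sim u i (g m) (g' m)) -> sim u i x x' -> sim u i y y' ->
     T g x y = T g' x' y') ->
  good (fun j => j \in D) (fun j => if j == i then t else msrt (u j)) T ->
  exists x, [/\ forall j, j \in D -> j != i -> u j != x, msrt x = t &
    forall g j j', (forall m, g m \in D) -> j \in D -> j' \in D ->
      mlab (upd u i x \o g) (upd u i x j) (upd u i x j') = T g j j'].
Proof.
move=> iD tb oldT simT goodT.
pose b := (\max_j u j).+1.
have ub j : u j < b by rewrite ltnS leq_bigmax.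
pose r : request := (D, finfun u, i, t, [ffun x : {ffun 'I_k -> 'I_n} * 'I_n * 'I_n => T x.1.1 x.1.2 x.2]).
(* The counter [d] makes each request recur at arbitrarily late stages, here at one where all the
   points [u j] are present. *)
have [d [p bd pE]] : exists d, exists2 p, b <= p & unpickle p = Some ((r, d) : request * nat).
  have inj : injective (fun d => pickle ((r, d) : request * nat)).
    by move=> d d' /(pcan_inj pickleK) [].
  by have [d bd] := unbounded_inj b inj; exists d, (pickle ((r, d) : request * nat)); rewrite ?pickleK.
have ue : finfun u = u :> ('I_n -> nat) by apply/funext => j; rewrite ffunE.
have Te : (fun g j j' => r.2 (finfun g, j, j')) = T.
  apply/funext => g; apply/funext => j; apply/funext => j'; rewrite /= ffunE /=.
  by congr (T _ j j'); apply/funext => m; rewrite ffunE.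
have up j : u j < p by apply: leq_trans (ub j) bd.
set v := upd u i p.
have simv j j' : v j = v j' -> sim u i j j'.
  rewrite /v /upd /sim; case: (altP (j =P i)) => [->|ji]; case: (altP (j' =P i)) => [->|ji'] //=.
  - by rewrite eqxx.
  - by move=> e; have := up j'; rewrite -e ltnn.
  - by move=> e; have := up j; rewrite e ltnn.
  - by move=> ->; rewrite eqxx orbT.
(* Carries [T] from indices to points. Several indices may name one point; [simT] makes the value
   independent of the choice. *)
pose ell q x y := xget 0 [set w | exists g j j', [/\ (forall m, g m \in D) /\ v \o g = q,
   j \in D /\ v j = x, j' \in D /\ v j' = y & w = T g j j']].
have ellE g j j' : (forall m, g m \in D) -> j \in D -> j' \in D ->
    ell (v \o g) (v j) (v j') = T g j j'.
  move=> gD jD jD'; rewrite /ell; case: xgetP => [w _|/(_ (T g j j'))]; last first.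
    by case; exists g, j, j'.
  case=> g2 [j2 [j2' [[g2D eg] [j2D ej] [j2D' ej'] ->]]].
  apply: simT => //; try exact: simv.
  by move=> m; apply: simv; apply: (congr1 (fun f => f m) eg).
have vsrt j : srt' p t (ssrt (sval (stages p))) (v j) = (if j == i then t else msrt (u j)).
  rewrite /v /upd /srt'; case: (altP (j =P i)) => ji; first by rewrite eqxx.
  by rewrite msrtE //; case: eqP => // e; have := up j; rewrite e ltnn.
have val : decode r (admissible p (sval (stages p))).
  rewrite /decode Te /= ue; split=> //; exists ell; split=> //.
    move=> q x y o [qR [j jD ej] [j' jD' ej']].
    have /choice[g hg] m : exists j, j \in D /\ v j = q m by have [j2 ? ?] := qR m; exists j2.
    have eq : v \o g = q by apply/funext => m /=; case: (hg m).
    have old j2 : v j2 < p -> j2 != i by rewrite /v /upd; case: eqP => //; rewrite ltnn.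
    have vu j2 : j2 != i -> v j2 = u j2 by rewrite /v /upd => /negbTE ->.
    rewrite mlabE // -eq -ej -ej' ellE //; last by move=> m; case: (hg m).
    move: o; rewrite -eq -ej -ej' => -[gp /old ji /old ji'].
    have gDi m : g m \in D :\ i by rewrite !inE (old _ (gp m)); case: (hg m).
    have jDi : j \in D :\ i by rewrite !inE ji.
    have jDi' : j' \in D :\ i by rewrite !inE ji'.
    rewrite oldT // -/v (vu _ ji) (vu _ ji'); congr (mlab _ _ _); apply/funext => m /=.
    by rewrite vu // old //; apply: gp.
  apply: (good_image (D := fun j => j \in D) (v := v)) goodT; last by move=> *; apply: ellE.
    by move=> y [j jD <-]; exists j.
  by move=> j _; rewrite vsrt.
have [st rl] : realizes (sval (stages p.+1)) D u i t T p.
  by have := next_realizes pE val; rewrite /decode Te /= ue.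
exists p; split=> [j _ _||g j j' gD jD jD'].
- by rewrite neq_ltn up.
- by rewrite -st msrtE.
- rewrite -rl // mlabE //.
  have vp j2 : v j2 < p.+1 by rewrite /v /upd; case: ifP => // _; apply: ltnW (up _).
  by split=> [m||]; apply: vp.
Qed.
End Model.

(** * Types of tuples *)

(* Blurs all but finitely many reds into 0. Reds 2h and 2h+1 are kept or blurred together, so
   that [flip] respects truncation. *)
Definition trunc N x := if x./2 < N then x else 0.

Lemma truncE N x : trunc N x != 0 -> trunc N x = x.
Proof. by rewrite /trunc; case: ifP. Qed.

(** The bound 9 is half of 18: from there on truncation keeps all labels below 18 and blurs real
    reds only. *)
Lemma trunc_big N x : 9 <= N -> x != 0 -> trunc N x = 0 -> 18 <= x.
Proof. by rewrite /trunc; case: ifP => // h1 h2 /eqP + e; rewrite ?e //; lia. Qed.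

Lemma trunc_inj N x y : trunc N x = trunc N y -> trunc N x != 0 -> x = y.
Proof. by move=> e ne; rewrite -(truncE ne) e truncE // -e. Qed.

Lemma trunc_cases N x y : 9 <= N -> trunc N x = trunc N y ->
  x = y \/ ((x == 0) || (18 <= x)) && ((y == 0) || (18 <= y)).
Proof.
move=> N9 e; have [z|/(trunc_inj e)] := eqVneq (trunc N x) 0; last by left.
right; have [->|x0] := eqVneq x 0 => /=.
  by have [->//|y0] := eqVneq y 0; rewrite /= (trunc_big N9 y0) // -e.
rewrite (trunc_big N9 x0) //=.
by have [->//|y0] := eqVneq y 0; rewrite /= (trunc_big N9 y0) // -e.
Qed.

Lemma trunc_sem N x y : 9 <= N -> trunc N x = trunc N y ->
  [/\ (x == 1) = (y == 1), forall c, white c x = white c y, red x = red y &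
   forall j, allowed x j = allowed y j].
Proof.
move=> N9 /(trunc_cases N9)[->//|h].
have [x1 y1] : (x == 1) = false /\ (y == 1) = false by split; lia.
have [x2 y2] : (1 < x < 18) = false /\ (1 < y < 18) = false by split; lia.
split=> [|c||j]; rewrite ?x1 ?y1 ?/white ?/allowed ?x1 ?y1 ?x2 ?y2 ?/red //.
by move/andP: h => [-> ->].
Qed.

Section Types.
Variable k : nat.
Notation n := k.+3.
Notation labels I := (('I_k -> I) -> I -> I -> nat).
Notation full := ([set: 'I_n]%SET).
Notation srt := (@msrt k).
Notation lab := (@mlab k).

(** Among the conditions of [good] only the one on red triangles distinguishes the reds, so it alone
    has to be checked anew. *)
Lemma good_trunc N I (D : I -> Prop) (sr : I -> nat) (T T0 : labels I) : 9 <= N ->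
  (forall g x y, trunc N (T g x y) = trunc N (T0 g x y)) ->
  good D sr T0 ->
  (forall g x y z, frame D sr g -> D x -> D y -> D z ->
    1 < sr x -> sr x < sr y -> sr y < sr z < 6 ->
    red (T g x y) -> red (T g y z) -> red (T g x z) ->
    tri (T0 g x y) (T0 g y z) (T0 g x z) ->
    tri (T g x y) (T g y z) (T g x z)) ->
  good D sr T.
Proof.
move=> N9 tE g0 gt.
have sem g x y := trunc_sem N9 (tE g x y).
have one g x y : T g x y = 1 -> T0 g x y = 1.
  by have [e _ _ _] := sem g x y; move/eqP; rewrite e => /eqP.
split.
- move=> g a b z fg Da Db Dz sa sb sz /one e1 /one e2.
  have [_ _ _ ->] := sem g a b.
  exact: (good_base g0).
- move=> g h z z' fg Dh Dz Dz' sh sz sz' /one e1 /one e2.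
  have [_ -> _ _] := sem g z z'.
  exact: (good_white g0).
- move=> g x y z fg Dx Dy Dz hx hy hz r1 r2 r3; apply: gt => //.
  apply: (good_tri g0) => //.
  + by have [_ _ <- _] := sem g x y.
  + by have [_ _ <- _] := sem g y z.
  + by have [_ _ <- _] := sem g x z.
Qed.

(** With [tr] equal to [id] this describes exact types, with [trunc N] blurred ones. Only the
    coincidences among the values of [e] matter. *)
Definition matches (tr : nat -> nat) (D : {set 'I_n}) (s : 'I_n -> nat)
    (sr e : 'I_n -> nat) (T : labels 'I_n) :=
  [/\ forall j j', j \in D -> j' \in D -> (s j == s j') = (e j == e j'),
      forall j, j \in D -> srt (s j) = sr j &
      forall g j j', (forall m, g m \in D) -> j \in D -> j' \in D ->
        tr (lab (s \o g) (s j) (s j')) = tr (T g j j')].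

Definition pull (w : 'I_n -> nat) : labels 'I_n := fun g j j' => lab (w \o g) (w j) (w j').

Definition alike tr D s w := matches tr D s (srt \o w) w (pull w).

Definition congruent (e : 'I_n -> nat) (T : labels 'I_n) :=
  forall g g' x x' y y', (forall m, e (g m) = e (g' m)) -> e x = e x' -> e y = e y' ->
    T g x y = T g' x' y'.

Lemma pull_congruent w : congruent w (pull w).
Proof. by move=> g g' x x' y y' eg ex ey; rewrite /pull ex ey; congr (lab _ _ _); apply/funext. Qed.

Lemma matches_dup tr (D : {set 'I_n}) i j s (sr e : 'I_n -> nat) T :
  congruent e T -> sr i = sr j -> e i = e j -> j \in D :\ i ->
  matches tr (D :\ i) s sr e T -> matches tr D (upd s i (s j)) sr e T.
Proof.
move=> cT sij eij jD [h1 h2 h3].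
pose r a := if a == i then j else a.
have rD a : a \in D -> r a \in D :\ i.
  by rewrite /r; case: ifP => // ai aD; rewrite !inE ai.
have ur a : upd s i (s j) a = s (r a) by rewrite /upd /r; case: ifP.
have er a : e (r a) = e a by rewrite /r; case: eqP => // ->.
split.
- by move=> a b aD bD; rewrite !ur h1 ?rD // !er.
- by move=> a aD; rewrite ur h2 ?rD // /r; case: eqP => // ->.
- move=> g a b gD aD bD.
  have -> : upd s i (s j) \o g = s \o (r \o g) by apply/funext => m; rewrite /= ur.
  rewrite !ur h3 ?rD //; last by move=> m; apply: rD.
  by congr tr; apply: cT => *; rewrite /= er.
Qed.

(** [T] is realised exactly, while the wanted [T0] is met only after [tr]. This leaves the freedom
    to choose the reds that truncation does not see. *)
Lemma matches_new tr (D : {set 'I_n}) i s (sr e : 'I_n -> nat) T0 T :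
  i \in D -> sr i < k + 6 -> (forall j, j \in D -> j != i -> e j != e i) ->
  congruent e T ->
  (forall g j j', tr (T g j j') = tr (T0 g j j')) ->
  good (fun j => j \in D) sr T ->
  matches id (D :\ i) s sr e T ->
  exists x, matches tr D (upd s i x) sr e T0.
Proof.
move=> iD sb new cT tE gT [h1 h2 h3].
have sE j : j \in D -> (if j == i then sr i else srt (s j)) = sr j.
  by case: (altP (j =P i)) => [->//|ji jD]; rewrite h2 // !inE ji.
have simE j j' : j \in D -> j' \in D -> sim s i j j' -> e j = e j'.
  move=> jD jD'; rewrite /sim; case: eqP => [->//|_] /= /and3P[ji ji'].
  by rewrite h1 ?inE ?ji ?ji' ?jD ?jD' // => /eqP.
have gT' : good (fun j => j \in D) (fun j => if j == i then sr i else srt (s j)) T.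
  by apply: (good_image (D := fun j => j \in D) (v := id)) gT => // y yD; exists y.
have old g j j' (gD : forall m, g m \in D :\ i) (jD : j \in D :\ i) (jD' : j' \in D :\ i) :=
  esym (h3 g j j' gD jD jD').
have simT g g' a a' b b' : (forall m, g m \in D /\ g' m \in D) -> a \in D -> a' \in D ->
    b \in D -> b' \in D -> (forall m, sim s i (g m) (g' m)) -> sim s i a a' -> sim s i b b' ->
    T g a b = T g' a' b'.
  by move=> gD aD aD' bD bD' sg sa sb'; apply: cT => [m||]; apply: simE => //; case: (gD m).
have [x [nx sx lx]] := model_extension iD sb old simT gT'.
exists x; split.
- move=> j j' jD jD'; rewrite /upd.
  case: (altP (j =P i)) => [->|ji]; case: (altP (j' =P i)) => [->|ji'].
  + by rewrite !eqxx.
  + by rewrite eq_sym (negbTE (nx _ jD' ji')) eq_sym (negbTE (new _ jD' ji')).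
  + by rewrite (negbTE (nx _ jD ji)) (negbTE (new _ jD ji)).
  + by rewrite h1 // !inE ?ji ?ji'.
- move=> j jD; rewrite /upd; case: (altP (j =P i)) => [->//|ji].
  by rewrite h2 // !inE ji.
- by move=> g j j' gD jD jD'; rewrite lx // tE.
Qed.

Lemma realize (sr e : 'I_n -> nat) (T : labels 'I_n) :
  (forall j, sr j < k + 6) -> (forall j j', e j = e j' -> sr j = sr j') ->
  congruent e T -> good (fun=> True) sr T ->
  exists s, matches id full s sr e T.
Proof.
move=> sb se cT gT.
suff H m : m <= n -> exists s, matches id [set j : 'I_n | j < m]%SET s sr e T.
  have [s hs] := H n (leqnn _); exists s.
  suff <- : [set j : 'I_n | j < n]%SET = full by [].
  by apply/setP => j; rewrite !inE ltn_ord.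
elim: m => [|m IH] mn.
  by exists (fun=> 0); split=> [j j'|j|g j j' _]; rewrite inE ltn0.
have [s hs] := IH (ltnW mn); pose i : 'I_n := Ordinal mn.
have Dm : [set j : 'I_n | j < m.+1]%SET :\ i = [set j : 'I_n | j < m]%SET.
  by apply/setP => j; rewrite !inE ltnS ltn_neqAle.
rewrite -Dm in hs.
have [[j [jD ej]]|new] := pselect (exists j, j \in [set j : 'I_n | j < m.+1]%SET :\ i /\ e j = e i).
  by exists (upd s i (s j)); apply: matches_dup => //; apply: se.
have [||||x hx] := @matches_new id [set j : 'I_n | j < m.+1]%SET i s sr e T T _ (sb i) _ cT _ _ hs.
- by rewrite inE /=.
- move=> j jD ji; apply/eqP => ej; apply: new; exists j; split=> //.
  by rewrite in_setD1 ji jD.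
- by [].
- by split=> g x y z fg *; [apply: (good_base gT)|apply: (good_white gT)|apply: (good_tri gT)] => //;
    move=> m'; case: (fg m').
- by exists (upd s i x).
Qed.

Lemma pull_good w : good (fun=> True) (srt \o w) (pull w).
Proof.
split=> g x y z fg _ _ _.
- by apply: (good_base (@mgood k)) => // m; case: (fg m).
- by apply: (good_white (@mgood k)) => // m; case: (fg m).
- by apply: (good_tri (@mgood k)) => // m; case: (fg m).
Qed.

Lemma index_count (sr : 'I_n -> nat) (g : 'I_k -> 'I_n) (l : seq 'I_n) :
  frame (fun=> True) sr g -> uniq (map sr l) -> all (fun s => s < 6) (map sr l) ->
  size l <= 3 /\ (size l = 3 -> injective sr).
Proof.
move=> fg; apply: (@count_sorts k 'I_n id sr (fun=> True)) => // x _.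
by exists x.
Qed.

(** Ranges over all index triples, also those whose label is not constrained by [good], since types
    record these labels too. *)
Definition real (s : 'I_n -> nat) := forall g i j, pull s g i j != 0.

Lemma flipK x : flip (flip x) = x.
Proof.
have [o|/negbTE o] := boolP (odd x); last by rewrite /flip o /= o.
by case: x o => // x /= /negbTE o; rewrite /flip /= o /= o.
Qed.

Lemma flip_half x : (flip x)./2 = x./2.
Proof.
rewrite /flip -{1 2 3}[x]odd_double_half; case: (odd x) => /=; rewrite ?odd_double /=; lia.
Qed.

Lemma index_three (sr : 'I_n -> nat) (g : 'I_k -> 'I_n) x y z t :
  frame (fun=> True) sr g -> sr x < sr y -> sr y < sr z < 6 -> sr t < 6 ->
  [|| sr t == sr x, sr t == sr y | sr t == sr z].
Proof.
move=> fg xy yz t6; apply/negPn/negP => h.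
have u : uniq (map sr [:: t; x; y; z]) by rewrite /= !inE; lia.
have a : all (fun s => s < 6) (map sr [:: t; x; y; z]) by rewrite /=; lia.
by have [] := index_count fg u a.
Qed.

(** Each blurred label is replaced by 2N or 2N + 1, which [flip] exchanges and [trunc N] sends to 0.
    Three points beside a frame exhaust the sorts below 6, so in a red triangle [btw] holds on the
    long edge only, as [tri] demands. Hence every nonempty tame set contains a real tuple. *)
Lemma real_ex N s : 9 <= N -> exists s', real s' /\ alike (trunc N) full s' s.
Proof.
move=> N9; pose sr := srt \o s.
pose btw a b := [exists z, sr a < sr z < sr b].
pose T : labels 'I_n := fun g a b => if pull s g a b == 0 then N.*2 + btw a b else pull s g a b.
have TN g a b : trunc N (T g a b) = trunc N (pull s g a b).
  rewrite /T; case: eqP => // ->; rewrite /trunc; do 2!case: ifP => //=; case: (btw a b); lia.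
have [s' [h1 h2 h3]] : exists s', matches id full s' sr s T.
  apply: realize.
  - by move=> j; apply: msrt_bound.
  - by move=> j j' e; rewrite /sr /= e.
  - move=> g g' x x' y y' eg ex ey; rewrite /T (pull_congruent eg ex ey).
    by rewrite /btw /sr /= ex ey.
  - apply: (good_trunc (sr := sr) N9 TN (pull_good s)) => g x y z fg _ _ _ hx hxy hyz r1 r2 r3.
    have := fun t => @index_three sr g x y z t fg hxy hyz.
    move: hx hxy hyz; rewrite /sr /= => hx hxy hyz three.
    have bxy : btw x y = false.
      by apply/negbTE/existsP => -[t]; rewrite /sr /=; have := three t; lia.
    have byz : btw y z = false.
      by apply/negbTE/existsP => -[t]; rewrite /sr /=; have := three t; lia.
    have bxz : btw x z by apply/existsP; exists y; rewrite /sr /=; lia.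
    rewrite /T bxy byz bxz /tri; move: (pull s g x y) (pull s g y z) (pull s g x z) => a b c.
    case/andP=> /eqP <- /orP[/andP[/eqP -> /eqP ->]|/andP[a18 /eqP ->]]; rewrite !eqxx /=.
      by rewrite addn0 /flip odd_double addn1 eqxx andbT; lia.
    have [-> ->] : (a == 0) = false /\ (flip a == 0) = false.
      by rewrite /flip; split; [|case: ifP]; lia.
    by rewrite !eqxx a18 orbT.
have F a : a \in full by rewrite inE.
exists s'; split.
  move=> g i j; rewrite /pull h3 // /T; case: ifP => [_|/negbT//]; by rewrite -lt0n addn_gt0 double_gt0 (leq_trans _ N9).
by split; [exact: h1|exact: h2|move=> g j j' gF jF jF'; rewrite h3 // TN].
Qed.

(** The back-and-forth property that makes tame sets closed under cylindrification. Reds of [w]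
    beyond the truncation cannot be copied: they might clash with those of [s], which agree with [w]
    only after truncation. They are chosen anew. *)
Lemma extN N i s w : 9 <= N -> alike (trunc N) (full :\ i) s w ->
  exists x, alike (trunc N) full (upd s i x) w.
Proof.
move=> N9 eq_sw; have [h1 h2 h3] := eq_sw; pose sr := srt \o w.
have inF j : j != i -> j \in full :\ i by rewrite !inE => ->.
have [[j [ji ej]]|new] := pselect (exists j, j != i /\ w j = w i).
  exists (s j); apply: matches_dup => //; first exact: pull_congruent.
  - by rewrite /= ej.
  - exact: inF.
pose old (g : 'I_k -> 'I_n) a b := [&& [forall m, g m != i], a != i & b != i].
have oldF g a b : old g a b -> [/\ forall m, g m \in full :\ i, a \in full :\ i & b \in full :\ i].
  by case/and3P=> /forallP gi ai bi; split=> [m||]; apply: inF.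
pose L (fx : nat -> nat -> nat) g a b :=
  if old g a b then pull s g a b else
  if trunc N (pull w g a b) != 0 then pull w g a b else fx (sr a) (sr b).
have LN fx : (forall a b, trunc N (fx a b) = 0) ->
    forall g a b, trunc N (L fx g a b) = trunc N (pull w g a b).
  move=> fx0 g a b; rewrite /L; case: ifP => [/oldF[gF aF bF]|_]; first exact: h3.
  by case: eqP => //= ->.
have inj3 (g : 'I_k -> 'I_n) x y z a b : frame (fun=> True) sr g -> sr x < sr y -> sr y < sr z < 6 ->
    a \in [:: x; y; z] -> b \in [:: x; y; z] -> a != b -> sr a != sr b.
  move=> fg xy yz; rewrite !inE => /or3P[] /eqP -> /or3P[] /eqP -> //; rewrite ?eqxx // => _; lia.
(* [fx] supplies the labels lost by truncation. If the new index has a frame sort, [fx] is 0: every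
   label relative to a frame through [i] is new, and a triangle blurred throughout is allowed. *)
have [fx [fx0 fx6 fxT]] : exists fx : nat -> nat -> nat, [/\ forall a b, trunc N (fx a b) = 0,
    sr i < 6 \/ forall a b, fx a b = 0 &
    forall g x y z, frame (fun=> True) sr g -> 1 < sr x -> sr x < sr y -> sr y < sr z < 6 ->
      i \in [:: x; y; z] ->
      (forall a b, a \in [:: x; y; z] -> b \in [:: x; y; z] -> sr a < sr b ->
         trunc N (pull w g a b) = 0) ->
      tri (L fx g x y) (L fx g y z) (L fx g x z)].
  have [[g0 [y0 [z0 [[f0 [yi zi]] [s1 s2 s3 [s4 s5]] [X0 XN]]]]]|nobad] :=
    pselect (exists g y z,
    [/\ frame (fun=> True) sr g /\ (y != i /\ z != i),
        [/\ 1 < sr y, sr y < sr z < 6, 1 < sr i < 6 & sr i != sr y /\ sr i != sr z] &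
        pull s g y z != 0 /\ trunc N (pull s g y z) = 0]).
    set X := pull s g0 y0 z0 in X0 XN.
    have X18 := trunc_big N9 X0 XN.
    have u0 : uniq (map sr [:: i; y0; z0]) by rewrite /= !inE; lia.
    have a0 : all (fun s => s < 6) (map sr [:: i; y0; z0]) by rewrite /=; lia.
    have [_ /(_ erefl) inj] := index_count f0 u0 a0.
    have mem t : sr t < 6 -> t \in [:: i; y0; z0].
      move=> t6; apply/negPn/negP => nt.
      have u1 : uniq (map sr [:: t; i; y0; z0]).
        by rewrite map_inj_uniq // cons_uniq nt -(map_inj_uniq inj).
      have a1 : all (fun s => s < 6) (map sr [:: t; i; y0; z0]) by rewrite /= t6.
      by have [] := index_count f0 u1 a1.
    (* The old edge of the triangle carries a red beyond the truncation level, which forces the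
       two new edges: each gets [X] or [flip X], according to its place in the triangle. *)
    pose btw a b := has (fun c => a < c < b) [:: sr i; sr y0; sr z0].
    pose fx a b := if btw a b == btw (sr y0) (sr z0) then X else flip X.
    exists fx; split; [|by left; lia|].
      move=> a b; rewrite /fx; case: ifP => // _.
      by move: XN; rewrite /trunc flip_half; case: ifP => // _ e; rewrite e in X0.
    move=> g x y z fg hx hxy hyz iin H.
    have gE : g = g0 by apply/funext => m; apply: inj; have [_ ->] := fg m; have [_ ->] := f0 m.
    have LE a b : a \in [:: x; y; z] -> b \in [:: x; y; z] -> sr a < sr b ->
        L fx g a b = fx (sr a) (sr b).
      move=> ain bin ab; rewrite /L; case: ifP => [/and3P[_ ai bi]|_]; last by rewrite H.
      have lt6 c : c \in [:: x; y; z] -> sr c < 6.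
        by rewrite !inE => /or3P[] /eqP ->; lia.
      move: (mem _ (lt6 _ ain)) (mem _ (lt6 _ bin)); rewrite !inE (negbTE ai) (negbTE bi) /=.
      case/orP=> /eqP ea /orP[] /eqP eb; move: ab; rewrite ea eb ?ltnn // => ab.
        by rewrite gE /fx eqxx.
      lia.
    have three := fun t => @index_three sr g x y z t fg hxy hyz.
    have bE a b : a \in [:: x; y; z] -> b \in [:: x; y; z] -> sr a < sr b ->
        btw (sr a) (sr b) = (sr a < sr y < sr b).
      move=> ain bin ab; apply/idP/idP => [|/andP[ay yb]]; last first.
        have y6 : sr y < 6 by lia.
        move: (mem _ y6); rewrite !inE /btw /= => /or3P[] /eqP <-; rewrite ay yb ?orbT //.
      have := three i; have := three y0; have := three z0.
      move: ain bin; rewrite /btw /= !inE => /or3P[] /eqP -> /or3P[] /eqP -> //; lia.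
    have [mx my mz] : [/\ x \in [:: x; y; z], y \in [:: x; y; z] & z \in [:: x; y; z]].
      by rewrite !inE !eqxx !orbT.
    have xz : sr x < sr z by lia.
    have [hyz1 _] := andP hyz.
    rewrite !LE // /fx (bE x y) // (bE y z) // (bE x z) // !ltnn andbF /= hxy hyz1.
    rewrite /tri; case: (btw (sr y0) (sr z0)) => /=; rewrite eqxx /=.
      by rewrite flipK eqxx andbT; apply/orP; right; move: X18; rewrite /flip; case: ifP; lia.
    by rewrite X18 eqxx orbT.
  exists (fun _ _ => 0); split=> [a b||]; [by rewrite /trunc; case: ifP|by right|].
  move=> g x y z fg hx hxy hyz iin H.
  have z6 : forall c, c \in [:: x; y; z] -> 1 < sr c < 6.
    by move=> c; rewrite !inE => /or3P[] /eqP ->; lia.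
  have LE a b : a \in [:: x; y; z] -> b \in [:: x; y; z] -> sr a < sr b ->
      L (fun _ _ => 0) g a b = 0.
    move=> ain bin ab; rewrite /L; case: ifP => [o|_]; last by rewrite H.
    have [gF aF bF] := oldF _ _ _ o; have /and3P[_ ai bi] := o.
    apply/eqP/negPn/negP => n0; apply: nobad; exists g, a, b; split=> //.
      split; [by case/andP: (z6 _ ain)|by case/andP: (z6 _ bin) => _ ->; rewrite ab|exact: z6|].
      by split; rewrite (inj3 g x y z) // eq_sym.
    by split=> //; rewrite [LHS]h3 //; apply: H.
  have [mx my mz] : [/\ x \in [:: x; y; z], y \in [:: x; y; z] & z \in [:: x; y; z]].
    by rewrite !inE !eqxx !orbT.
  have xz : sr x < sr z by lia.
  have [hyz1 _] := andP hyz.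
  by rewrite !LE.
have gL : good (fun=> True) sr (L fx).
  apply: (good_trunc (sr := sr) N9 (LN _ fx0) (pull_good w)) => g x y z fg _ _ _ hx hxy hyz r1 r2 r3 t0.
  have tE := LN _ fx0 g.
  (* [flip] preserves halves, so truncation blurs either all three labels of a red triangle or
     none. *)
  have [t1|t1] := eqVneq (trunc N (pull w g x y)) 0; last first.
    have t2 : trunc N (pull w g y z) != 0 by move: t0 t1; rewrite /tri => /andP[/eqP ->].
    have t3 : trunc N (pull w g x z) != 0.
      move: t0 t1; rewrite /tri => /andP[_ /orP[/andP[/eqP -> _]|/andP[h18 /eqP ->]]].
        by rewrite /trunc; case: ifP.
      rewrite /trunc flip_half; case: ifP => // _ _; rewrite /flip; case: ifP; lia.
    by rewrite -!(trunc_inj (esym (tE _ _))) .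
  have t2 : trunc N (pull w g y z) = 0 by move: t0 t1; rewrite /tri => /andP[/eqP ->].
  have t3 : trunc N (pull w g x z) = 0.
    move: t0 t1; rewrite /tri => /andP[_ /orP[/andP[_ /eqP ->] _|/andP[h18 /eqP ->]]].
      by rewrite /trunc; case: ifP.
    rewrite /trunc flip_half; case: ifP => // _ e; lia.
  have [iin|iout] := boolP (i \in [:: x; y; z]).
    apply: fxT => // a b; rewrite !inE => /or3P[] /eqP -> /or3P[] /eqP -> //; lia.
  have [gi|/forallPn[m]] := boolP [forall m, g m != i].
    have oT a b : a \in [:: x; y; z] -> b \in [:: x; y; z] -> L fx g a b = pull s g a b.
      move=> ain bin; rewrite /L /old gi ifT //=.
      by apply/andP; split; apply: contra iout => /eqP <-.
    move: r1 r2 r3; rewrite !oT ?inE ?eqxx ?orbT // => r1 r2 r3.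
    have sE a : a != i -> srt (s a) = sr a by move=> /inF/h2.
    have off a : a \in [:: x; y; z] -> a != i by move=> ain; apply: contra iout => /eqP <-.
    have [xi yi zi] : [/\ x != i, y != i & z != i] by split; apply: off; rewrite !inE eqxx ?orbT.
    apply: (good_tri (@mgood k)) => //=; rewrite ?sE //.
    by move=> m; split=> //=; rewrite sE ?(forallP gi) //; case: (fg m).
  move=> /negPn/eqP gm.
  have [i6|fz] := fx6; first by have [_ e] := fg m; move: i6; rewrite -gm e; lia.
  have L0 a b : trunc N (pull w g a b) = 0 -> L fx g a b = 0.
    rewrite /L ifN => [->|]; first by rewrite eqxx fz.
    by apply/negP => /and3P[/forallP/(_ m)]; rewrite gm eqxx.
  by rewrite !L0.
have wi j : (w j == w i) = (j == i).
  by have [->|ji] := eqVneq j i; [rewrite eqxx|apply/eqP => e; apply: new; exists j].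
have sw a b : a != i -> b != i -> w a = w b -> s a = s b.
  by move=> ai bi e; apply/eqP; rewrite h1 ?inF // e.
have cL : congruent w (L fx).
  move=> g g' x x' y y' eg ex ey; rewrite /L (pull_congruent eg ex ey) /sr /= ex ey.
  have oE : old g x y = old g' x' y'.
    rewrite /old -!wi ex ey; congr (_ && _).
    by apply: eq_forallb => m; rewrite -!wi eg.
  rewrite -oE; case: ifP => // o; have /and3P[/forallP gi xi yi] := o.
  have /and3P[/forallP gi' xi' yi'] : old g' x' y' by rewrite -oE.
  by rewrite /pull (sw x x') // (sw y y') //; congr (lab _ _ _); apply/funext => m; apply: sw.
have gL' : good (fun j => j \in full) sr (L fx).
  by apply: (good_image (D := fun=> True) (v := id)) gL => // y _; exists y.
have mL : matches id (full :\ i) s sr w (L fx).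
  split=> // g a b gF aF bF; rewrite /L ifT //.
  have off a' : a' \in full :\ i -> a' != i by rewrite !inE andbT.
  by rewrite /old !off // andbT andbT; apply/forallP => m; apply: off.
have iF : i \in full by rewrite inE.
have wi' j : j \in full -> j != i -> w j != w i by rewrite wi.
have sb : sr i < k + 6 by apply: msrt_bound.
exact: (matches_new iF sb wi' cL (LN _ fx0) gL' mL).
Qed.
End Types.

(** * The algebra of tame relations *)

Section Blur.
Variable k : nat.
Notation n := k.+3.
Notation labels I := (('I_k -> I) -> I -> I -> nat).
Notation srt := (@msrt k).
Notation lab := (@mlab k).
Notation full := ([set: 'I_n]%SET).
Notation tuples := ('I_n -> nat).
Notation qea := (@qea_sig n).

Lemma alike_sym tr D (s t : tuples) : alike tr D s t -> alike tr D t s.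
Proof.
case=> h1 h2 h3; split=> [j j' jD jD'|j jD|g j j' gD jD jD'].
- by rewrite h1.
- by rewrite /= h2.
- by rewrite /pull h3.
Qed.

Lemma alike_trans tr D (s t u : tuples) : alike tr D s t -> alike tr D t u -> alike tr D s u.
Proof.
case=> h1 h2 h3 [e1 e2 e3]; split=> [j j' jD jD'|j jD|g j j' gD jD jD'].
- by rewrite h1 // e1.
- by rewrite h2 //= e2.
- by rewrite h3 //= -e3.
Qed.

Lemma alike_agree tr (D : {set 'I_n}) (s t : tuples) : (forall j, j \in D -> s j = t j) -> alike tr D s t.
Proof.
move=> h; split=> [j j' jD jD'|j jD|g j j' gD jD jD']; rewrite ?h // /pull.
by congr (tr (lab _ _ _)); apply/funext => m /=; rewrite h.
Qed.

Lemma alike_refl tr D (s : tuples) : alike tr D s s.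
Proof. exact: alike_agree. Qed.

Lemma alike_sub tr (D E : {set 'I_n}) (s t : tuples) : D \subset E -> alike tr E s t -> alike tr D s t.
Proof.
move=> /fintype.subsetP DE [h1 h2 h3]; split=> [j j' /DE jD /DE jD'|j /DE jD|g j j' gD /DE jD /DE jD'].
- exact: h1.
- exact: h2.
- by apply: h3 => // m; apply: DE.
Qed.

Lemma alike_comp tr (D E : {set 'I_n}) (f : 'I_n -> 'I_n) (s t : tuples) :
  (forall j, j \in D -> f j \in E) -> alike tr E s t -> alike tr D (s \o f) (t \o f).
Proof.
move=> fD [h1 h2 h3]; split=> [j j' /fD jD /fD jD'|j /fD jD|g j j' gD /fD jD /fD jD'] /=.
- exact: h1.
- exact: h2.
- by apply: (h3 (f \o g)) => // m; apply: fD.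
Qed.

Lemma trunc_le N N' x : N <= N' -> trunc N (trunc N' x) = trunc N x.
Proof. by move=> le; rewrite /trunc; do 3!case: ifP => //; lia. Qed.

Lemma alike_le N N' D (s t : tuples) : N <= N' -> alike (trunc N') D s t -> alike (trunc N) D s t.
Proof.
move=> le [h1 h2 h3]; split=> // g j j' gD jD jD'.
by rewrite -(trunc_le _ le) h3 // trunc_le.
Qed.

Lemma alike_id N D (s t : tuples) : alike id D s t -> alike (trunc N) D s t.
Proof. by case=> h1 h2 h3; split=> // g j j' gD jD jD'; rewrite h3. Qed.

Lemma label_bound (s : tuples) : exists N, 9 <= N /\ forall g i j, (pull s g i j)./2 < N.
Proof.
pose M := \max_(x : {ffun 'I_k -> 'I_n} * 'I_n * 'I_n) pull s x.1.1 x.1.2 x.2.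
exists (9 + M); split=> [|g i j]; first exact: leq_addr.
have -> : g = finfun g by apply/funext => m; rewrite ffunE.
have : pull s (finfun g) i j <= M.
  exact: (leq_bigmax (F := fun x : {ffun 'I_k -> 'I_n} * 'I_n * 'I_n => pull s x.1.1 x.1.2 x.2) (finfun g, i, j)).
by move: (pull _ _ _ _) => x; lia.
Qed.

Definition real_on (D : {set 'I_n}) (s : tuples) :=
  forall g i j, (forall m, g m \in D) -> i \in D -> j \in D -> pull s g i j != 0.

(** No label of [s] is 0 or reaches the truncation level, so no label of [t] has been blurred
    either. This makes real types tame, hence atoms. *)
Lemma alike_exact N D (s t : tuples) : (forall g i j, (pull s g i j)./2 < N) -> real_on D s ->
  alike (trunc N) D s t -> alike id D s t.
Proof.
move=> sN sr [h1 h2 h3]; split=> // g j j' gD jD jD'.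
apply: (trunc_inj (h3 g j j' gD jD jD')).
by rewrite /trunc ifT ?sN //; apply: sr.
Qed.

Lemma real_real_on D (s : tuples) : real s -> real_on D s.
Proof. by move=> rs g i j _ _ _; apply: rs. Qed.

Lemma real_alike (s t : tuples) : real s -> alike id full s t -> real t.
Proof.
move=> rs [_ _ h3] g i j; rewrite -[pull t g i j]h3 ?inE //; exact: rs.
Qed.

Lemma real_comp (s : tuples) (f : 'I_n -> 'I_n) : real s -> real (s \o f).
Proof. by move=> rs g i j; apply: (rs (f \o g)). Qed.

Definition invariant N (X : set tuples) := forall s t, alike (trunc N) full s t -> X s -> X t.
Definition tame X := exists2 N, 9 <= N & invariant N X.

Lemma invariant_le N N' X : N <= N' -> invariant N X -> invariant N' X.
Proof. by move=> le h s t /(alike_le le); apply: h. Qed.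

Lemma tame2 (F : set tuples -> set tuples -> set tuples) X Y :
  (forall N, invariant N X -> invariant N Y -> invariant N (F X Y)) ->
  tame X -> tame Y -> tame (F X Y).
Proof.
move=> h [N N9 iX] [N' N9' iY]; exists (maxn N N'); first by rewrite leq_max N9.
by apply: h; [apply: invariant_le iX; apply: leq_maxl|apply: invariant_le iY; apply: leq_maxr].
Qed.

Lemma tameU X Y : tame X -> tame Y -> tame (X `|` Y).
Proof. by apply: tame2 => N hX hY s t e [/(hX _ _ e)|/(hY _ _ e)]; [left|right]. Qed.

Lemma tameI X Y : tame X -> tame Y -> tame (X `&` Y).
Proof. by apply: tame2 => N hX hY s t e [/(hX _ _ e) ? /(hY _ _ e)]. Qed.

Lemma tameC X : tame X -> tame (setT `\` X).
Proof. by move=> [N N9 h]; exists N => // s t e [_ ns]; split=> // /(h _ _ (alike_sym e)). Qed.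

Lemma tame0 : tame set0.
Proof. by exists 9. Qed.

Lemma tameT : tame setT.
Proof. by exists 9. Qed.

Lemma tame_op f (X : 'I_(arity f) -> set tuples) : (forall j, tame (X j)) ->
  tame (@op n qea (full_set_alg qea nat) f isT X).
Proof.
case: f X => [i|i j|i j|i j] X tX.
- have [N N9 h] := tX ord0; exists N => // s s' e [_ [t Xt st]]; split=> //.
  have e' : alike (trunc N) (full :\ i) s' t.
    apply: alike_trans (alike_sub (finset.subsetT _) (alike_sym e)) _.
    by apply: alike_agree => j; rewrite !inE andbT => /st.
  have [x hx] := extN N9 e'.
  exists (upd s' i x); first exact: (h _ _ (alike_sym hx) Xt).
  by move=> j ji; rewrite /upd (negbTE ji).
- have [N N9 h] := tX ord0; exists N => // s s' e [_ Xs]; split=> //.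
  by apply: h Xs; apply: (alike_comp _ e) => a; rewrite !inE.
- have [N N9 h] := tX ord0; exists N => // s s' e [_ Xs]; split=> //.
  by apply: h Xs; apply: (alike_comp _ e) => a; rewrite !inE.
- exists 9 => // s s' [e _ _] [_ sij]; split=> //; apply/eqP; rewrite -e ?inE //.
  exact/eqP.
Qed.

Definition blur : alg qea :=
  @Alg n qea {X : set tuples | tame X}
    (fun X Y => exist _ _ (tameU (svalP X) (svalP Y)))
    (fun X Y => exist _ _ (tameI (svalP X) (svalP Y)))
    (fun X => exist _ _ (tameC (svalP X)))
    (exist _ _ tame0) (exist _ _ tameT)
    (fun f _ a => exist _ _ (tame_op (fun j => svalP (a j)))).

Lemma blur_eq (x y : blur) : sval x = sval y -> x = y.
Proof. by case: x y => [X tX] [Y tY] /= e; apply: eq_exist. Qed.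

Lemma le_blur (x y : blur) : le x y <-> sval x `<=` sval y.
Proof.
split=> [<- s []//|xy]; apply: blur_eq => /=; apply/seteqP.
by split=> s; [case|move=> xs; split=> //; apply: xy].
Qed.

Lemma blur_hom (P : signature n) : hom (A := reduct (fun f (_ : P f) => isT : qea f) blur)
  (B := full_set_alg P nat) (fun x => sval x).
Proof. by split=> //= -[i|i j|i j|i j]. Qed.

Lemma blur_representable (P : signature n) :
  representable (reduct (fun f (_ : P f) => isT : qea f) blur).
Proof.
exists unit, (fun=> nat), (fun=> reduct (fun f (_ : P f) => isT : qea f) blur); split.
  by move=> _; exists (fun x => sval x); split; [exact: blur_hom|exact: blur_eq].
exists (fun _ x => x); split=> //; last by move=> x y; apply.
by move=> _ b; exists b.
Qed.

Lemma blur_RQEA : RQEA blur.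
Proof.
exists unit, (fun=> nat), (fun=> blur); split.
  move=> _; exists (fun x => sval x); split; last exact: blur_eq.
  by split=> //= -[i|i j|i j|i j].
exists (fun _ x => x); split=> //; last by move=> x y; apply.
by move=> _ b; exists b.
Qed.

Definition code_type N : finType :=
  ({ffun 'I_n * 'I_n -> bool} * {ffun 'I_n -> 'I_(k + 6).+1} *
   {ffun {ffun 'I_k -> 'I_n} * 'I_n * 'I_n -> 'I_(N.*2).+1})%type.

Definition code N (s : tuples) : code_type N :=
  ([ffun p => s p.1 == s p.2], [ffun j => inord (srt (s j))],
   [ffun x : {ffun 'I_k -> 'I_n} * 'I_n * 'I_n => inord (trunc N (pull s x.1.1 x.1.2 x.2))]).

Lemma code_alike N (s t : tuples) : code N s = code N t -> alike (trunc N) full s t.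
Proof.
have tN x : trunc N x < (N.*2).+1 by rewrite /trunc; case: ifP; lia.
case=> /ffunP h1 /ffunP h2 /ffunP h3; split.
- by move=> j j' _ _; have := h1 (j, j'); rewrite !ffunE.
- move=> j _; have := h2 j; rewrite !ffunE => /(congr1 val) /=.
  by rewrite !inordK // ltnS ltnW // msrt_bound.
- move=> g j j' _ _ _; have := h3 (finfun g, j, j'); rewrite !ffunE => /(congr1 val) /=.
  by rewrite !inordK //; have -> : finfun g = g :> (_ -> _) by apply/funext => m; rewrite ffunE.
Qed.

(** A tame set is determined by a level of invariance and the finitely many codes of its members at
    that level. *)
Lemma blur_countable : countable [set: blur].
Proof.
pose lv (x : blur) := sval (cid2 (svalP x)).
pose cd (x : blur) : {N : nat & {set code_type N}} :=
  Tagged (fun N => {set code_type N}) [set c | `[< exists2 s, sval x s & code (lv x) s = c >]]%SET.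
apply/countable_injP; exists (fun x => pickle (cd x)).
move=> x y _ _ /(pcan_inj pickleK) exy.
suff H x' y' : cd x' = cd y' -> sval x' `<=` sval y'.
  by apply: blur_eq; apply/seteqP; split; apply: H.
move=> e s xs; have iy : invariant (lv y') (sval y') by rewrite /lv; case: cid2.
have : code (tag (cd x')) s \in tagged (cd x') by rewrite inE; apply/asboolP; exists s.
by rewrite e inE => /asboolP[t yt /code_alike h]; apply: iy h yt.
Qed.

Lemma blur_chain (x : blur) s t : sval x s ->
  sval (foldr (fun i y => qC i y) x (enum 'I_n)) t.
Proof.
move=> xs.
suff H (l : seq 'I_n) u : (forall j, j \notin l -> u j = s j) ->
    sval (foldr (fun i y => qC i y) x l) u.
  by apply: H => j; rewrite mem_enum.
elim: l u => [|i l IH] u hu /=; first by have -> : u = s by apply/funext => j; apply: hu.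
split=> //; exists (upd u i (s i)); last by move=> j ji; rewrite /upd (negbTE ji).
apply: IH => j jl; rewrite /upd; case: eqP => [->//|ji].
by apply: hu; rewrite inE negb_or jl andbT; apply/eqP.
Qed.

(** Cylindrifying a nonempty set in all n directions yields the unit, so a congruence that
    identifies a nonzero element with zero identifies everything. *)
Lemma blur_simple : simple blur.
Proof.
split.
  exists zero, one => /(congr1 (fun x : blur => sval x (fun=> 0))) /= e.
  by suff : True by rewrite -e.
move=> r cr; have [[x [y [rxy nxy]]]|h] := pselect (exists x y, r x y /\ x <> y); last first.
  by left=> x y rxy; apply: contrapT => n; apply: h; exists x, y.
right.
have [rr rs rt ra rm rn ro] := cr.
have [d [[s ds] rd]] : exists d : blur, (exists s, sval d s) /\ r d zero.
  have diff a b : r a b -> (exists s, sval a s /\ ~ sval b s) ->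
      exists d : blur, (exists s, sval d s) /\ r d zero.
    move=> rab [s [a_s nbs]]; exists (mul a (neg b)); split; first by exists s; split.
    have -> : zero = mul b (neg b) :> blur.
      by apply: blur_eq; apply/seteqP; split=> u //= -[? []].
    exact: rm.
  have [h|h] := pselect (exists s, sval x s /\ ~ sval y s); first exact: diff rxy h.
  apply: (diff y x); first exact: rs.
  apply: contrapT => h'; apply: nxy; apply: blur_eq; apply/seteqP; split=> s xs.
    by apply: contrapT => ys; apply: h; exists s.
  by apply: contrapT => ys; apply: h'; exists s.
have r1 : r one zero.
  have -> : one = foldr (fun i y => qC i y) d (enum 'I_n) :> blur.
    by apply: blur_eq; apply/seteqP; split=> // t _; apply: blur_chain ds.
  have q0 i : qC i zero = zero :> blur.
    by apply: blur_eq; apply/seteqP; split=> // u [_ []].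
  elim: (enum 'I_n) => [|i l IH]; first by [].
  rewrite -[foldr _ _ (i :: l)]/(qC i (foldr (fun i y => qC i y) d l)) -(q0 i).
  by apply: ro => _.
have r0 z : r z zero.
  have e1 : mul z one = z by apply: blur_eq; rewrite /= setIT.
  have e0 : mul z zero = zero by apply: blur_eq; rewrite /= setI0.
  by rewrite -[X in r X _]e1 -e0; apply: rm.
by move=> z w; apply: rt (r0 z) (rs _ _ (r0 w)).
Qed.
End Blur.

(** * Atoms and the complex algebra *)

Section Atoms.
Variable k : nat.
Notation n := k.+3.
Notation full := ([set: 'I_n]%SET).
Notation tuples := ('I_n -> nat).
Notation qea := (@qea_sig n).
Notation A := (blur k).

Definition cls (s : tuples) : set tuples := [set t | alike id full s t].

Lemma cls_tame s : real s -> tame (cls s).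
Proof.
move=> rs; have [N [N9 sN]] := label_bound s; exists N => // t t' e st.
apply: (alike_exact sN (real_real_on rs)).
exact: alike_trans (alike_id _ st) e.
Qed.

Lemma cls_atom s (rs : real s) : is_atom (exist _ (cls s) (cls_tame rs) : A).
Proof.
split.
  move=> /(congr1 (fun x : A => sval x s)) /= e.
  suff : False by []; rewrite -[False]e; exact: alike_refl.
move=> x /le_blur /= xs; have [[t xt]|none] := pselect (exists t, sval x t).
  right; apply: blur_eq; apply/seteqP; split=> [|u su] //=.
  have [N _ h] := svalP x; apply: (h _ _ _ xt); apply: alike_id.
  exact: alike_trans (alike_sym (xs _ xt)) su.
by left; apply: blur_eq; apply/seteqP; split=> // t xt; apply: none; exists t.
Qed.

Lemma cls_below (x : A) : x <> zero -> exists s (rs : real s), le (exist _ (cls s) (cls_tame rs) : A) x.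
Proof.
move=> x0; have [s xs] : exists s, sval x s.
  apply: contrapT => none; apply: x0; apply: blur_eq; apply/seteqP.
  by split=> // s xs; apply: none; exists s.
have [N N9 h] := svalP x; have [s' [rs' e]] := real_ex s N9.
exists s', rs'; apply/le_blur => t /= st.
by apply: h xs; apply: alike_trans (alike_sym e) (alike_id _ st).
Qed.

Lemma blur_atomic : atomic A.
Proof.
move=> x /cls_below[s [rs le_sx]]; exists (exist _ (cls s) (cls_tame rs) : A) => //.
exact: cls_atom.
Qed.

Definition Ats := {a : A | is_atom a}.
Definition holds (b : Ats) (s : tuples) : Prop := sval (sval b) s.

Lemma atom_cls (b : Ats) s : holds b s -> real s /\ sval (sval b) = cls s.
Proof.
case: b => b [b0 hb]; rewrite /holds /= => bs.
have [u [ru /[dup] le_ub /hb[e0|e]]] := cls_below b0.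
  case: (cls_atom ru) => + _; by rewrite e0.
have us : cls u s by move: bs; rewrite -e.
split; first exact: real_alike ru us.
rewrite -e /=; apply/seteqP; split=> t ht; last exact: alike_trans us ht.
exact: alike_trans (alike_sym us) ht.
Qed.

Lemma holds_real b s : holds b s -> real s.
Proof. by move=> /atom_cls[]. Qed.

Lemma holds_alike b s t : holds b s -> holds b t <-> alike id full s t.
Proof. by move=> /atom_cls[_ e]; rewrite /holds e. Qed.

Lemma holds_inj b b' s : holds b s -> holds b' s -> b = b'.
Proof.
move=> /atom_cls[_ e] /atom_cls[_ e'].
by case: b b' e e' => [b hb] [b' hb'] /= e e'; apply: eq_exist; apply: blur_eq; rewrite e.
Qed.

Lemma ex_holds (b : Ats) : exists s, holds b s.
Proof.
have [b0 _] := svalP b; have [s [rs /le_blur h]] := cls_below b0.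
by exists s; apply: h; apply: alike_refl.
Qed.

Lemma ex_atom s : real s -> exists b, holds b s.
Proof. by move=> rs; exists (exist _ _ (cls_atom rs)); apply: alike_refl. Qed.

Lemma ext_exact i s t : real s -> real t -> alike id (full :\ i) s t ->
  exists x, alike id full (upd s i x) t.
Proof.
move=> rs rt e; have [N [N9 tN]] := label_bound t.
have [x hx] := extN N9 (alike_id N e); exists x; apply: alike_sym.
exact: alike_exact tN (real_real_on rt) (alike_sym hx).
Qed.

Notation CmA := (Cm (At A)).

(** Reads a set of atoms as its union, a set of real tuples that need not be tame. By [rep_ext] the
    complex algebra can be computed on real tuples. *)
Definition rep (X : set Ats) (s : tuples) := exists b, X b /\ holds b s.

Lemma repP (X : set Ats) b s : holds b s -> rep X s <-> X b.
Proof. by move=> bs; split=> [[b' [Xb' /holds_inj/(_ bs) <-]]|Xb] //; exists b. Qed.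

Lemma rep_ext (X Y : set Ats) : (forall s, real s -> rep X s <-> rep Y s) -> X = Y.
Proof.
move=> h; apply/seteqP; split=> b; have [s bs] := ex_holds b; have := h s (holds_real bs);
  rewrite !(propext (repP _ bs)); tauto.
Qed.

Lemma rep_alike X s t : alike id full s t -> rep X s -> rep X t.
Proof. by move=> e [b [Xb bs]]; exists b; split=> //; apply/(holds_alike _ bs). Qed.

Lemma rep_add (X Y : CmA) s : rep (add X Y) s <-> rep X s \/ rep Y s.
Proof.
split=> [[b [[Xb|Yb] bs]]|[[b [Xb bs]]|[b [Yb bs]]]].
- by left; exists b.
- by right; exists b.
- by exists b; split=> //; left.
- by exists b; split=> //; right.
Qed.

Lemma rep_mul (X Y : CmA) s : rep (mul X Y) s <-> rep X s /\ rep Y s.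
Proof.
split=> [[b [[Xb Yb] bs]]|[[b [Xb bs]] [b' [Yb bs']]]]; first by split; exists b.
by exists b; split=> //; split=> //; rewrite (holds_inj bs bs').
Qed.

Lemma rep_neg (X : CmA) s : real s -> rep (neg X) s <-> ~ rep X s.
Proof. by move=> /ex_atom[b bs]; rewrite !(propext (repP _ bs)). Qed.

Lemma rep_zero s : rep (zero : CmA) s <-> False.
Proof. by split=> // -[b []]. Qed.

Lemma rep_one s : real s -> rep (one : CmA) s.
Proof. by move=> /ex_atom[b bs]; exists b. Qed.

(** The witness only has to share the type of [s] off [i]: [ext_exact] turns such a [t] into a tuple
    differing from [s] at [i] alone. *)
Lemma rep_cyl i (X : 'I_1 -> CmA) s : real s ->
  rep (@op n qea CmA (Cyl i) isT X) s <->
  exists t, [/\ real t, rep (X ord0) t & alike id (full :\ i) s t].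
Proof.
move=> rs; split=> [[b [[a [Xa /le_blur ba]] bs]]|[t [rt [a [Xa at_]] st]]].
  have [_ [t att st]] := ba _ bs; exists t; split; first exact: holds_real att.
    by exists (a ord0).
  by apply: alike_agree => j; rewrite !inE andbT => /st.
have [b bs] := ex_atom rs; exists b; split=> //; exists (fun=> a); split.
  by move=> j; rewrite (ord1 j).
apply/le_blur => u bu; split=> //.
have su := proj1 (holds_alike _ bs) bu.
have ru := holds_real bu.
have [x hx] := ext_exact ru rt (alike_trans (alike_sub (finset.subsetT _) (alike_sym su)) st).
exists (upd u i x); last by move=> j ji; rewrite /upd (negbTE ji).
by apply/(holds_alike _ at_); apply: alike_sym.
Qed.

Lemma rep_sub i j (X : 'I_1 -> CmA) s : real s ->
  rep (@op n qea CmA (Sub i j) isT X) s <-> rep (X ord0) (s \o repl i j).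
Proof.
move=> rs; split=> [[b [[a [Xa /le_blur ba]] bs]]|[a [Xa at_]]].
  by have [_ h] := ba _ bs; exists (a ord0).
have [b bs] := ex_atom rs; exists b; split=> //; exists (fun=> a); split.
  by move=> m; rewrite (ord1 m).
apply/le_blur => u bu; split=> //.
apply/(holds_alike _ at_); apply: (alike_comp _ (proj1 (holds_alike _ bs) bu)) => m _.
by rewrite finset.in_setT.
Qed.

Lemma rep_tr i j (X : 'I_1 -> CmA) s : real s ->
  rep (@op n qea CmA (Tr i j) isT X) s <-> rep (X ord0) (s \o tperm i j).
Proof.
move=> rs; split=> [[b [[a [Xa /le_blur ba]] bs]]|[a [Xa at_]]].
  by have [_ h] := ba _ bs; exists (a ord0).
have [b bs] := ex_atom rs; exists b; split=> //; exists (fun=> a); split.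
  by move=> m; rewrite (ord1 m).
apply/le_blur => u bu; split=> //.
apply/(holds_alike _ at_); apply: (alike_comp _ (proj1 (holds_alike _ bs) bu)) => m _.
by rewrite finset.in_setT.
Qed.

Lemma rep_diag i j (X : 'I_0 -> CmA) s : real s ->
  rep (@op n qea CmA (Diag i j) isT X) s <-> s i = s j.
Proof.
move=> rs; split=> [[b [[a [Xa /le_blur ba]] bs]]|e].
  by have [] := ba _ bs.
have [b bs] := ex_atom rs; exists b; split=> //.
exists (fun m : 'I_0 => b); split=> [[]//|].
apply/le_blur => u bu; split=> //; have [h _ _] := proj1 (holds_alike _ bs) bu.
by apply/eqP; rewrite -h ?inE //; apply/eqP.
Qed.

Lemma rep_qC i (X : CmA) s : real s ->
  rep (qC i X) s <-> exists t, [/\ real t, rep X t & alike id (full :\ i) s t].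
Proof. exact: rep_cyl. Qed.

Lemma rep_qS i j (X : CmA) s : real s -> rep (qS i j X) s <-> rep X (s \o repl i j).
Proof. exact: rep_sub. Qed.

Lemma rep_qT i j (X : CmA) s : real s -> rep (qT i j X) s <-> rep X (s \o tperm i j).
Proof. exact: rep_tr. Qed.

Lemma rep_qD i j s : real s -> rep (qD CmA i j) s <-> s i = s j.
Proof. exact: rep_diag. Qed.

Lemma Cm_boolean : boolean CmA.
Proof.
split=> *; [exact: setUC|exact: setIC|exact: setUA|exact: setIA|exact: setIUr|exact: setUIr
  |exact: setU0|exact: setIT|exact: setUv|exact: setICr].
Qed.

Lemma pullback_endo (F : CmA -> CmA) (f : 'I_n -> 'I_n) :
  (forall X s, real s -> rep (F X) s <-> rep X (s \o f)) -> boolean_endo F.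
Proof.
move=> h; split=> [X Y|X Y|X||]; apply: rep_ext => s rs; rewrite (propext (h _ _ rs)).
- by rewrite !(propext (rep_add _ _ _)) !(propext (h _ _ rs)).
- by rewrite !(propext (rep_mul _ _ _)) !(propext (h _ _ rs)).
- by rewrite !(propext (rep_neg _ _)) ?(propext (h _ _ rs)) //; apply: real_comp.
- by rewrite !(propext (rep_zero _)).
- by split=> _; apply: rep_one => //; apply: real_comp.
Qed.

Lemma alike_off (i : 'I_n) (s t : tuples) : (forall j, j != i -> s j = t j) ->
  alike id (full :\ i) s t.
Proof. by move=> h; apply: alike_agree => j; rewrite !inE andbT => /h. Qed.

(* An n-tuple glued from two real ones need not be real, but it is truncation-equivalent to
   a real one, and truncation beyond all the labels of [s] and [t] loses nothing. *)
Lemma real_amalgam (i j : 'I_n) c (s t : tuples) : c \notin [:: i; j] -> real s -> real t ->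
  alike id (full :\ c) (s \o repl i j) t ->
  exists u, [/\ real u, alike id (full :\ c) s u & alike id full t (u \o repl i j)].
Proof.
rewrite !inE negb_or => /andP[ci cj] rs rt e.
have rs' : real (s \o repl i j) by apply: real_comp.
have [x hx] := ext_exact rs' rt e; pose u := upd s c x.
have [N [N9 sN]] := label_bound s; have [N' [N9' tN]] := label_bound t.
have M9 : 9 <= maxn N N' by rewrite leq_max N9.
have [u' [ru' eu]] := real_ex u M9; exists u'; split=> //.
  apply: (alike_exact sN (real_real_on rs)); apply: (alike_le (leq_maxl N N')).
  apply: alike_trans (alike_sym (alike_sub (finset.subsetT _) eu)).
  by apply: alike_id; apply: alike_off => a ac; rewrite /u /upd (negbTE ac).
apply: (alike_exact tN (real_real_on rt)); apply: (alike_le (leq_maxr N N')).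
apply: alike_trans (alike_sym (alike_comp _ eu)); last by move=> a _; rewrite finset.in_setT.
apply: alike_id; apply: alike_trans (alike_sym hx) _; apply: alike_agree => a _ /=.
rewrite /u /upd /repl; case: (altP (a =P c)) => [->|ac].
  by rewrite (negbTE ci) eqxx.
by rewrite /=; case: (altP (a =P i)) => _; rewrite ?(negbTE ac) // eq_sym (negbTE cj).
Qed.

(** Needed because the terms for the s_i^j of a variety are known to define them in QEA, and it is
    the complex algebra that gets embedded. The commutation of [qS i j] with [qC c] is the axiom
    that calls for [real_amalgam]. *)
Lemma Cm_QEA : QEA CmA.
Proof.
split.
- exact: Cm_boolean.
- move=> i X; apply: rep_ext => s rs; rewrite (propext (rep_qS _ _ _ rs)).
  suff -> : s \o repl i i = s by [].
  by apply/funext => a /=; rewrite /repl; case: eqP => [->|].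
- move=> i X; apply: rep_ext => s rs; rewrite (propext (rep_qT _ _ _ rs)).
  suff -> : s \o tperm i i = s by [].
  by apply/funext => a /=; rewrite tperm1 perm1.
- move=> i j X; apply: rep_ext => s rs; rewrite !(propext (rep_qT _ _ _ rs)).
  by rewrite tpermC.
- move=> i X; apply/seteqP; split=> b; first by case.
  move=> Xb; split=> //; have [s bs] := ex_holds b; have rs := holds_real bs.
  apply/(repP _ bs)/(rep_qC _ _ rs); exists s.
  by split; [exact: rs|exact/(repP _ bs)|exact: alike_refl].
- move=> i X Y; apply: rep_ext => s rs.
  rewrite (propext (rep_add _ _ _)) !(propext (rep_qC _ _ rs)).
  split=> [[t [rt /rep_add[Xt|Yt] st]]|[[t [rt Xt st]]|[t [rt Yt st]]]].
  + by left; exists t.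
  + by right; exists t.
  + by exists t; split=> //; apply/rep_add; left.
  + by exists t; split=> //; apply/rep_add; right.
- move=> i j X; apply: rep_ext => s rs; have rs' := @real_comp k s (repl i j) rs.
  rewrite (propext (rep_qS _ _ _ rs)) (propext (rep_qC _ _ rs)) (propext (rep_qC _ _ rs')).
  have e : alike id (full :\ i) (s \o repl i j) s.
    by apply: alike_off => a ai; rewrite /= /repl (negbTE ai).
  split=> -[t [rt Xt st]]; exists t; split=> //; last exact: alike_trans e st.
  exact: alike_trans (alike_sym e) st.
- move=> i j X ij; apply: rep_ext => s rs.
  rewrite (propext (rep_qS _ _ _ rs)) (propext (rep_qC _ _ rs)).
  split=> [[t [rt Xt st]]|Xs].
    rewrite (propext (rep_qS _ _ _ rt)) in Xt; apply: rep_alike Xt; apply: alike_sym.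
    by apply: (alike_comp _ st) => a _; rewrite !inE andbT /repl; case: (altP (a =P i)) => _ //; rewrite eq_sym.
  by exists s; split; [exact: rs|apply/rep_qS|exact: alike_refl].
- move=> i j c X cij; apply: rep_ext => s rs; have rs' := @real_comp k s (repl i j) rs.
  rewrite (propext (rep_qS _ _ _ rs)) (propext (rep_qC _ _ rs)) (propext (rep_qC _ _ rs')).
  split=> [[t [rt Xt st]]|[t [rt Xt st]]].
    have [u [ru su tu]] := real_amalgam cij rs rt st.
    by exists u; split=> //; apply/rep_qS => //; apply: rep_alike Xt.
  rewrite (propext (rep_qS _ _ _ rt)) in Xt; exists (t \o repl i j); split=> //; first exact: real_comp.
  apply: (alike_comp _ st) => a; rewrite !inE !andbT /repl => ac.
  move: cij; rewrite !inE negb_or => /andP[_ cj].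
  by case: (altP (a =P i)) => _ //; rewrite eq_sym.
- by move=> i j; apply: (pullback_endo (f := repl i j)) => X s; apply: rep_qS.
- by move=> i j; apply: (pullback_endo (f := tperm i j)) => X s; apply: rep_qT.
- move=> i j X; apply: rep_ext => s rs; have rs' := @real_comp k s (tperm i j) rs.
  rewrite (propext (rep_qT _ _ _ rs)) (propext (rep_qT _ _ _ rs')).
  suff -> : (s \o tperm i j) \o tperm i j = s by [].
  by apply/funext => a /=; rewrite tpermK.
- move=> i j c X u; apply: rep_ext => s rs.
  rewrite !(propext (rep_qT _ _ _ _)) //; try exact: real_comp.
  suff -> : (s \o tperm i j) \o tperm i c = (s \o tperm j c) \o tperm i j by [].
  apply/funext => a /=; congr s.
  move: u; rewrite /= !inE negb_or andbT => /andP[/andP[ij ic] jc].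
  have [ji ci cj] : [/\ j != i, c != i & c != j] by split; rewrite eq_sym.
  case: (altP (a =P i)) => [->|ai]; first by rewrite !(tpermL, tpermD ic jc).
  case: (altP (a =P j)) => [->|aj]; first by rewrite (tpermD ij cj) !tpermR (tpermD ji ci).
  case: (altP (a =P c)) => [->|ac]; first by rewrite tpermR tpermL (tpermD ic jc) tpermR.
  by rewrite !tpermD // eq_sym.
- move=> i j X; apply: rep_ext => s rs; have rs' := @real_comp k s (tperm i j) rs.
  rewrite (propext (rep_qT _ _ _ rs)) !(propext (rep_qS _ _ _ _)) //.
  suff -> : (s \o tperm i j) \o repl i j = s \o repl j i by [].
  apply/funext => a /=; congr s; rewrite /repl; case: (altP (a =P i)) => [->|ai].
    by rewrite tpermR; case: ifP => //; case: eqP.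
  case: (altP (a =P j)) => [->|aj]; first by rewrite tpermR.
  by rewrite tpermD // eq_sym.
- move=> i j; apply: rep_ext => s rs; have rs' := @real_comp k s (repl i j) rs.
  rewrite (propext (rep_qS _ _ _ rs)) (propext (rep_qD _ _ rs')).
  split=> _; first exact: rep_one.
  by rewrite /= /repl eqxx; case: ifP => // /eqP ->.
- move=> i j X; apply: rep_ext => s rs.
  rewrite !(propext (rep_mul _ _ _)) (propext (rep_qS _ _ _ rs)) (propext (rep_qD _ _ rs)).
  split=> [[]//|[Xs e]]; split=> //.
  suff -> : s \o repl i j = s by [].
  by apply/funext => a /=; rewrite /repl; case: eqP => [->|].
Qed.
End Atoms.

(** * The clash of four apexes *)

Lemma odd_flip x : odd (flip x) = ~~ odd x.
Proof. by rewrite /flip; case: ifP => [|/= ->//]; case: x => //= x /negbTE ->. Qed.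

Section Core.
Variable k : nat.
Notation n := k.+3.
Notation full := ([set: 'I_n]%SET).
Notation tuples := ('I_n -> nat).
Notation srt := (@msrt k).
Notation lab := (@mlab k).
Notation A := (blur k).
Notation CmA := (Cm (At A)).

Definition p0 : 'I_n := inord k.
Definition p1 : 'I_n := inord k.+1.
Definition p2 : 'I_n := inord k.+2.
Definition iq (m : 'I_k) : 'I_n := inord m.

Lemma val_p0 : p0 = k :> nat. Proof. by rewrite inordK //; lia. Qed.
Lemma val_p1 : p1 = k.+1 :> nat. Proof. by rewrite inordK //; lia. Qed.
Lemma val_p2 : p2 = k.+2 :> nat. Proof. by rewrite inordK. Qed.
Lemma val_iq m : iq m = m :> nat. Proof. by rewrite inordK //; have := ltn_ord m; lia. Qed.

Lemma p_neq : [/\ p0 != p1, p0 != p2, p1 != p2 & forall m, [/\ iq m != p0, iq m != p1 & iq m != p2]].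
Proof.
split=> [|||m]; try split; rewrite -val_eqE /= ?val_p0 ?val_p1 ?val_p2 ?val_iq //;
  try (have := ltn_ord m); lia.
Qed.

Definition pairP (a b : 'I_n) (c d : nat) (phi : nat -> bool) (s : tuples) : Prop :=
  [/\ forall m, srt ((s \o iq) m) = 6 + m, srt (s a) = c, srt (s b) = d
   & phi (lab (s \o iq) (s a) (s b))].

Definition pset (P : tuples -> Prop) : CmA := [set b | exists2 s, holds b s & P s].

Definition inv_pred (P : tuples -> Prop) := forall s t, alike id full s t -> P s -> P t.

Lemma rep_pset P s : inv_pred P -> real s -> rep (pset P) s <-> P s.
Proof.
move=> iP rs; split=> [[b [[t bt Pt] bs]]|Ps].
  by apply: iP Pt; apply/(holds_alike _ bt).
by have [b bs] := ex_atom rs; exists b; split=> //; exists s.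
Qed.

Lemma pairP_alike a b c d phi (D : {set 'I_n}) s t :
  (forall m, iq m \in D) -> a \in D -> b \in D -> alike id D s t ->
  pairP a b c d phi s -> pairP a b c d phi t.
Proof.
move=> qD aD bD [h1 h2 h3] [e1 e2 e3 e4]; split=> [m|||].
- by rewrite -e1 /= h2.
- by rewrite -e2 h2.
- by rewrite -e3 h2.
- by rewrite -[lab _ _ _]h3.
Qed.

Lemma inv_pair a b c d phi : inv_pred (pairP a b c d phi).
Proof. by move=> s t; apply: pairP_alike => *; rewrite finset.in_setT. Qed.

Definition R a b c d phi : CmA := pset (pairP a b c d phi).

Lemma repR a b c d phi s : real s -> rep (R a b c d phi) s <-> pairP a b c d phi s.
Proof. by move=> rs; apply: rep_pset => //; apply: inv_pair. Qed.

Lemma R_free e a b c d phi : (forall m, iq m != e) -> a != e -> b != e ->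
  qC e (R a b c d phi) = R a b c d phi.
Proof.
move=> qe ae be; apply: rep_ext => s rs; rewrite (propext (rep_qC _ _ rs)) (propext (repR _ _ _ _ _ rs)).
split=> [[t [rt /(repR _ _ _ _ _ rt) Pt st]]|Ps]; last first.
  by exists s; split; [exact: rs|apply/repR|exact: alike_refl].
by apply: pairP_alike (alike_sym st) Pt => *; rewrite !inE andbT.
Qed.

Lemma sub_rep (X Y : CmA) : (forall s, real s -> rep X s -> rep Y s) -> X `<=` Y.
Proof.
move=> h b Xb; have [s bs] := ex_holds b; apply/(repP _ bs); apply: h; first exact: holds_real bs.
exact/(repP _ bs).
Qed.

Lemma R_s12 c d phi : qS p1 p2 (R p0 p1 c d phi) = R p0 p2 c d phi.
Proof.
have [n01 n02 n12 nq] := p_neq.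
apply: rep_ext => s rs; rewrite (propext (rep_qS _ _ _ rs)) !(propext (repR _ _ _ _ _ _)) //; last exact: real_comp.
suff e : [/\ (s \o repl p1 p2) \o iq = s \o iq, (s \o repl p1 p2) p0 = s p0 & (s \o repl p1 p2) p1 = s p2].
  by case: e => e1 e2 e3; rewrite /pairP e1 e2 e3.
split=> /=; last by rewrite /repl eqxx.
  by apply/funext => m /=; rewrite /repl; have [_ /negbTE -> _] := nq m.
by rewrite /repl (negbTE n01).
Qed.

Lemma R_s01 c d phi : qS p0 p1 (R p0 p2 c d phi) = R p1 p2 c d phi.
Proof.
have [n01 n02 n12 nq] := p_neq.
apply: rep_ext => s rs; rewrite (propext (rep_qS _ _ _ rs)) !(propext (repR _ _ _ _ _ _)) //; last exact: real_comp.
suff e : [/\ (s \o repl p0 p1) \o iq = s \o iq, (s \o repl p0 p1) p0 = s p1 & (s \o repl p0 p1) p2 = s p2].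
  by case: e => e1 e2 e3; rewrite /pairP e1 e2 e3.
split=> /=; last by rewrite /repl eq_sym (negbTE n02).
  by apply/funext => m /=; rewrite /repl; have [/negbTE -> _ _] := nq m.
by rewrite /repl eqxx.
Qed.

Definition apexP j (s : tuples) := pairP p0 p2 0 j (eq_op 1) s /\ pairP p1 p2 1 j (eq_op 1) s /\
  lab (s \o iq) (s p0) (s p1) = 1.
Definition baseP := pairP p0 p1 0 1 (eq_op 1).
Definition apex_set j := pset (apexP j).
Definition base_set := R p0 p1 0 1 (eq_op 1).

Lemma inv_apex j : inv_pred (apexP j).
Proof.
move=> s t e [/(inv_pair e) h1 [/(inv_pair e) h2 h3]]; split=> //; split=> //.
by case: e => _ _ e3; rewrite -[LHS](e3 iq p0 p1) //; move=> *; rewrite finset.in_setT.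
Qed.

Lemma rep_apex j s : real s -> rep (apex_set j) s <-> apexP j s.
Proof. by move=> rs; apply: rep_pset => //; apply: inv_apex. Qed.

(** The parity of a real red is all that the clash of four apexes requires, so finitely many
    elements [Red e i j] have to be decided. *)
Definition redp e x := (18 <= x) && (odd x == e).
Definition Red e i j := R p1 p2 i j (redp e).

(* [Sat x y z X]: the triple of nodes [x y z], placed at the last three coordinates over a fixed
   [k]-tuple, lies in [X]. Node [0] is the base point of sort 0, [1] that of sort 1, and nodes
   2 to 5 are four apexes of the corresponding sorts. *)
Section Contradiction.
Variable Sat : nat -> nat -> nat -> CmA -> Prop.
Notation apx j := (1 < j < 6).

Hypothesis sat_mono : forall x y z X Y, X `<=` Y -> Sat x y z X -> Sat x y z Y.
Hypothesis sat_mul : forall x y z (X Y : CmA), Sat x y z X -> Sat x y z Y -> Sat x y z (mul X Y).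
Hypothesis sat0 : forall x y z, ~ Sat x y z zero.
Hypothesis sat_apex : forall j, apx j -> Sat 0 1 j (apex_set j).
Hypothesis sat_dec : forall j l e, apx j -> apx l -> j < l ->
  Sat 0 j l (Red e j l) \/ Sat 0 j l (neg (Red e j l)).
Hypothesis sat_a01 : forall c d phi z z', apx z -> apx z' -> z != z' ->
  Sat 0 1 z (R p0 p2 c d phi) -> Sat 0 z z' (R p0 p1 c d phi).
Hypothesis sat_a02 : forall c d phi z z', apx z -> apx z' -> z != z' ->
  Sat 0 1 z (R p0 p2 c d phi) -> Sat 0 z' z (R p0 p2 c d phi).
Hypothesis sat_b02 : forall c d phi z z', apx z -> apx z' -> z != z' ->
  Sat 0 1 z (R p1 p2 c d phi) -> Sat 1 z' z (R p0 p2 c d phi).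
Hypothesis sat_b01 : forall c d phi z z', apx z -> apx z' -> z != z' ->
  Sat 0 1 z (R p1 p2 c d phi) -> Sat 1 z z' (R p0 p1 c d phi).
Hypothesis sat_12 : forall c d phi x z z', apx z -> apx z' -> z < z' -> x < 6 -> x != z -> x != z' ->
  Sat 0 z z' (R p1 p2 c d phi) -> Sat x z z' (R p1 p2 c d phi).
Hypothesis sat_z02 : forall c d phi z z' z'', apx z -> apx z' -> apx z'' -> z < z'' -> z'' < z' ->
  Sat 0 z z' (R p1 p2 c d phi) -> Sat z z'' z' (R p0 p2 c d phi).
Hypothesis sat_z01 : forall c d phi z z' z'', apx z -> apx z' -> apx z'' -> z < z' -> z' < z'' ->
  Sat 0 z z' (R p1 p2 c d phi) -> Sat z z' z'' (R p0 p1 c d phi).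

Lemma frame_iq (s : tuples) : (forall m, srt ((s \o iq) m) = 6 + m) -> frame (fun=> True) srt (s \o iq).
Proof. by move=> h m; split=> //; apply: h. Qed.

Lemma not_white c j l s : c < 2 -> apx j -> apx l -> j < l ->
  pairP p0 p1 c j (eq_op 1) s -> pairP p0 p2 c l (eq_op 1) s ->
  ~~ white c (lab (s \o iq) (s p1) (s p2)).
Proof.
move=> c2 hj hl jl [q1 q2 q3 /eqP q4] [_ _ r3 /eqP r4]; rewrite -{1}q2.
by apply: (good_white (@mgood k) (frame_iq q1)) => //; rewrite ?q2 ?q3 ?r3 //; lia.
Qed.

(** At the triple through base point 0 the label of the two apexes is not white 0, and it is not 0
    because tuples are real. Were it no real red, it would be white 1; carried over to the triple
    through base point 1, this is forbidden. *)
Lemma sat_red j l : apx j -> apx l -> j < l -> exists e, Sat 0 j l (Red e j l).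
Proof.
move=> hj hl jl; have jl' : j != l by lia.
have lj' : l != j by lia.
have s02 i : apx i -> Sat 0 1 i (R p0 p2 0 i (eq_op 1)).
  move=> hi; apply: sat_mono (sat_apex hi); apply: sub_rep => s rs.
  by rewrite (propext (rep_apex _ rs)) (propext (repR _ _ _ _ _ rs)) => -[].
have s12 i : apx i -> Sat 0 1 i (R p1 p2 1 i (eq_op 1)).
  move=> hi; apply: sat_mono (sat_apex hi); apply: sub_rep => s rs.
  by rewrite (propext (rep_apex _ rs)) (propext (repR _ _ _ _ _ rs)) => -[_ []].
have [e|n1] := sat_dec true hj hl jl; first by exists true.
have [e|n0] := sat_dec false hj hl jl; first by exists false.
have a1 := sat_a01 hj hl jl' (s02 _ hj); have a2 := sat_a02 hl hj lj' (s02 _ hl).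
have b1 := sat_b01 hj hl jl' (s12 _ hj); have b2 := sat_b02 hl hj lj' (s12 _ hl).
have w : Sat 0 j l (R p1 p2 j l (white 1)).
  apply: sat_mono (sat_mul (sat_mul a1 a2) (sat_mul n1 n0)); apply: sub_rep => s rs.
  rewrite !(propext (rep_mul _ _ _)) !(propext (rep_neg _ rs)) !(propext (repR _ _ _ _ _ rs)).
  case=> -[P1 P2] [m1 m2].
  have nw := not_white (isT : 0 < 2) hj hl jl P1 P2.
  case: P1 P2 => q1 q2 q3 _ [_ _ r3 _]; split=> //.
  have l0 : lab (s \o iq) (s p1) (s p2) != 0 by apply: rs.
  move: nw l0; rewrite /white /=; set x := lab _ _ _ => x1 x0.
  rewrite ltn_neqAle eq_sym x1 lt0n x0 /= ltnNge; apply/negP => x18.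
  by case: (boolP (odd x)) => ox; [apply: m1|apply: m2]; split=> //;
    rewrite /redp -/x x18 ?ox // (negbTE ox).
exfalso; apply: (@sat0 1 j l).
have w' : Sat 1 j l (R p1 p2 j l (white 1)) by apply: (@sat_12 _ _ _ 1) w => //; lia.
apply: sat_mono (sat_mul (sat_mul b1 b2) w'); apply: sub_rep => s rs.
rewrite !(propext (rep_mul _ _ _)) !(propext (repR _ _ _ _ _ rs)) => -[[P1 P2] [_ _ _ wh]].
by have := not_white (isT : 1 < 2) hj hl jl P1 P2; rewrite wh.
Qed.

(** The three labels, each known at a triple through base point 0, are carried to the triple of the
    apexes themselves, where [tri] applies. *)
Lemma sat_parity i j l e e' e'' : apx i -> apx j -> apx l -> i < j -> j < l ->
  Sat 0 i j (Red e i j) -> Sat 0 j l (Red e' j l) -> Sat 0 i l (Red e'' i l) ->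
  e' = e /\ e'' = ~~ e.
Proof.
move=> hi hj hl ij jl s1 s2 s3.
have t1 := sat_z01 hi hj hl ij jl s1; have t3 := sat_z02 hi hl hj ij jl s3.
have t2 : Sat i j l (R p1 p2 j l (redp e')) by apply: (@sat_12 _ _ _ i) s2 => //; lia.
apply: contrapT => ne; apply: (@sat0 i j l).
apply: sat_mono (sat_mul (sat_mul t1 t2) t3); apply: sub_rep => s rs.
rewrite !(propext (rep_mul _ _ _)) !(propext (repR _ _ _ _ _ rs)).
case=> -[[q1 q2 q3 /andP[a1 /eqP a2]] [_ _ r3 /andP[b1 /eqP b2]]] [_ _ _ /andP[c1 /eqP c2]].
case: ne; have := good_tri (@mgood k) (frame_iq q1) (x := s p0) (y := s p1) (z := s p2) I I I.
rewrite q2 q3 r3 /red a1 b1 c1 !orbT => /(_ _ _ _ isT isT isT).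
have -> : (1 < i) by lia.
have -> : (j < l < 6) by lia.
move=> /(_ isT ij isT) /andP[/eqP e1 /orP[/andP[/eqP z _]|/andP[_ /eqP e2]]].
  by rewrite z in a1.
by rewrite -a2 -b2 -c2 e2 odd_flip e1.
Qed.

(** Triangles 2 3 4 and 2 3 5 give the edges 34 and 35 the parity of 23, while triangle 3 4 5 gives
    them opposite parities. *)
Lemma contradiction : False.
Proof.
have [e23 h23] := @sat_red 2 3 isT isT isT; have [e34 h34] := @sat_red 3 4 isT isT isT.
have [e24 h24] := @sat_red 2 4 isT isT isT; have [e35 h35] := @sat_red 3 5 isT isT isT.
have [e25 h25] := @sat_red 2 5 isT isT isT; have [e45 h45] := @sat_red 4 5 isT isT isT.
have [a _] := @sat_parity 2 3 4 _ _ _ isT isT isT isT isT h23 h34 h24.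
have [b _] := @sat_parity 2 3 5 _ _ _ isT isT isT isT isT h23 h35 h25.
have [_ c] := @sat_parity 3 4 5 _ _ _ isT isT isT isT isT h34 h45 h35.
by move: c; rewrite a b; case: (e23).
Qed.
End Contradiction.
End Core.

(** * Existence of bases and of apexes over them *)

Section Bases.
Variable k : nat.
Notation n := k.+3.
Notation labels I := (('I_k -> I) -> I -> I -> nat).
Notation full := ([set: 'I_n]%SET).
Notation tuples := ('I_n -> nat).
Notation srt := (@msrt k).
Notation lab := (@mlab k).
Notation A := (blur k).
Notation CmA := (Cm (At A)).
Notation p0 := (p0 k).
Notation p1 := (p1 k).
Notation p2 := (p2 k).

Lemma index_cases (a : 'I_n) : [\/ exists m, a = iq m, a = p0, a = p1 | a = p2].
Proof.
have [ak|ka] := ltnP a k.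
  by apply: Or41; exists (Ordinal ak); apply: ord_inj; rewrite val_iq.
have : [|| a == k :> nat, a == k.+1 :> nat | a == k.+2 :> nat].
  by have := ltn_ord a; lia.
by case/or3P=> /eqP e; [apply: Or42|apply: Or43|apply: Or44]; apply: ord_inj;
  rewrite e ?val_p0 ?val_p1 ?val_p2.
Qed.

Lemma base_ex : exists s : tuples, real s /\ baseP s.
Proof.
pose sr (a : 'I_n) := if a < k then 6 + a else a - k.
have [s [h1 h2 h3]] : exists s, matches id full s sr (fun a => a) (fun (g : 'I_k -> 'I_n) (a b : 'I_n) => 1).
  apply: realize => //.
  - by move=> j; rewrite /sr; have := ltn_ord j; case: ifP; lia.
  - by move=> j j' /val_inj ->.
  - have sr3 a : ~ (2 < sr a < 6).
      by rewrite /sr; have := ltn_ord a; case: ifP; lia.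
    split=> // g x y z _ _ _ _ hx hy hz; case: (sr3 z); lia.
have F a : a \in full by rewrite inE.
exists s; split; first by move=> g i j; rewrite /pull h3.
split=> [m|||] /=; rewrite ?h2 ?h3 // /sr.
- by rewrite val_iq ltn_ord.
- by rewrite val_p0 ltnn subnn.
- by rewrite val_p1 ltnNge leqnSn subSnn.
Qed.

Lemma apex_ex j (s : tuples) : 1 < j < 6 -> real s -> baseP s ->
  exists t, [/\ real t, apexP j t & alike id (full :\ p2) s t].
Proof.
move=> hj rs [b1 b2 b3 /eqP b4]; have [n01 n02 n12 nq] := p_neq k.
pose sr a := if a == p2 then j else srt (s a).
(* A value that no [s a] takes, so that the apex is a new point. *)
pose e a := if a == p2 then (\max_a s a).+1 else s a.
pose old (g : 'I_k -> 'I_n) a b := [&& [forall m, g m != p2], a != p2 & b != p2].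
pose T : labels 'I_n := fun g a b => if old g a b then pull s g a b else 1.
have es a b : e a = e b -> (a == p2) = (b == p2) /\ s a = s b.
  rewrite /e; case: (altP (a =P p2)) => [->|ap]; case: (altP (b =P p2)) => [->|bp] //.
  - by move=> h; have := leq_bigmax (F := s) b; rewrite -h ltnn.
  - by move=> h; have := leq_bigmax (F := s) a; rewrite h ltnn.
have srE : [/\ sr p0 = 0, sr p1 = 1, sr p2 = j & forall m, sr (iq m) = 6 + m].
  rewrite /sr eqxx (negbTE n02) (negbTE n12) b2 b3; split=> // m.
  by have [_ _ /negbTE ->] := nq m; apply: b1.
case: srE => s0 s1 s2 sq.
have apexE a : 1 < sr a < 6 -> a = p2.
  by case: (index_cases a) => [[m ->]|->|->|//]; rewrite ?sq ?s0 ?s1 //; lia.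
have [t [h1 h2 h3]] : exists t, matches id full t sr e T.
  apply: realize.
  - by move=> a; rewrite /sr; case: ifP => _; [lia|apply: msrt_bound].
  - by move=> a b /es[h hs]; rewrite /sr h hs.
  - move=> g g' x x' y y' eg /es[ex sx] /es[ey sy].
    have -> : T g x y = if old g' x' y' then pull s g x y else 1.
      rewrite /T /old ex ey; congr (if _ && _ then _ else _).
      by apply: eq_forallb => m; case: (es _ _ (eg m)) => ->.
    rewrite /T /pull sx sy; case: ifP => // _; congr (lab _ _ _); apply/funext => m /=.
    by case: (es _ _ (eg m)).
  - split.
    + move=> g a b z fg _ _ _ sa sb /apexE -> _ _.
      have -> : a = p0.
        by case: (index_cases a) sa => [[m ->]|->|->|->] //; rewrite ?sq ?s1 ?s2; lia.
      have -> : b = p1.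
        by case: (index_cases b) sb => [[m ->]|->|->|->] //; rewrite ?sq ?s0 ?s2; lia.
      have -> : g = @iq k.
        apply/funext => m; have [_] := fg m.
        case: (index_cases (g m)) => [[m' ->]|->|->|->]; rewrite ?sq ?s0 ?s1 ?s2; try lia.
        by move=> /addnI/val_inj ->.
      have pe : pull s (@iq k) p0 p1 = 1 by rewrite /pull -b4.
      by rewrite /T pe; case: ifP.
    + move=> g h z z' _ _ _ _ _ hz hz'.
      have z2 : z = p2 by apply: apexE; lia.
      have z2' : z' = p2 by apply: apexE; lia.
      by move: hz'; rewrite z2 z2' ltnn.
    + move=> g x y z _ _ _ _ hx hxy hyz.
      have x2 : x = p2 by apply: apexE; lia.
      have y2 : y = p2 by apply: apexE; lia.
      by move: hxy; rewrite x2 y2 ltnn.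
have F a : a \in full by rewrite inE.
have new g a b : ~~ old g a b -> lab (t \o g) (t a) (t b) = 1.
  by move=> o; rewrite [LHS]h3 // /T (negbTE o).
have oldT g a b : old g a b -> lab (t \o g) (t a) (t b) = pull s g a b.
  by move=> o; rewrite [LHS]h3 // /T o.
have qt m : srt ((t \o @iq k) m) = 6 + m by rewrite /= h2 // sq.
exists t; split.
- move=> g a b; rewrite /pull; case: (boolP (old g a b)) => [/oldT|/new] -> //; exact: rs.
- split; [|split].
  + split=> //; rewrite ?h2 ?s0 ?s2 // new // /old eqxx !andbF //.
  + split=> //; rewrite ?h2 ?s1 ?s2 // new // /old eqxx !andbF //.
  + rewrite oldT -?b4 // /old n02 n12 !andbT; apply/forallP => m.
    by case: (nq m).
- have off a : a \in full :\ p2 -> a != p2 by rewrite !inE andbT.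
  split=> [a b /off aF /off bF|a /off aF|g a b gF /off aF /off bF].
  + by rewrite h1 // /e (negbTE aF) (negbTE bF).
  + by rewrite /= h2 // /sr (negbTE aF).
  + rewrite /pull oldT // /old aF bF !andbT; apply/forallP => m; exact/off/gF.
Qed.

(** The right-hand side is the same for all [j]: every base carries apexes of all four sorts, which
    can be added one after another. *)
Lemma qC_apex j : 1 < j < 6 -> qC p2 (@apex_set k j) = @base_set k.
Proof.
move=> hj; have [n01 n02 n12 nq] := p_neq k.
apply: rep_ext => s rs; rewrite (propext (rep_qC _ _ rs)) (propext (repR _ _ _ _ _ rs)).
split=> [[t [rt /(rep_apex _ rt) [P1 [P2 P3]] st]]|bs].
  have Pt : baseP t.
    by case: P1 P2 => q1 q2 _ _ [_ r2 _ _]; split=> //; rewrite P3.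
  apply: pairP_alike (alike_sym st) Pt => [m||]; rewrite !inE ?andbT //.
  by case: (nq m).
have [t [rt at_ st]] := apex_ex hj rs bs; exists t; split=> //.
exact/rep_apex.
Qed.

Lemma base_neq0 : @base_set k <> zero.
Proof.
move=> e; have [s [rs bs]] := base_ex; apply/(@rep_zero k s).
by rewrite -e; apply/repR.
Qed.
End Bases.

(** * No neat embedding *)

Section Boolean.
Variables (m : nat) (P : signature m) (S : alg P).
Hypothesis bS : boolean S.

Lemma mulxx (x : S) : mul x x = x.
Proof. by rewrite -[RHS](ba_mul1 bS) -(ba_addN bS x) (ba_mulDr bS) (ba_mulN bS) (ba_add0 bS). Qed.

Lemma mul0 (x : S) : mul x zero = zero.
Proof. by rewrite -(ba_mulN bS x) (ba_mulA bS) mulxx. Qed.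

Lemma le_trans (x y z : S) : le x y -> le y z -> le x z.
Proof. by rewrite /le => xy yz; rewrite -[in RHS]xy -yz (ba_mulA bS) xy. Qed.

Lemma le_mul (a x y : S) : le a x -> le a y -> le a (mul x y).
Proof. by rewrite /le => ax ay; rewrite (ba_mulA bS) ax. Qed.

Lemma le_mull (x y : S) : le (mul x y) x.
Proof. by rewrite /le (ba_mulC bS x y) -(ba_mulA bS) mulxx. Qed.

Lemma le_mulr (x y : S) : le (mul x y) y.
Proof. by rewrite /le -(ba_mulA bS) mulxx. Qed.

(** Takes the place of an ultrafilter, as only finitely many elements have to be decided. *)
Lemma decide (I : eqType) (f : I -> S) (a : S) (l : seq I) : a <> zero ->
  exists a', [/\ a' <> zero, le a' a & forall i, i \in l -> le a' (f i) \/ le a' (neg (f i))].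
Proof.
elim: l a => [|i l IH] a a0; first by exists a; split=> //; rewrite /le mulxx.
set x := f i; have [b [bx b0 ba]] : exists b, [/\ le b x \/ le b (neg x), b <> zero & le b a].
  have [e|ne] := pselect (mul a x = zero).
    exists (mul a (neg x)); split; [by right; apply: le_mulr| |exact: le_mull].
    by move=> e'; apply: a0; rewrite -[a](ba_mul1 bS) -(ba_addN bS x) (ba_mulDr bS) e e' (ba_add0 bS).
  by exists (mul a x); split; [left; apply: le_mulr| |exact: le_mull].
have [c [c0 cb cl]] := IH b b0; exists c; split=> //; first exact: le_trans cb ba.
move=> j; rewrite inE => /orP[/eqP ->|/cl//]; case: bx => h; [left|right]; exact: le_trans cb h.
Qed.
End Boolean.

Section Nodes.
Variables (k m : nat) (hm : k.+3 + 3 <= m).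

Lemma m_gt0 : 0 < m.
Proof. by move: hm; lia. Qed.

Definition node v : 'I_m := insubd (Ordinal m_gt0) v.
(** The nodes follow the k frame coordinates: nodes 0, 1, 2 are the last coordinates of dimension n,
    and nodes 3, 4, 5 the three extra ones. *)
Definition nd x := node (k + x).

Lemma val_node v : v < k + 6 -> node v = v :> nat.
Proof. by move=> vk; rewrite /node val_insubd; move: hm; case: ifP => //; lia. Qed.

Lemma val_nd x : x < 6 -> nd x = k + x :> nat.
Proof. by move=> x6; rewrite val_node // ltn_add2l. Qed.

Lemma nd_eq x y : x < 6 -> y < 6 -> (nd x == nd y) = (x == y).
Proof. by move=> hx hy; rewrite -val_eqE /= !val_nd // eqn_add2l. Qed.
End Nodes.

Section Neat.
Variables (k m : nat) (nm : k.+3 <= m) (hm : k.+3 + 3 <= m) (S : alg (@sc_sig m)).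
Notation n := k.+3.
Notation CmA := (Cm (At (blur k))).
Hypothesis HS : Sc S.

Definition free i (x : S) := scC i x = x.

Lemma sub_free i j x : free i x -> scS i j x = x.
Proof. by move=> fx; rewrite -fx (sc_sc HS). Qed.

Lemma free_sub c i j x : c != i -> c != j -> free c x -> free c (scS i j x).
Proof. by move=> ci cj fx; rewrite /free -(sc_sck HS) ?fx // !inE negb_or ci cj. Qed.

Lemma free_mul c (x y : S) : free c x -> free c y -> free c (mul x y).
Proof. by rewrite /free => fx fy; rewrite -{1}fy (sc_cM HS) fx fy. Qed.

Lemma sub_through l i j x : l != j -> l != i -> free l x -> scS l i (scS j l x) = scS j i x.
Proof. by move=> lj li fx; rewrite (sc_ss HS) sub_free //; apply: free_sub. Qed.

Lemma cyl_sub i j x : free j x -> scC j (scS i j x) = scC i x.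
Proof. by move=> fx; rewrite (sc_csji HS) [scS j i x]sub_free. Qed.

Variable F : CmA -> S.
Notation wd := (widen_ord nm).
Hypothesis F_mul : forall X Y, F (mul X Y) = mul (F X) (F Y).
Hypothesis F_neg : forall X, F (neg X) = neg (F X).
Hypothesis F_zero : F zero = zero.
Hypothesis F_inj : injective F.
Hypothesis F_neat : forall (i : 'I_m) X, n <= i -> free i (F X).
Hypothesis F_cyl : forall i X, F (qC i X) = scC (wd i) (F X).
Hypothesis F_sub : forall i j X, F (qS i j X) = scS (wd i) (wd j) (F X).

Notation nd := (nd hm).

Lemma wd0 : wd (p0 k) = nd 0.
Proof. by apply: ord_inj; rewrite val_nd //= val_p0 addn0. Qed.
Lemma wd1 : wd (p1 k) = nd 1.
Proof. by apply: ord_inj; rewrite val_nd //= val_p1 addn1. Qed.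
Lemma wd2 : wd (p2 k) = nd 2.
Proof. by apply: ord_inj; rewrite val_nd //= val_p2 addn2. Qed.

(** For the arguments that occur, [y] is not 0 and [z] is an apex, so the successive replacements
    amount to a simultaneous one. *)
Definition sub3 x y z (X : CmA) := scS (nd 0) (nd x) (scS (nd 1) (nd y) (scS (nd 2) (nd z) (F X))).

Lemma bS : boolean S. Proof. exact: sc_bool HS. Qed.

Lemma sub3_mul x y z X Y : sub3 x y z (mul X Y) = mul (sub3 x y z X) (sub3 x y z Y).
Proof. by rewrite /sub3 F_mul !(be_mul (sc_endo HS _ _)). Qed.

Lemma sub3_neg x y z X : sub3 x y z (neg X) = neg (sub3 x y z X).
Proof. by rewrite /sub3 F_neg !(be_neg (sc_endo HS _ _)). Qed.

Lemma sub3_zero x y z : sub3 x y z zero = zero.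
Proof. by rewrite /sub3 F_zero !(be_zero (sc_endo HS _ _)). Qed.

Section Relation.
Variables (c d : nat) (phi : nat -> bool).
Let r01 := F (R (p0 k) (p1 k) c d phi).
Let r02 := F (R (p0 k) (p2 k) c d phi).
Let r12 := F (R (p1 k) (p2 k) c d phi).

Lemma r01_free : free (nd 2) r01.
Proof.
have [n01 n02 n12 nq] := p_neq k.
by rewrite /free -wd2 -F_cyl R_free // => q; case: (nq q).
Qed.

Lemma r02_free : free (nd 1) r02.
Proof.
have [n01 n02 n12 nq] := p_neq k.
by rewrite /free -wd1 -F_cyl R_free // 1?eq_sym // => q; case: (nq q).
Qed.

Lemma r12_free : free (nd 0) r12.
Proof.
have [n01 n02 n12 nq] := p_neq k.
by rewrite /free -wd0 -F_cyl R_free // 1?eq_sym // => q; case: (nq q).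
Qed.

Lemma r02E : r02 = scS (nd 1) (nd 2) r01.
Proof. by rewrite /r02 -R_s12 F_sub wd1 wd2. Qed.

Lemma r12E : r12 = scS (nd 0) (nd 1) r02.
Proof. by rewrite /r12 -R_s01 F_sub wd0 wd1. Qed.

Notation apx j := (1 < j < 6).
Notation Rcd a b := (R a b c d phi).

Lemma r02_sub z : apx z -> scS (nd 2) (nd z) r02 = scS (nd 1) (nd z) r01.
Proof.
move=> hz; rewrite r02E; have [->|z2] := eqVneq z 2; first by rewrite (sc_sii HS).
apply: sub_through; last exact: r01_free; rewrite nd_eq //; lia.
Qed.

Lemma sub3_a01 z z' : apx z -> apx z' -> sub3 0 1 z (Rcd (p0 k) (p2 k)) = sub3 0 z z' (Rcd (p0 k) (p1 k)).
Proof.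
move=> hz hz'; rewrite /sub3 !(sc_sii HS) -/r01 -/r02 r02_sub //.
by rewrite [in RHS](sub_free _ r01_free).
Qed.

Lemma r02_sub_free z : apx z -> free (nd 1) (scS (nd 2) (nd z) r02).
Proof. by move=> hz; apply: free_sub r02_free; rewrite nd_eq //; lia. Qed.

Lemma sub3_a02 z z' : apx z -> sub3 0 1 z (Rcd (p0 k) (p2 k)) = sub3 0 z' z (Rcd (p0 k) (p2 k)).
Proof.
by move=> hz; rewrite /sub3 !(sc_sii HS) -/r02 (sub_free _ (r02_sub_free hz)).
Qed.

Lemma r12_sub z : apx z -> scS (nd 2) (nd z) r12 = scS (nd 0) (nd 1) (scS (nd 2) (nd z) r02).
Proof.
move=> hz; rewrite r12E; have [->|z2] := eqVneq z 2; first by rewrite !(sc_sii HS).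
by apply: (sc_ssC HS); rewrite /= !inE !nd_eq //; lia.
Qed.

Lemma sub3_b02 z z' : apx z -> sub3 0 1 z (Rcd (p1 k) (p2 k)) = sub3 1 z' z (Rcd (p0 k) (p2 k)).
Proof.
move=> hz; rewrite /sub3 !(sc_sii HS) -/r02 -/r12 r12_sub //.
by rewrite (sub_free _ (r02_sub_free hz)).
Qed.

Lemma sub3_b01 z z' : apx z -> apx z' ->
  sub3 0 1 z (Rcd (p1 k) (p2 k)) = sub3 1 z z' (Rcd (p0 k) (p1 k)).
Proof.
move=> hz hz'; rewrite /sub3 !(sc_sii HS) -/r01 -/r12 r12_sub // r02_sub //.
by rewrite [in RHS](sub_free _ r01_free).
Qed.

Lemma sub3_12 x x' z z' : apx z -> apx z' -> sub3 x z z' (Rcd (p1 k) (p2 k)) = sub3 x' z z' (Rcd (p1 k) (p2 k)).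
Proof.
move=> hz hz'; rewrite /sub3 -/r12.
have f : free (nd 0) (scS (nd 1) (nd z) (scS (nd 2) (nd z') r12)).
  by do 2!(apply: free_sub; rewrite ?nd_eq //; try lia); apply: r12_free.
by rewrite !(sub_free _ f).
Qed.

Lemma sub3_z z z' : apx z -> apx z' ->
  sub3 0 z z' (Rcd (p1 k) (p2 k)) = scS (nd 0) (nd z) (scS (nd 2) (nd z') r02).
Proof.
move=> hz hz'; rewrite /sub3 (sc_sii HS) -/r12 r12_sub //.
apply: sub_through; last exact: r02_sub_free; rewrite nd_eq //; lia.
Qed.

Lemma sub3_z02 z z' z'' : apx z -> apx z' ->
  sub3 0 z z' (Rcd (p1 k) (p2 k)) = sub3 z z'' z' (Rcd (p0 k) (p2 k)).
Proof. by move=> hz hz'; rewrite sub3_z // /sub3 -/r02 (sub_free _ (r02_sub_free hz')). Qed.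

Lemma sub3_z01 z z' z'' : apx z -> apx z' ->
  sub3 0 z z' (Rcd (p1 k) (p2 k)) = sub3 z z' z'' (Rcd (p0 k) (p1 k)).
Proof. by move=> hz hz'; rewrite sub3_z // r02_sub // /sub3 -/r01 [in RHS](sub_free _ r01_free). Qed.
End Relation.

Definition apx_at j := sub3 0 1 j (apex_set j).
Let beta := F (@base_set k).

Lemma apx_atE j : apx_at j = scS (nd 2) (nd j) (F (apex_set j)).
Proof. by rewrite /apx_at /sub3 !(sc_sii HS). Qed.

Lemma apx_at_cyl j : 1 < j < 6 -> scC (nd j) (apx_at j) = beta.
Proof.
move=> hj; rewrite apx_atE /beta -(qC_apex k hj) F_cyl wd2.
have [->|j2] := eqVneq j 2; first by rewrite (sc_sii HS).
by apply: cyl_sub; apply: F_neat; rewrite val_nd; lia.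
Qed.

Lemma apx_at_free j l : 1 < j < 6 -> 2 < l < 6 -> l != j -> free (nd l) (apx_at j).
Proof.
move=> hj hl lj; rewrite apx_atE; apply: free_sub; rewrite ?nd_eq //; try lia.
by apply: F_neat; rewrite val_nd; lia.
Qed.

Lemma beta_free l : 1 < l < 6 -> free (nd l) beta.
Proof.
move=> hl; have [->|l2] := eqVneq l 2; first exact: r01_free.
by apply: F_neat; rewrite val_nd; lia.
Qed.

(** Cylindrify the product along [nd j]: [a] comes out and [apx_at j] becomes [beta], so zero equals
    the meet of [a] and [beta], which is [a]. *)
Lemma peel (a : S) j : 1 < j < 6 -> free (nd j) a -> le a beta -> mul a (apx_at j) = zero -> a = zero.
Proof.
move=> hj fa ab e.
have := sc_cM HS (nd j) (apx_at j) a; rewrite fa (apx_at_cyl hj) (ba_mulC bS) e (sc_c0 HS).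
by rewrite (ba_mulC bS) ab.
Qed.

(** In the meet of [beta] with the apexes placed so far the coordinate of the next apex is free, so
    [peel] carries zero back from the full meet to [beta]. *)
Lemma start : exists a : S, a <> zero /\ forall j, 1 < j < 6 -> le a (apx_at j).
Proof.
have nz : beta <> zero by rewrite -F_zero => /F_inj; apply: base_neq0.
pose a2 := mul beta (apx_at 2); pose a3 := mul a2 (apx_at 3).
pose a4 := mul a3 (apx_at 4); pose a5 := mul a4 (apx_at 5).
have l2 : le a2 beta by apply: le_mull bS _ _.
have l3 : le a3 beta by apply: le_trans bS _ _ _ (le_mull bS _ _) l2.
have l4 : le a4 beta by apply: le_trans bS _ _ _ (le_mull bS _ _) l3.
exists a5; split.
  move=> e; apply: nz.
  apply: (@peel _ 2) => //; [exact: beta_free|by rewrite /le (mulxx bS)|].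
  by apply: (@peel _ 3) => //; [|apply: (@peel _ 4) => //; [|apply: (@peel _ 5) => //]];
    repeat (apply: free_mul); try (by apply: apx_at_free); apply: beta_free.
move=> j hj; have h3 : le a5 a3 by apply: (le_trans bS (le_mull bS _ _)); apply: le_mull bS _ _.
have h2 : le a5 a2 by apply: (le_trans bS h3); apply: le_mull bS _ _.
have : [|| j == 2, j == 3, j == 4 | j == 5] by lia.
case/or4P=> /eqP ->.
- by apply: (le_trans bS h2); apply: le_mulr bS _ _.
- by apply: (le_trans bS h3); apply: le_mulr bS _ _.
- by apply: (le_trans bS (le_mull bS _ _)); apply: le_mulr bS _ _.
- by apply: le_mulr bS _ _.
Qed.

Lemma neat_contradiction : False.
Proof.
have [a0 [a00 ha0]] := start.
pose l := [seq (q, e) | q <- [seq (i, j) | i <- iota 2 4, j <- iota 2 4], e <- [:: true; false]].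
have [a [nz aa dec]] := decide bS (fun p => sub3 0 p.1.1 p.1.2 (@Red k p.2 p.1.1 p.1.2)) l a00.
apply: (@contradiction k (fun x y z X => le a (sub3 x y z X))).
- move=> x y z X Y XY h; apply: le_trans bS _ _ _ h _; rewrite /le -sub3_mul; congr (sub3 _ _ _ _).
  exact/setIidPl.
- by move=> x y z X Y h1 h2; rewrite sub3_mul; apply: le_mul bS _ _ _ h1 h2.
- by move=> x y z; rewrite sub3_zero /le (mul0 bS) => /esym.
- by move=> j hj; apply: le_trans bS _ _ _ aa (ha0 j hj).
- move=> i j e hi hj ij; rewrite sub3_neg; apply: (dec ((i, j), e)).
  apply: allpairs_f; last by case: (e).
  by apply: allpairs_f; rewrite mem_iota; lia.
- by move=> c d phi z z' hz hz' _; rewrite (sub3_a01 _ _ _ hz hz').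
- by move=> c d phi z z' hz hz' _; rewrite (sub3_a02 _ _ _ z' hz).
- by move=> c d phi z z' hz hz' _; rewrite (sub3_b02 _ _ _ z' hz).
- by move=> c d phi z z' hz hz' _; rewrite (sub3_b01 _ _ _ hz hz').
- by move=> c d phi x z z' hz hz' *; rewrite (sub3_12 _ _ _ x 0 hz hz').
- by move=> c d phi z z' z'' hz hz' *; rewrite -(sub3_z02 _ _ _ z'' hz hz').
- by move=> c d phi z z' z'' hz hz' *; rewrite -(sub3_z01 _ _ _ z'' hz hz').
Qed.
End Neat.

(** * No square representation *)

Section Square.
Variable k : nat.
Notation n := k.+3.
Notation N := (k.+3 + 3).
Notation CmA := (Cm (At (blur k))).
Notation RdA := (Rd_sc (Cm (At (blur k)))).
Notation srt := (@msrt k).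
Notation p0 := (p0 k).
Notation p1 := (p1 k).
Notation p2 := (p2 k).
Notation node := (@node k N (leqnn N)).
Notation nd := (@nd k N (leqnn N)).

Definition place x y z (a : 'I_n) : 'I_N :=
  if a < k then node a else if a == p0 then nd x else if a == p1 then nd y else nd z.

Lemma place_p0 x y z : place x y z p0 = nd x.
Proof. by rewrite /place val_p0 ltnn eqxx. Qed.

Lemma place_p1 x y z : place x y z p1 = nd y.
Proof.
have [n01 _ _ _] := p_neq k.
by rewrite /place val_p1 ltnNge leqnSn /= eq_sym (negbTE n01) eqxx.
Qed.

Lemma place_p2 x y z : place x y z p2 = nd z.
Proof.
have [_ n02 n12 _] := p_neq k.
by rewrite /place val_p2 ltnNge leqW ?leqnSn //= eq_sym (negbTE n02) eq_sym (negbTE n12).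
Qed.

Lemma place_iq x y z m : place x y z (iq m) = node m.
Proof. by rewrite /place val_iq ltn_ord. Qed.

Definition placeE := (place_p0, place_p1, place_p2, place_iq).

Lemma place_ext (F G : 'I_n -> 'I_N) : (forall m, F (iq m) = G (iq m)) ->
  F p0 = G p0 -> F p1 = G p1 -> F p2 = G p2 -> F = G.
Proof. by move=> *; apply/funext => a; case: (index_cases a) => [[m ->]|->|->|->]. Qed.

Lemma place_repl12 x y z : place x y z \o repl p1 p2 = place x z z.
Proof.
have [n01 n02 n12 nq] := p_neq k.
apply: place_ext => [m|||]; rewrite /= /repl ?eqxx ?placeE //.
- by have [_ /negbTE -> _] := nq m; rewrite placeE.
- by rewrite (negbTE n01) placeE.
- by case: ifP; rewrite placeE.
Qed.

Lemma place_repl01 x y z : place x y z \o repl p0 p1 = place y y z.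
Proof.
have [n01 n02 n12 nq] := p_neq k.
apply: place_ext => [m|||]; rewrite /= /repl ?eqxx ?placeE //.
- by have [/negbTE -> _ _] := nq m; rewrite placeE.
- by case: ifP; rewrite placeE.
- by rewrite eq_sym (negbTE n02) placeE.
Qed.

Lemma place_inj x y z : x < 6 -> y < 6 -> z < 6 -> x != y -> x != z -> y != z ->
  injective (place x y z).
Proof.
move=> hx hy hz xy xz yz a b.
have v c : place x y z c = (if c < k then nat_of_ord c else if c == p0 then k + x else if c == p1 then k + y else k + z) :> nat.
  case: (index_cases c) => [[m ->]|->|->|->]; rewrite placeE ?val_nd //.
  - by rewrite val_iq ltn_ord val_node //; have := ltn_ord m; lia.
  - by rewrite val_p0 ltnn eqxx.
  - by have [n01 _ _ _] := p_neq k; rewrite val_p1 ltnNge leqnSn /= eq_sym (negbTE n01) eqxx.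
  - have [_ n02 n12 _] := p_neq k.
    by rewrite val_p2 ltnNge leqW ?leqnSn //= eq_sym (negbTE n02) eq_sym (negbTE n12).
move=> /(congr1 (fun i : 'I_N => i : nat)); rewrite !v => e.
apply: ord_inj; move: e.
rewrite -!val_eqE /= val_p0 val_p1.
by have := ltn_ord a; have := ltn_ord b; repeat (case: ifP => //= ?); lia.
Qed.

Definition apex_sort j (a : 'I_n) := if a < k then 6 + a else if a == k.+2 :> nat then j else a - k.

Lemma apexP_sort j s a : apexP j s -> srt (s a) = apex_sort j a.
Proof.
case=> -[q1 q2 q3 _] [[_ r2 _ _] _]; rewrite /apex_sort.
case: (index_cases a) => [[m ->]|->|->|->].
- by rewrite [LHS]q1 val_iq ltn_ord.
- by rewrite q2 val_p0 ltnn; repeat (case: ifP => //= ?); lia.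
- by rewrite r2 val_p1; repeat (case: ifP => //= ?); lia.
- by rewrite q3 val_p2; repeat (case: ifP => //= ?); lia.
Qed.

Lemma apex_sort_inj j : 1 < j < 6 -> injective (apex_sort j).
Proof.
move=> hj a b; rewrite /apex_sort => e; apply: ord_inj; move: e.
by have := ltn_ord a; have := ltn_ord b; repeat (case: ifP => //= ?); lia.
Qed.

Lemma apex_neq0 j : 1 < j < 6 -> @apex_set k j <> zero.
Proof.
move=> hj e; have [s [rs bs]] := @base_ex k; have [t [rt at_ _]] := apex_ex hj rs bs.
by apply/(@rep_zero k t); rewrite -e; apply/rep_apex.
Qed.

(** In the absence of diagonals, the distinctness of points in a representation is read off from
    replacements: the coordinates of an apex tuple have pairwise different sorts, so identifying two
    of them leaves the set. *)
Lemma apex_sub0 j a b : 1 < j < 6 -> a != b -> qS a b (@apex_set k j) = zero.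
Proof.
move=> hj ab; apply: rep_ext => s rs; rewrite (propext (rep_qS _ _ _ rs)) (propext (rep_zero _)).
split=> // /(rep_apex _ (real_comp _ rs)) h.
have e : srt ((s \o repl a b) a) = srt ((s \o repl a b) b).
  by rewrite /= /repl eqxx; case: ifP.
move: e; rewrite !(apexP_sort _ h) => /(apex_sort_inj hj) e.
by rewrite e eqxx in ab.
Qed.

Lemma apex_meet0 i j : i != j -> mul (@apex_set k i) (@apex_set k j) = zero.
Proof.
move=> ij; apply: rep_ext => s rs; rewrite (propext (rep_mul _ _ _)) (propext (rep_zero _)).
rewrite !(propext (rep_apex _ rs)); split=> // -[[[_ _ e _] _] [[_ _ e' _] _]].
by move: ij; rewrite -e -e' eqxx.
Qed.

Variables (M : Type) (V : set ('I_n -> M)) (f : RdA -> set_alg (@sc_sig n) V).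
Hypothesis rf : rel_rep f.
Hypothesis sf : square f N.

Definition F (X : CmA) : set ('I_n -> M) := f X.
Notation tup := ('I_n -> M).

Lemma F_mul X Y : F (mul X Y) = F X `&` F Y.
Proof. exact: (hom_mul (rr_hom rf)). Qed.
Lemma F_neg X : F (neg X) = V `\` F X.
Proof. exact: (hom_neg (rr_hom rf)). Qed.
Lemma F_zero : F zero = set0.
Proof. exact: (hom_zero (rr_hom rf)). Qed.
Lemma F_one : F one = V.
Proof. exact: (hom_one (rr_hom rf)). Qed.
Lemma F_sub X s : F X s -> V s.
Proof. exact: (rr_sub rf). Qed.
Lemma F_cyl i X (s : tup) : F (qC i X) s <-> V s /\ exists2 t, F X t & agree_off i s t.
Proof. by rewrite /F [f (qC i X)](hom_op (rr_hom rf) (g := Cyl i) isT (fun=> X)). Qed.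
Lemma F_repl i j X (s : tup) : F (qS i j X) s <-> V s /\ F X (s \o repl i j).
Proof. by rewrite /F [f (qS i j X)](hom_op (rr_hom rf) (g := Sub i j) isT (fun=> X)). Qed.

Lemma V_repl i j s : V s -> V (s \o repl i j).
Proof.
move=> Vs; have := F_repl i j one s; rewrite (be_one (qea_s_endo (Cm_QEA k) i j)) F_one.
by case=> /(_ Vs) [].
Qed.

Lemma F_move i X s t : F X s -> V t -> agree_off i t s -> F (qC i X) t.
Proof. by move=> Xs Vt st; apply/F_cyl; split=> //; exists s. Qed.

Lemma apex_inj j s : 1 < j < 6 -> F (apex_set j) s -> injective s.
Proof.
move=> hj h a b e; apply/eqP/negPn/negP => ab.
have : F (qS a b (apex_set j)) s.
  apply/F_repl; split; first exact: F_sub h.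
  suff -> : s \o repl a b = s by [].
  by apply/funext => c /=; rewrite /repl; case: eqP => // ->.
by rewrite apex_sub0 // F_zero.
Qed.

Let iota0 := place 0 1 2.
Lemma iota0_inj : injective iota0. Proof. exact: place_inj. Qed.

Definition chain i : CmA := iteri i (fun j X => qC (inord j) X) (@apex_set k 2).

(** Squareness only continues cliques, so a first clique is needed. A constant tuple is one, having
    no n distinct values, and it satisfies all the cylindrifications of the apex set because [V] is
    closed under replacements. *)
Lemma start_chain : exists t : 'I_N -> M, clique_tuples V t /\ F (chain n) (t \o iota0).
Proof.
have [s s2] : exists s, F (apex_set 2) s.
  apply: contrapT => none; apply: (@apex_neq0 2) => //; apply: (rr_inj rf).
  rewrite -/(F (apex_set 2)) -/(F zero) F_zero; apply/seteqP.
  by split=> // s h; apply: none; exists s.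
pose u i : tup := fun j => if j < i then s ord0 else s j.
have H i : i <= n -> F (chain i) (u i).
  elim: i => [_|i IH hi]; first by have -> : u 0 = s by apply/funext => j; rewrite /u ltn0.
  have ui : u i.+1 = u i \o repl (inord i) ord0.
    apply/funext => j; rewrite /u /= /repl.
    case: (altP (j =P inord i)) => [->|ji]; first by rewrite inordK // leqnn /=; case: ifP.
    suff -> : (j < i.+1) = (j < i) by [].
    rewrite ltnS leq_eqVlt; suff -> : (j == i :> nat) = false by [].
    apply/negbTE; apply: contra ji => /eqP e; apply/eqP/ord_inj.
    by rewrite inordK.
  have Fi := IH (ltnW hi).
  rewrite /chain iteriS; apply: (F_move Fi); first by rewrite ui; apply: V_repl; apply: F_sub Fi.
  by move=> j ji; rewrite ui /= /repl (negbTE ji).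
exists (fun=> s ord0); split.
  move=> a ai ar; have [i0 _ e0] := ar ord0; have [i1 _ e1] := ar ord_max.
  by have := ai ord0 ord_max; rewrite -e0 -e1 => /(_ erefl).
have := H n (leqnn _); have -> // : u n = (fun=> s ord0) \o iota0.
by apply/funext => j; rewrite /u /= ltn_ord.
Qed.

Lemma start_apex : exists t : 'I_N -> M, clique_tuples V t /\ F (apex_set 2) (t \o iota0).
Proof.
suff H i : (exists t : 'I_N -> M, clique_tuples V t /\ F (chain i) (t \o iota0)) ->
    exists t : 'I_N -> M, clique_tuples V t /\ F (apex_set 2) (t \o iota0) by exact: H start_chain.
elim: i => [//|i IH] [t [ct ht]]; apply: IH.
have [t' [ct' _ h]] := sf (i := inord i) (hC := isT) ct iota0_inj ht.
by exists t'.
Qed.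

Lemma grow j : 1 < j < 6 -> exists t : 'I_N -> M, clique_tuples V t /\
  forall i, 1 < i <= j -> F (apex_set i) (t \o place 0 1 i).
Proof.
elim: j => [//|j IH] hj; have [j1|j1] := leqP j 1.
  have [t [ct ht]] := start_apex; exists t; split=> // i hi.
  by have -> : i = 2 by lia.
have [t [ct ht]] := IH ltac:(lia).
have h2 : F (apex_set 2) (t \o iota0) by apply: ht; lia.
have inj2 := @apex_inj 2 _ isT h2.
pose l := place 0 1 j.+1.
have linj : injective l by apply: place_inj => //; lia.
have off a : a != p2 -> l a = iota0 a.
  by case: (index_cases a) => [[m ->]|->|->|->]; rewrite /l /iota0 !placeE // eqxx.
(* The coordinate [l p2] still holds an arbitrary point. If it repeats a frame or base point, the
   tuple is a replacement of one in [V]; otherwise its points are distinct and the clique condition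
   applies. *)
have Vl : V (t \o l).
  have [[a [ap ea]]|new] := pselect (exists a, a != p2 /\ t (l p2) = t (iota0 a)).
    have -> : t \o l = (t \o iota0) \o repl p2 a.
      apply/funext => b; rewrite /= /repl; case: (altP (b =P p2)) => [->|bp] //.
      by rewrite off.
    exact: V_repl (F_sub h2).
  apply: ct => [a b /=|a]; last by exists (l a).
  case: (altP (a =P p2)) => [->|ap]; case: (altP (b =P p2)) => [->|bp] //.
  - by rewrite (off _ bp) => e; case: new; exists b.
  - by rewrite (off _ ap) => e; case: new; exists a.
  - by rewrite !off // => /inj2.
have hl : F (qC p2 (apex_set j.+1)) (t \o l).
  rewrite (qC_apex k hj) -(qC_apex k (isT : 1 < 2 < 6)); apply: (F_move h2 Vl).
  by move=> a ap; rewrite /= off.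
have [t' [ct' tt' h']] := sf (i := p2) (hC := isT) ct linj hl.
exists t'; split=> // i hi; have [->//|ij] := eqVneq i j.+1.
have -> : t' \o place 0 1 i = t \o place 0 1 i; last by apply: ht; lia.
apply/funext => a /=; apply: tt'; rewrite /l place_p2.
case: (index_cases a) => [[m ->]|->|->|->]; rewrite placeE ?nd_eq //; try lia.
by rewrite -val_eqE /= val_nd ?val_node; have := ltn_ord m; lia.
Qed.

Lemma square_contradiction : False.
Proof.
have [t [ct ht]] := @grow 5 isT.
(* Points within one apex tuple differ by [apex_inj]. If two apexes coincided, one tuple would lie
   in two disjoint apex sets. *)
have tinj : injective t.
  have inj l : 1 < l < 6 -> injective (t \o place 0 1 l).
    by move=> hl; apply: (apex_inj hl); apply: ht; lia.
  have cases (i : 'I_N) : (exists a, forall l, i = place 0 1 l a) \/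
      exists2 l, 1 < l < 6 & forall x y, i = place x y l p2.
    have ki := ltn_ord i; have [ik|ik] := ltnP i k.
      left; exists (iq (Ordinal ik)) => l; apply: ord_inj.
      by rewrite place_iq val_node //=; lia.
    have iE : i = nd (i - k) by apply: ord_inj; rewrite val_nd; lia.
    have [i2|i2] := ltnP (i - k) 2; last first.
      by right; exists (i - k) => [|x y]; [lia|rewrite place_p2].
    left; have : (i - k == 0) || (i - k == 1) by lia.
    by case/orP=> /eqP e; [exists p0|exists p1] => l; rewrite placeE iE e.
  move=> i j e; case: (cases i) (cases j) => [[a ia]|[l hl ia]] [[b jb]|[l' hl' jb]].
  - by rewrite (ia 2) (jb 2) in e *; have /(_ a b e) -> := inj 2 isT.
  - by rewrite (ia l') (jb 0 1) in e *; have /(_ a p2 e) -> := inj l' hl'.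
  - by rewrite (ia 0 1) (jb l) in e *; have /(_ p2 b e) -> := inj l hl.
  - have [el|ll'] := eqVneq l l'; first by rewrite (ia 0 1) (jb 0 1) el.
    exfalso; have ti : F (apex_set l) (t \o place 0 1 l) by apply: ht; lia.
    have tj : F (apex_set l') (t \o place 0 1 l') by apply: ht; lia.
    have : F (mul (apex_set l) (apex_set l')) (t \o place 0 1 l).
      rewrite F_mul; split=> //.
      suff -> : t \o place 0 1 l = t \o place 0 1 l' by [].
      apply/funext => a; case: (index_cases a) => [[m ->]|->|->|->] /=; rewrite ?placeE //.
      by move: e; rewrite (ia 0 1) (jb 0 1) !placeE.
    by rewrite apex_meet0 // F_zero.
pose w x y z := t \o place x y z.
have Vw x y z : x < 6 -> y < 6 -> z < 6 -> x != y -> x != z -> y != z -> V (w x y z).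
  move=> hx hy hz xy xz yz; apply: ct => [a b /tinj|a]; last by exists (place x y z a).
  exact: place_inj.
have [n01 n02 n12 nq] := p_neq k.
have r12 c d phi x y z : F (R p0 p2 c d phi) (w x y z) -> F (R p0 p1 c d phi) (w x z z).
  by rewrite -R_s12 => /F_repl[_]; rewrite /w -(place_repl12 x y z).
have r01 c d phi x y z : F (R p1 p2 c d phi) (w x y z) -> F (R p0 p2 c d phi) (w y y z).
  by rewrite -R_s01 => /F_repl[_]; rewrite /w -(place_repl01 x y z).
have mv2 x y z z' c d phi : F (R p0 p1 c d phi) (w x y z) -> V (w x y z') ->
    F (R p0 p1 c d phi) (w x y z').
  move=> h Vt; rewrite -(@R_free k p2) //; last by move=> m; case: (nq m).
  apply: (F_move h Vt) => a ap; rewrite /w /=.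
  by case: (index_cases a) ap => [[m ->]|->|->|->] //; rewrite ?placeE // eqxx.
have mv1 x y y' z c d phi : F (R p0 p2 c d phi) (w x y z) -> V (w x y' z) ->
    F (R p0 p2 c d phi) (w x y' z).
  move=> h Vt; rewrite -(@R_free k p1) //; [|by move=> m; case: (nq m)|by rewrite eq_sym].
  apply: (F_move h Vt) => a ap; rewrite /w /=.
  by case: (index_cases a) ap => [[m ->]|->|->|->] //; rewrite ?placeE // eqxx.
have mv0 x x' y z c d phi : F (R p1 p2 c d phi) (w x y z) -> V (w x' y z) ->
    F (R p1 p2 c d phi) (w x' y z).
  move=> h Vt; rewrite -(@R_free k p0); last by rewrite eq_sym.
  - apply: (F_move h Vt) => a ap; rewrite /w /=.
    by case: (index_cases a) ap => [[m ->]|->|->|->] //; rewrite ?placeE // eqxx.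
  - by move=> m; case: (nq m).
  - by rewrite eq_sym.
apply: (@contradiction k (fun x y z X => F X (w x y z))).
- move=> x y z X Y XY h; have : F (mul (X : CmA) (Y : CmA)) (w x y z) by have -> : mul (X : CmA) (Y : CmA) = X by apply/setIidPl.
  by rewrite F_mul => -[].
- by move=> x y z X Y h1 h2; rewrite F_mul.
- by move=> x y z; rewrite F_zero.
- by move=> j hj; apply: ht; lia.
- move=> j l e hj hl jl; rewrite F_neg.
  have [h|h] := pselect (F (Red e j l) (w 0 j l)); first by left.
  by right; split=> //; apply: Vw; lia.
- by move=> c d phi z z' hz hz' ne h; apply: (@mv2 0 z z z'); [apply: r12; apply: h|apply: Vw; lia].
- by move=> c d phi z z' hz hz' ne h; apply: (@mv1 0 1 z' z); [exact: h|apply: Vw; lia].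
- by move=> c d phi z z' hz hz' ne h; apply: (@mv1 1 1 z' z); [apply: r01 h|apply: Vw; lia].
- move=> c d phi z z' hz hz' ne h.
  by apply: (@mv2 1 z z z'); [apply: r12; apply: r01 h|apply: Vw; lia].
- by move=> c d phi x z z' hz hz' lt hx xz xz' h; apply: (@mv0 0 x z z'); [exact: h|apply: Vw; lia].
- move=> c d phi z z' z'' hz hz' hz'' lt lt' h.
  by apply: (@mv1 z z z'' z'); [apply: r01 h|apply: Vw; lia].
- move=> c d phi z z' z'' hz hz' hz'' lt lt' h.
  by apply: (@mv2 z z' z' z''); [apply: r12; apply: r01 h|apply: Vw; lia].
Qed.
End Square.

(** * The theorem *)

Lemma hom_eval n (P : signature n) (A B : alg P) (f : A -> B) (t : term P) v :
  hom f -> f (eval v t) = eval (fun i => f (v i)) t.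
Proof.
move=> hf; elim: t => //=.
- exact: hom_zero hf.
- exact: hom_one hf.
- by move=> t <- u <-; apply: hom_add hf _ _.
- by move=> t <- u <-; apply: hom_mul hf _ _.
- by move=> t <-; apply: hom_neg hf _.
- move=> g h ts IH; rewrite (hom_op hf); congr (op _ _ _); exact/funext.
Qed.

(** A member of the variety is only known to satisfy the equations valid in Sc. Each axiom of Sc is
    such an equation, the side conditions concerning indices alone. *)
Lemma Sc_equational m (S : alg (@sc_sig m)) :
  (forall e, valid (@Sc m) e -> sat S e) -> Sc S.
Proof.
move=> H.
pose T := term (@sc_sig m).
pose x0 : T := TVar _ 0; pose x1 : T := TVar _ 1; pose x2 : T := TVar _ 2.
pose C i (t : T) : T := @TOp _ (@sc_sig m) (Cyl i) isT (fun=> t).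
pose U i j (t : T) : T := @TOp _ (@sc_sig m) (Sub i j) isT (fun=> t).
pose v (x y z : S) i := nth z [:: x; y] i.
have ax (t u : T) : (forall A : alg (@sc_sig m), Sc A -> forall w, eval (A := A) w t = eval w u) ->
    forall x y z : S, eval (v x y z) t = eval (v x y z) u.
  by move=> h x y z; apply: (H (t, u)).
split.
- split.
  + by move=> x y; apply: (ax (TAdd x0 x1) (TAdd x1 x0) _ x y x) => A hA w; apply: ba_addC (sc_bool hA) _ _.
  + by move=> x y; apply: (ax (TMul x0 x1) (TMul x1 x0) _ x y x) => A hA w; apply: ba_mulC (sc_bool hA) _ _.
  + by move=> x y z; apply: (ax (TAdd x0 (TAdd x1 x2)) (TAdd (TAdd x0 x1) x2) _ x y z) => A hA w; apply: ba_addA (sc_bool hA) _ _ _.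
  + by move=> x y z; apply: (ax (TMul x0 (TMul x1 x2)) (TMul (TMul x0 x1) x2) _ x y z) => A hA w; apply: ba_mulA (sc_bool hA) _ _ _.
  + by move=> x y z; apply: (ax (TMul x0 (TAdd x1 x2)) (TAdd (TMul x0 x1) (TMul x0 x2)) _ x y z) => A hA w; apply: ba_mulDr (sc_bool hA) _ _ _.
  + by move=> x y z; apply: (ax (TAdd x0 (TMul x1 x2)) (TMul (TAdd x0 x1) (TAdd x0 x2)) _ x y z) => A hA w; apply: ba_addMr (sc_bool hA) _ _ _.
  + by move=> x; apply: (ax (TAdd x0 (TZero _)) x0 _ x x x) => A hA w; apply: ba_add0 (sc_bool hA) _.
  + by move=> x; apply: (ax (TMul x0 (TOne _)) x0 _ x x x) => A hA w; apply: ba_mul1 (sc_bool hA) _.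
  + by move=> x; apply: (ax (TAdd x0 (TNeg x0)) (TOne _) _ x x x) => A hA w; apply: ba_addN (sc_bool hA) _.
  + by move=> x; apply: (ax (TMul x0 (TNeg x0)) (TZero _) _ x x x) => A hA w; apply: ba_mulN (sc_bool hA) _.
- by move=> i; apply: (ax (C i (TZero _)) (TZero _) _ zero zero zero) => A hA w; apply: sc_c0 hA _.
- by move=> i x; apply: (ax (TMul x0 (C i x0)) x0 _ x x x) => A hA w; apply: sc_le_c hA _ _.
- by move=> i x y; apply: (ax (C i (TMul x0 (C i x1))) (TMul (C i x0) (C i x1)) _ x y x) => A hA w; apply: sc_cM hA _ _ _.
- by move=> i j x; apply: (ax (C i (C j x0)) (C j (C i x0)) _ x x x) => A hA w; apply: sc_cC hA _ _ _.
- by move=> i x; apply: (ax (U i i x0) x0 _ x x x) => A hA w; apply: sc_sii hA _ _.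
- move=> i j; split.
  + by move=> x y; apply: (ax (U i j (TAdd x0 x1)) (TAdd (U i j x0) (U i j x1)) _ x y x) => A hA w; apply: be_add (sc_endo hA _ _) _ _.
  + by move=> x y; apply: (ax (U i j (TMul x0 x1)) (TMul (U i j x0) (U i j x1)) _ x y x) => A hA w; apply: be_mul (sc_endo hA _ _) _ _.
  + by move=> x; apply: (ax (U i j (TNeg x0)) (TNeg (U i j x0)) _ x x x) => A hA w; apply: be_neg (sc_endo hA _ _) _.
  + by apply: (ax (U i j (TZero _)) (TZero _) _ zero zero zero) => A hA w; apply: be_zero (sc_endo hA _ _).
  + by apply: (ax (U i j (TOne _)) (TOne _) _ zero zero zero) => A hA w; apply: be_one (sc_endo hA _ _).
- by move=> i j x; apply: (ax (U i j (C i x0)) (C i x0) _ x x x) => A hA w; apply: sc_sc hA _ _ _.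
- by move=> i j x ij; apply: (ax (C i (U i j x0)) (U i j x0) _ x x x) => A hA w; apply: sc_cs hA _ _ _ ij.
- by move=> i j l x lij; apply: (ax (U i j (C l x0)) (C l (U i j x0)) _ x x x) => A hA w; apply: sc_sck hA _ _ _ _ lij.
- by move=> i j x; apply: (ax (C i (U j i x0)) (C j (U i j x0)) _ x x x) => A hA w; apply: sc_csji hA _ _ _.
- by move=> i j l l' x u; apply: (ax (U j i (U l' l x0)) (U l' l (U j i x0)) _ x x x) => A hA w; apply: sc_ssC hA _ _ _ _ _ u.
- by move=> i j l x; apply: (ax (U l i (U j l x0)) (U l i (U j i x0)) _ x x x) => A hA w; apply: sc_ss hA _ _ _ _.
Qed.

Lemma blur_not_SNr k (K : between) m : k.+3 + 3 <= m ->
  ~ SNr m (Cm (At (reduct (fun f (_ : @bt_sig K k.+3 f) => isT : qea_sig f) (blur k)))).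
Proof.
move=> hm [nm [B [KB [f [hf fi fn]]]]].
have m2 : 2 < m by move: hm; lia.
pose S := sc_of (@bt_cyl K m) (@bt_sub K m) B.
have HS : Sc S by apply: Sc_equational => e he; apply: (bt_above m2 he KB).
(* Atoms depend on the Boolean operations only, so [f] is also a map on the complex algebra of the
   full signature. *)
apply: (@neat_contradiction k m (ltnW nm) hm S HS (f : Cm (At (blur k)) -> S)).
- by move=> X Y; apply: (hom_mul hf).
- by move=> X; apply: (hom_neg hf).
- exact: (hom_zero hf).
- exact: fi.
- by move=> i X ni; apply: (fn X i ni).
- move=> i X; rewrite [LHS](hom_op hf (g := Cyl i) (bt_cyl K i) (fun=> X)) /scC /=.
  by congr (op _ _ _); apply: bool_irrelevance.
(* In the complex algebra [qS i j] is the value of the term [bt_sub i j]; the term passes through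
   [f], and [bt_sub_widen] identifies it with the term of dimension m. *)
- move=> i j X; rewrite (bt_sub_qea K (n := k.+3) isT (Cm_QEA k) i j X).
  rewrite [LHS](hom_eval _ _ hf).
  exact: (bt_sub_widen (ltnW nm) isT KB i j (f X)).
Qed.

Theorem theorem4p6 (n : nat) (hn : 2 < n) (K : between) (m : nat) (hm : n + 3 <= m) :
  (exists D : alg (@bt_sig K n), [/\ RK D, atomic D & ~ SNr m (Cm (At D))]) /\
  (exists A : alg (@qea_sig n),
     [/\ RQEA A, countable [set: A], atomic A, simple A
       & ~ has_square_rep (Rd_sc (Cm (At A))) (n + 3) /\
         ~ has_flat_rep (Rd_sc (Cm (At A))) (n + 3)]).
Proof.
case: n hn hm => [|[|[|k]]] // _ hm; split.
  exists (reduct (fun f (_ : @bt_sig K k.+3 f) => isT : qea_sig f) (blur k)); split.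
  - exact: blur_representable.
  - exact: blur_atomic.
  - exact: blur_not_SNr.
have nsq : ~ has_square_rep (Rd_sc (Cm (At (blur k)))) (k.+3 + 3).
  by move=> [M [V [f [rf sf]]]]; apply: (square_contradiction rf sf).
exists (blur k); split.
- exact: blur_RQEA.
- exact: blur_countable.
- exact: blur_atomic.
- exact: blur_simple.
- by split=> // -[M [V [f [rf [sf _]]]]]; apply: nsq; exists M, V, f.
Qed.
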